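(* Let $\mathfrak{g}$ be a finite-dimensional complex semisimple Lie algebra with Cartan subalgebra $\mathfrak{h}$, root system $\Phi$ and base $\Delta$. Let $T$ be a closed subset of $\Phi$, let $\mathfrak{t}$ be a subalgebra of $\mathfrak{h}$ containing $[\mathfrak{g}_\alpha,\mathfrak{g}_{-\alpha}]$ for each $\alpha\in T^r$, and let $\lambda\in\Lambda^+$ be a dominant weight. Then the regular subalgebra $\mathfrak{s}_{T,\mathfrak{t}}$ is $\lambda$-wide if and only if $[T\cup -T]\cdot\lambda = V(\lambda)$.
   Context: All Lie algebras and modules are finite-dimensional over $\mathbb{C}$. $\mathfrak{g}_\alpha$ is the root space of $\alpha\in\Phi$; $\Phi^+$, $\Phi^-=-\Phi^+$ are the positive and negative roots with respect to $\Delta$; $e_\alpha$ denotes a nonzero element of $\mathfrak{g}_\alpha$. $\Lambda^+$ is the set of dominant integral weights with respect to $\Delta$. $V(\lambda)$ is the simple $\mathfrak{g}$-module of highest weight $\lambda$, and $v_\lambda$ is a fixed highest weight vector. A subset $T\subseteq\Phi$ is closed if $x,y\in T$ and $x+y\in\Phi$ imply $x+y\in T$. For closed $T$, $T^r=\{\alpha\in T\mid -\alpha\in T\}$. For $S\subseteq\Phi$, $[S]$ is the smallest closed subset of $\Phi$ containing $S$; $-T=\{-\alpha\mid\alpha\in T\}$. $\mathfrak{s}_{T,\mathfrak{t}} := \mathfrak{t}\oplus\bigoplus_{\alpha\in T}\mathfrak{g}_\alpha$, a subalgebra of $\mathfrak{g}$. $[T\cup -T]\cdot\lambda := \mathrm{Span}\{e_{-\beta_1}\cdots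 e_{-\beta_m}\cdot v_\lambda \mid m\ge 0,\ -\beta_j\in[T\cup -T]\cap\Phi^-\text{ for all } j\}\subseteq V(\lambda)$, where the $\beta_j$ need not be distinct, and $m=0$ gives $v_\lambda$ itself. A subalgebra $\mathfrak{s}\subseteq\mathfrak{g}$ is $\lambda$-wide if $V(\lambda)$ is indecomposable as an $\mathfrak{s}$-module (i.e. is not a direct sum of two nonzero $\mathfrak{s}$-submodules). *)

(* Defs.v *)
From HB Require Import structures.
From mathcomp Require Import all_boot all_order all_algebra.
From mathcomp Require Import boolp classical_sets reals.
From mathcomp Require Export complex.

Set Implicit Arguments.
Unset Strict Implicit.
Unset Printing Implicit Defensive.

Import GRing.Theory.
Local Open Scope classical_set_scope.
Local Open Scope ring_scope.

HB.mixin Record Vector_isLieAlgebra (F : fieldType) L of Vector F L := {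
  lie : L -> L -> L;
  lie_linearl : forall y, linear (lie^~ y);
  lie_linearr : forall x, linear (lie x);
  liexx : forall x, lie x x = 0;
  lie_jacobi : forall x y z,
    lie x (lie y z) + lie y (lie z x) + lie z (lie x y) = 0
}.

#[short(type="lieAlgType")]
HB.structure Definition LieAlgebra (F : fieldType) :=
  {L of Vector_isLieAlgebra F L & Vector F L}.

Section Span.
Variables (F : fieldType) (V : vectType F).

Definition least_vspace_above (A : set V) (U : {vspace V}) : Prop :=
  A `<=` [set` U] /\
  forall W : {vspace V}, A `<=` [set` W] -> (U <= W)%VS.

(* The linear span of an arbitrary, possibly infinite, set of vectors. *)
Definition vspan (A : set V) : {vspace V} :=
  xget 0%VS [set U | least_vspace_above A U].

Lemma vspan_seq (A : set V) :
  exists s : seq V, [/\ {in s, forall x, A x}, least_vspace_above A <<s>> &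
                        vspan A = <<s>>%VS].
Proof.
pose P n := `[< exists2 s : seq V, {in s, forall x, A x} & \dim <<s>> = n >].
have exP : exists n, P n.
  by exists (\dim <<[::] : seq V>>); apply/asboolP; exists [::].
have leP n : P n -> (n <= \dim {:V})%N.
  by move/asboolP=> [s _ <-]; apply/dimvS/subvf.
case: (ex_maxnP exP leP) => n /asboolP[s sA dims] maxn.
have least : least_vspace_above A <<s>>%VS.
  split=> [x Ax|W AW] /=; last by apply/span_subvP => x /sA /AW.
  have sub : (<<s>> <= <<x :: s>>)%VS by rewrite span_cons addvSr.
  suff /eqP -> : (<<s>> == <<x :: s>>)%VS.
    by apply: memv_span; rewrite mem_head.
  rewrite eqEdim sub dims maxn //; apply/asboolP; exists (x :: s) => // y.
  by rewrite inE => /predU1P[->|/sA].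
exists s; split=> //; case: least => sup inf.
have [sup' inf'] : least_vspace_above A (vspan A).
  by apply: (xgetPex 0%VS); exists <<s>>%VS.
by apply/eqP; rewrite eqEsubv inf' // inf.
Qed.

Lemma vspanP (A : set V) : least_vspace_above A (vspan A).
Proof. by have [s [_ + ->]] := vspan_seq A. Qed.

End Span.

Section LieAlgebraTheory.
Variables (F : fieldType) (g : lieAlgType F).
Implicit Types (U W h t I : {vspace g}).

Definition lie_vspace U W : {vspace g} :=
  vspan [set lie x y | x in [set` U] & y in [set` W]].

Definition subalgebra U : Prop := (lie_vspace U U <= U)%VS.

Definition lie_ideal I : Prop := (lie_vspace fullv I <= I)%VS.

Definition derived_series U (n : nat) : {vspace g} :=
  iter n (fun W => lie_vspace W W) U.

Definition lower_central_series U (n : nat) : {vspace g} :=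
  iter n (lie_vspace U) U.

Definition solvable U : Prop := exists n, derived_series U n = 0%VS.

Definition nilpotent U : Prop := exists n, lower_central_series U n = 0%VS.

Definition semisimple : Prop :=
  forall I, lie_ideal I -> solvable I -> I = 0%VS.

Definition cartan_subalgebra h : Prop :=
  [/\ subalgebra h, nilpotent h &
      forall x, (forall y, y \in h -> lie x y \in h) -> x \in h].

End LieAlgebraTheory.
Arguments semisimple {F} g.

Section Roots.
Variables (F : fieldType) (g : lieAlgType F) (h : {vspace g}).
Local Notation weight := 'Hom(subvs_of h, F^o).
Implicit Types (a b l : weight) (S T : set weight) (D : seq weight).

Definition root_space a : {vspace g} :=
  vspan [set x | forall y : subvs_of h, lie (val y) x = (a y : F) *: x].

Lemma root_spaceP a x :
  reflect (forall y : subvs_of h, lie (val y) x = (a y : F) *: x)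
          (x \in root_space a).
Proof.
pose E := [set x | forall y : subvs_of h, lie (val y) x = (a y : F) *: x].
have lie0 y : lie y 0 = 0 :> g.
  have := lie_linearr y (-1) 0 0.
  by rewrite !scaler0 addr0 scaleN1r addNr.
suff memE : x \in root_space a <-> E x by apply: (iffP idP) => /memE.
split=> [|Ex]; last by have [Esub _] := vspanP E; apply: Esub.
have [s [sE _ defE]] := vspan_seq E.
rewrite [root_space a]defE => xs y.
rewrite (coord_span (X := in_tuple s) xs).
elim/big_ind: _ => [|u w Hu Hw|i _]; first by rewrite lie0 scaler0.
  by have := lie_linearr (val y) 1 u w; rewrite !scale1r scalerDr -Hu -Hw.
have := lie_linearr (val y) (coord (in_tuple s) i x) (in_tuple s)`_i 0.
rewrite !addr0 lie0 addr0 => ->.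
by rewrite sE ?mem_nth // !scalerA mulrC.
Qed.

Definition root_system : set weight :=
  [set a | a != 0 /\ root_space a <> 0%VS].

Definition closed_roots T : Prop :=
  T `<=` root_system /\
  forall a b, T a -> T b -> root_system (a + b) -> T (a + b).

Definition oppr_set T : set weight := [set - a | a in T].

Definition sym_part T : set weight := T `&` oppr_set T.

Definition root_closure S : set weight := smallest closed_roots S.

Definition nat_comb D a : Prop :=
  exists c : weight -> nat, a = \sum_(d <- D) d *+ c d.

(* The linear independence is over F: the real span of the roots is a real form
   of the dual of h, so its real bases are also bases of this dual. *)
Definition root_base D : Prop :=
  [/\ [set` D] `<=` root_system, basis_of fullv D &
      forall a, root_system a -> nat_comb D a \/ nat_comb D (- a)].

Definition pos_roots D : set weight := root_system `&` nat_comb D.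

Definition neg_roots D : set weight := oppr_set (pos_roots D).

Definition is_coroot a (y : subvs_of h) : Prop :=
  val y \in lie_vspace (root_space a) (root_space (- a)) /\ a y = 2%:R.

Definition dominant_integral D l : Prop :=
  forall a (y : subvs_of h), a \in D -> is_coroot a y ->
    exists n : nat, l y = n%:R.

Definition regular_subalgebra T (t : {vspace g}) : {vspace g} :=
  (t + vspan (\bigcup_(a in T) [set` root_space a]))%VS.

End Roots.

Section Modules.
Variables (F : fieldType) (g : lieAlgType F) (V : vectType F).
Variable rho : 'Hom(g, 'End(V)).

Definition representation : Prop :=
  forall x y v, rho (lie x y) v = rho x (rho y v) - rho y (rho x v).

Definition submodule (s : {vspace g}) (U : {vspace V}) : Prop :=
  forall x u, x \in s -> u \in U -> rho x u \in U.

Definition simple_module : Prop :=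
  {:V}%VS <> 0%VS /\
  forall U, submodule fullv U -> U = 0%VS \/ U = fullv.

Definition indecomposable (s : {vspace g}) : Prop :=
  ~ exists U W : {vspace V},
      [/\ submodule s U, submodule s W, U <> 0%VS & W <> 0%VS] /\
      (U + W = fullv)%VS /\ (U :&: W = 0)%VS.

Variables (h : {vspace g}).
Local Notation weight := 'Hom(subvs_of h, F^o).
Variable D : seq weight.

Definition highest_weight_vector (l : weight) (v : V) : Prop :=
  [/\ v != 0,
      forall y : subvs_of h, rho (val y) v = (l y : F) *: v &
      forall a x, pos_roots D a -> x \in root_space a -> rho x v = 0].

(* (V, v) is V(l) with its highest weight vector v_l, which is characterised
   up to isomorphism. *)
Definition simple_highest_weight_module (l : weight) (v : V) : Prop :=
  [/\ representation, simple_module & highest_weight_vector l v].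

(* s is l-wide, for the weight l such that V is V(l). *)
Definition wide (s : {vspace g}) : Prop := indecomposable s.

(* The list [:: c_1; ...; c_m] stands for e_{c_1} ... e_{c_m} v, with
   c_j = - beta_j. *)
Definition lowering_span (e : weight -> g) (S : set weight) (v : V) :
    {vspace V} :=
  vspan [set foldr (fun c w => rho (e c) w) v cs |
         cs in [set cs : seq weight |
                {in cs, forall c, root_closure S c /\ neg_roots D c}]].

End Modules.

(* Main.v *)
Require Import Defs.
From HB Require Import structures.
From mathcomp Require Import all_boot all_order all_algebra.
From mathcomp Require Import boolp classical_sets reals.
From mathcomp Require Import complex ring.

Set Implicit Arguments.
Unset Strict Implicit.
Unset Printing Implicit Defensive.

Import Order.TTheory GRing.Theory Num.Theory.
Local Open Scope classical_set_scope.
Local Open Scope ring_scope.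

(** Write [s] for the regular subalgebra, [Psi] for the closure of [T] and [-T], and [m]
    for the sum of the Cartan subalgebra and the root spaces of [Psi].

    Let [M] be the [m]-submodule of [V] generated by the highest weight vector.  By the
    Casimir operator of [m], the only extremal vectors of [M] are the multiples of its
    generator, and likewise for the [m]-submodule of the dual of [V] generated by the
    dual vector; so the annihilator of the latter is an [m]-stable complement of [M].  If
    [V] is indecomposable under [s], this forces [M] to be [V].

    Conversely, suppose that [M] is [V].  The Cartan subalgebra normalizes [s], so the
    commutant of [s] in [End V] is graded by weights.  Its elements of weight 0 commute
    with [e_a] and the coroot of [a] for each [a] in [T], hence with [e_(-a)] by the
    representation theory of sl2, hence with [m]; they are scalar, because [V] is
    generated under [m] by a vector of multiplicity one.  The components of nonzero
    weight do not contribute to traces of products, so an idempotent of the commutant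
    whose component of weight 0 is [c] satisfies [c = c ^ 2] and has trace [c * dim V]:
    it is 0 or 1.

    The root decomposition takes a shortcut: the roots have integral coordinates in a
    basis of the dual of the Cartan subalgebra, so they take conjugate values at conjugate
    points, and the Killing form is nondegenerate on the Cartan subalgebra because it is
    there a sum of squares of roots. *)

(** * Linear maps and traces *)

(** The summands of a decomposition of [V] under [s] need not be stable under [h], since [t] may be
    smaller than [h]. Weights therefore say nothing directly about a summand; the second half works
    with the projection onto it, seen as a vector of the module [End V], on which [h] acts. In the
    first half the Casimir operator replaces Weyl's complete reducibility theorem. It is built from
    the Killing form of the whole algebra, which stays nondegenerate on [m], whereas the Killing
    form of [m] vanishes on the centre of [m]. The submodule of the dual is generated by a lowest
    weight vector; for the same lemmas to cover it, reflections, Casimir operators and generated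
    submodules are treated for an abstract positive system. A Cartan subalgebra is given as
    nilpotent and self-normalizing: once the base has made it commutative, only generalized weights
    are available. Strict weights follow from the nondegeneracy of the Killing form, which rests on
    an Engel-type argument for ideals meeting [h] trivially, in place of Cartan's criterion. *)

Section LinearMaps.
Variables (F : fieldType) (U V : vectType F).

Lemma lfun_of_linear (f : U -> V) :
  linear f -> {g : 'Hom(U, V) | forall x, g x = f x}.
Proof.
move=> lf.
pose m := GRing.isLinear.Build F U V *:%R f lf.
pose f' : {linear U -> V} := HB.pack f m.
by exists (linfun f') => x; rewrite lfunE.
Qed.

Lemma lfunD (f : 'Hom(U, V)) x y : f (x + y) = f x + f y.
Proof. exact: linearD. Qed.

Lemma lfunB (f : 'Hom(U, V)) x y : f (x - y) = f x - f y.
Proof. exact: linearB. Qed.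

Lemma lfunN (f : 'Hom(U, V)) x : f (- x) = - f x.
Proof. exact: linearN. Qed.

Lemma lfunZ (f : 'Hom(U, V)) a x : f (a *: x) = a *: f x.
Proof. exact: linearZ. Qed.

Lemma lfun0 (f : 'Hom(U, V)) : f 0 = 0.
Proof. exact: linear0. Qed.

Lemma lfun_sum (f : 'Hom(U, V)) I (r : seq I) (P : pred I) (x : I -> U) :
  f (\sum_(i <- r | P i) x i) = \sum_(i <- r | P i) f (x i).
Proof. exact: linear_sum. Qed.

Lemma vspan_mem (A : set V) x : A x -> x \in vspan A.
Proof. by have [sub _] := vspanP A => /sub. Qed.

Lemma vspan_sub (A : set V) (W : {vspace V}) :
  (forall x, A x -> x \in W) -> (vspan A <= W)%VS.
Proof. by have [_ inf] := vspanP A => sub; apply: inf => x /sub. Qed.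

(** Turns a linear condition into a subspace whose membership unfolds to the condition. Generalized
    weight spaces, annihilators, centres and commutants are formed in this way below. *)
Lemma vspan_closedP (A : set V) x :
  A 0 -> (forall a u w, A u -> A w -> A (a *: u + w)) -> x \in vspan A <-> A x.
Proof.
move=> A0 Alin; split=> [|/vspan_mem//].
have [s [sA _ ->]] := vspan_seq A.
move=> xs; rewrite (coord_span (X := in_tuple s) xs).
have Asc i y : A y -> A (i *: y) by move=> Ay; rewrite -[_ *: _]addr0; apply: Alin.
elim/big_ind: _ => [//|u w Au Aw|i _]; first by rewrite -[u]scale1r; apply: Alin.
by apply/Asc/sA/mem_nth.
Qed.

End LinearMaps.

Lemma lfun_vspan (F : fieldType) (U V : vectType F) (f : 'Hom(U, V)) (A : set U)
    (W : {vspace V}) :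
  (forall x, A x -> f x \in W) -> forall x, x \in vspan A -> f x \in W.
Proof.
move=> AW x; rewrite memv_preim; apply/subvP/vspan_sub => y /AW.
by rewrite memv_preim.
Qed.

Lemma vspace_neq0 (F : fieldType) (V : vectType F) (W : {vspace V}) :
  W <> 0%VS -> exists2 x, x \in W & x != 0.
Proof.
move=> /eqP; rewrite -vpick0 => W0; exists (vpick W) => //; exact: memv_pick.
Qed.

Lemma vspace_neq0I (F : fieldType) (V : vectType F) (W : {vspace V}) x :
  x \in W -> x != 0 -> W <> 0%VS.
Proof. by move=> xW x0 W0; move: xW; rewrite W0 memv0 (negPf x0). Qed.

Section Trace.
Import VectorInternalTheory.
Variables (F : fieldType) (V : vectType F).
Implicit Types (f g : 'End(V)).

Lemma v2r_lfun f x : v2r (f x) = v2r x *m f2mx f.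
Proof. by rewrite unlock /= r2vK. Qed.

Lemma f2mx_unique f (A : 'M_(dim V)) :
  (forall x, v2r (f x) = v2r x *m A) -> f2mx f = A.
Proof.
move=> fA; apply/row_matrixP => i; rewrite !rowE.
by have := fA (r2v (delta_mx 0 i)); rewrite v2r_lfun r2vK.
Qed.

Lemma r2v_eigen f c (r : 'rV_(dim V)) :
  r *m f2mx f = c *: r -> f (r2v r) = c *: r2v r.
Proof. by move=> rf; apply: v2r_inj; rewrite v2r_lfun linearZ /= r2vK rf. Qed.

Definition ltr f : F := \tr (f2mx f).

Lemma ltr_is_scalar : scalar ltr.
Proof.
move=> a f g; rewrite /ltr -mxtraceZ -mxtraceD; congr (\tr _).
apply: f2mx_unique => x; rewrite add_lfunE scale_lfunE linearD linearZ /=.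
by rewrite !v2r_lfun mulmxDr scalemxAr.
Qed.

HB.instance Definition _ := GRing.isLinear.Build F 'End(V) F *%R ltr ltr_is_scalar.

Lemma f2mx_comp f g : f2mx (f \o g)%VF = f2mx g *m f2mx f.
Proof. by apply: f2mx_unique => x; rewrite comp_lfunE !v2r_lfun mulmxA. Qed.

Lemma ltrC f g : ltr (f \o g)%VF = ltr (g \o f)%VF.
Proof. by rewrite /ltr !f2mx_comp mxtrace_mulC. Qed.

Lemma ltr1 : ltr \1%VF = (\dim {:V})%:R.
Proof.
rewrite /ltr (@f2mx_unique _ 1%:M) ?mxtrace1 ?dimvf // => x.
by rewrite id_lfunE mulmx1.
Qed.

(** With a rank factorization [A = C R], idempotence gives [R C = 1] after cancelling the injective
    and surjective factors, so [A] has the trace of an identity matrix whose size is the rank. *)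
Lemma ltr_idem f : (f \o f = f)%VF -> ltr f = (\dim (limg f))%:R.
Proof.
move=> /(congr1 f2mx); rewrite f2mx_comp => ff.
have -> : \dim (limg f) = \rank (f2mx f).
  by rewrite unlock /dimv mx2vsK /= genmx1 mul1mx.
rewrite /ltr; set A := f2mx f in ff *.
have E := mulmx_base A.
rewrite -{1}E mxtrace_mulC.
suff -> : row_base A *m col_base A = 1%:M by rewrite mxtrace1.
have CR : row_full (col_base A) by apply: col_base_full.
apply: (row_free_inj (row_base_free A)); rewrite /= mul1mx.
apply: (row_full_inj CR); rewrite E -[RHS]ff.
have -> : A *m A = (col_base A *m row_base A) *m (col_base A *m row_base A).
  by rewrite E.
by rewrite !mulmxA.
Qed.

End Trace.

Section ClosedTrace.
Import VectorInternalTheory.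
Variables (F : closedFieldType) (V : vectType F).
Implicit Types (f g : 'End(V)).

Lemma lfun_eigen (f : 'End(V)) (W : {vspace V}) :
  W <> 0%VS -> (forall x, x \in W -> f x \in W) ->
  exists c, exists2 x, x \in W /\ x != 0 & f x = c *: x.
Proof.
move=> W0 fW.
have lfW : linear (fun x : subvs_of W => vsproj W (f (val x))).
  by move=> a x y; rewrite !linearP.
have [fw fwE] := lfun_of_linear lfW.
have dW : (0 < dim (subvs_of W))%N.
  by rewrite lt0n; apply/eqP => d0; apply: W0; apply/eqP; rewrite -dimv_eq0; apply/eqP.
have [c] : exists c, root (char_poly (f2mx fw)) c.
  apply/closed_rootP; rewrite size_char_poly; move: dW.
  by case: (dim _).
rewrite -eigenvalue_root_char => /eigenvalueP[r rE r0].
exists c; exists (val (r2v r : subvs_of W)).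
  split; first exact: subvsP.
  apply: contra r0 => /eqP r0.
  have : (r2v r : subvs_of W) = 0 by apply: val_inj.
  by move/(congr1 v2r); rewrite r2vK linear0 => ->.
have := fwE (r2v r); rewrite (r2v_eigen rE).
move/(congr1 (@vsval _ _ _)); rewrite vsprojK //; exact/fW/subvsP.
Qed.

(** Every eigenvalue vanishes, so the characteristic polynomial is a power of the variable, and its
    subleading coefficient is the opposite of the trace. *)
Lemma ltr_nilpotent (f : 'End(V)) n : (forall x, iter n f x = 0) -> ltr f = 0.
Proof.
move=> fn; have [d0|dV] := posnP (dim V).
  by rewrite /ltr; move: (f2mx f); rewrite d0 => A; rewrite /mxtrace big_ord0.
have := char_poly_trace (f2mx f) dV.
have [r rE] := closed_field_poly_normal (char_poly (f2mx f)).
have mon := char_poly_monic (f2mx f).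
rewrite (monicP mon) scale1r in rE.
have r0 c : c \in r -> c = 0.
  rewrite -root_prod_XsubC -rE -eigenvalue_root_char => /eigenvalueP[w wE w0].
  have fw := r2v_eigen wE.
  have : iter n f (r2v w) = c ^+ n *: r2v w.
    elim: (n) => [|k IH]; first by rewrite expr0 scale1r.
    by rewrite iterS IH linearZ /= fw scalerA exprSr.
  rewrite fn => /esym/eqP; rewrite scaler_eq0 expf_eq0 => /orP[/andP[_ /eqP//]|].
  by rewrite -(inj_eq (@v2r_inj _ V)) r2vK linear0 (negPf w0).
have -> : char_poly (f2mx f) = 'X^(size r).
  rewrite rE; elim: (r) r0 => [|c s IH] r0; first by rewrite big_nil expr0.
  rewrite big_cons (r0 c) ?mem_head // subr0 IH ?exprS // => x xs.
  by apply: r0; rewrite inE xs orbT.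
have : size (char_poly (f2mx f)) = (size r).+1 by rewrite rE size_prod_XsubC.
rewrite size_char_poly => -[<-]; rewrite coefXn.
rewrite ltn_eqF ?prednK // => /eqP.
by rewrite eq_sym oppr_eq0 => /eqP.
Qed.

(** Otherwise the characteristic polynomial would have more roots than its degree. For [sl2] this
    makes the raising and lowering operators nilpotent at eigenvectors of [H]. *)
Lemma eigen_seq_eq0 (f : 'End(V)) (c : nat -> F) (x : nat -> V) :
  injective c -> (forall k, f (x k) = c k *: x k) -> exists k, x k = 0.
Proof.
move=> c_inj fx; apply: contrapT => x0.
pose s := [seq c k | k <- iota 0 (dim V).+1].
have : (size s < size (char_poly (f2mx f)))%N.
  apply: max_poly_roots; first by rewrite monic_neq0 ?char_poly_monic.
    apply/allP => _ /mapP[k _ ->]; rewrite -eigenvalue_root_char.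
    apply/eigenvalueP; exists (v2r (x k)).
      by rewrite -v2r_lfun fx linearZ.
    apply/eqP => xk0; apply: x0; exists k.
    by apply: v2r_inj; rewrite xk0 linear0.
  by rewrite map_inj_uniq // iota_uniq.
by rewrite size_char_poly size_map size_iota ltnn.
Qed.

End ClosedTrace.

(** * Generalized weights of commuting operators *)

Section Nilpotence.
Variables (F : fieldType) (V : vectType F).
Implicit Types (A B : 'End(V)) (x : V).

Definition nil_at A x := exists n, iter n A x = 0.

Lemma iter_lfun_is_linear A n : linear (iter n A).
Proof. by elim: n => // n IH a x y; rewrite !iterS IH linearP. Qed.

Lemma iter_lfun0 A n : iter n A 0 = 0.
Proof. by elim: n => // n IH; rewrite iterS IH linear0. Qed.

Lemma iter_lfunW A x m n : iter m A x = 0 -> (m <= n)%N -> iter n A x = 0.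
Proof. by move=> Ax le_mn; rewrite -(subnK le_mn) iterD Ax iter_lfun0. Qed.

Lemma iter_stable A (W : {vspace V}) n x :
  (forall x, x \in W -> A x \in W) -> x \in W -> iter n A x \in W.
Proof. by move=> AW xW; elim: n => //= n; apply: AW. Qed.

Lemma nil_at0 A : nil_at A 0.
Proof. by exists 0%N. Qed.

Lemma nil_at_lin A a x y : nil_at A x -> nil_at A y -> nil_at A (a *: x + y).
Proof.
move=> [m Am] [n An]; exists (m + n)%N; rewrite iter_lfun_is_linear.
by rewrite (iter_lfunW Am) ?leq_addr // (iter_lfunW An) ?leq_addl // scaler0 addr0.
Qed.

Lemma iter_lfunC A B n x :
  (forall x, A (B x) = B (A x)) -> iter n A (B x) = B (iter n A x).
Proof. by move=> AB; elim: n => //= n ->. Qed.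

Lemma nil_at_comm A B x :
  (forall x, A (B x) = B (A x)) -> nil_at A x -> nil_at A (B x).
Proof. by move=> AB [n An]; exists n; rewrite iter_lfunC // An lfun0. Qed.

Lemma iter_first0 A x : x != 0 -> nil_at A x ->
  exists n, iter n A x != 0 /\ A (iter n A x) = 0.
Proof.
move=> x0 [n]; elim: n => [/eqP|n IH]; first by rewrite /= (negPf x0).
by move=> An; have [/IH//|nz] := eqVneq (iter n A x) 0; exists n.
Qed.

Lemma nil_at_unif A (s : seq V) : (forall x, x \in s -> nil_at A x) ->
  exists n, forall x, x \in <<s>>%VS -> iter n A x = 0.
Proof.
elim: s => [|x s IH] sA.
  by exists 0%N => x; rewrite span_nil memv0 => /eqP.
have [|n An] := IH; first by move=> y ys; apply: sA; rewrite inE ys orbT.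
have [m Am] := sA x (mem_head _ _).
exists (m + n)%N => y; rewrite span_cons => /memv_addP[_ /vlineP[a ->] [z zs ->]].
rewrite iter_lfun_is_linear (iter_lfunW Am) ?leq_addr //.
by rewrite (iter_lfunW (An z zs)) ?leq_addl // scaler0 addr0.
Qed.

End Nilpotence.

(** Leibniz rule: [C ^ (m + n)] expands into terms [b (A ^ i x) (B ^ j y)] with [i + j = m + n], and
    each has [i >= m] or [j >= n]. The double induction peels off one [C] at a time and so avoids
    binomial coefficients. *)
Lemma iter_leibniz (F : fieldType) (U V W : vectType F) (A : 'End(U)) (B : 'End(V))
    (C : 'End(W)) (b : U -> V -> W) m n x y :
  (forall x y, C (b x y) = b (A x) y + b x (B y)) ->
  (forall y, b 0 y = 0) -> (forall x, b x 0 = 0) ->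
  iter m A x = 0 -> iter n B y = 0 -> iter (m + n) C (b x y) = 0.
Proof.
move=> Cb b0l b0r.
have step k u v : iter k.+1 C (b u v) = iter k C (b (A u) v) + iter k C (b u (B v)).
  rewrite iterSr Cb -[X in iter _ _ (X + _)]scale1r iter_lfun_is_linear.
  by rewrite scale1r.
elim: m n x y => [|m IHm].
  by move=> n x y /= -> _; rewrite b0l iter_lfun0.
elim=> [|n IHn] x y Am; first by move=> y0; rewrite -[y]/(iter 0 B y) y0 b0r iter_lfun0.
move=> Bn; rewrite addSn step IHm -?iterSr // add0r -addSnnS IHn //.
by rewrite -iterSr.
Qed.

Section CommutingFamily.
Variables (F : closedFieldType) (H X : vectType F) (f : 'Hom(H, 'End(X))).
Local Notation weight := 'Hom(H, F^o).
Implicit Types (mu nu : weight) (W : {vspace X}).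

Hypothesis f_comm : forall y z x, f y (f z x) = f z (f y x).

Definition stable W := forall y x, x \in W -> f y x \in W.

Definition wt mu x := forall y, f y x = (mu y : F) *: x.

Definition sh mu y : 'End(X) := f y - (mu y : F) *: \1%VF.

Definition gwt mu x := forall y, nil_at (sh mu y) x.

Lemma shE mu y x : sh mu y x = f y x - (mu y : F) *: x.
Proof. by rewrite /sh add_lfunE opp_lfunE scale_lfunE id_lfunE. Qed.

Lemma wt_gwt mu x : wt mu x -> gwt mu x.
Proof. by move=> mx y; exists 1%N; rewrite /= shE mx subrr. Qed.

Lemma wt0 mu : wt mu 0.
Proof. by move=> y; rewrite lfun0 scaler0. Qed.

Lemma wt_lin mu a x y : wt mu x -> wt mu y -> wt mu (a *: x + y).
Proof. by move=> mx my z; rewrite lfunD lfunZ mx my scalerDr !scalerA mulrC. Qed.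

Lemma wtZ mu a x : wt mu x -> wt mu (a *: x).
Proof. by move=> mx; rewrite -[_ *: _]addr0; apply/wt_lin/wt0. Qed.

Lemma gwt0 mu : gwt mu 0.
Proof. by move=> y; apply: nil_at0. Qed.

Lemma gwt_lin mu a x y : gwt mu x -> gwt mu y -> gwt mu (a *: x + y).
Proof. by move=> mx my z; apply: nil_at_lin. Qed.

Lemma gwtD mu x y : gwt mu x -> gwt mu y -> gwt mu (x + y).
Proof. by rewrite -{2}[x]scale1r; apply: gwt_lin. Qed.

Lemma gwtZ mu a x : gwt mu x -> gwt mu (a *: x).
Proof. by move=> mx; rewrite -[_ *: _]addr0; apply/gwt_lin/gwt0. Qed.

Lemma gwt_comm mu (B : 'End(X)) x :
  (forall y x, f y (B x) = B (f y x)) -> gwt mu x -> gwt mu (B x).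
Proof.
move=> fB mx y; apply: nil_at_comm => [z|//].
by rewrite !shE fB lfunB lfunZ.
Qed.

Lemma gwt_f mu y x : gwt mu x -> gwt mu (f y x).
Proof. by apply: (@gwt_comm mu (f y)) => z u; rewrite f_comm. Qed.

Lemma sh_comm mu nu y z x : sh mu y (sh nu z x) = sh nu z (sh mu y x).
Proof.
rewrite !shE !lfunB !lfunZ f_comm !scalerBr !scalerA [mu y * nu z]mulrC.
by rewrite !opprB -!addrA; congr (_ + _); rewrite addrCA [RHS]addrCA [- _ - _]addrC.
Qed.

Lemma gwt_sh mu nu y x : gwt mu x -> gwt mu (sh nu y x).
Proof. by move=> mx z; apply: nil_at_comm => // w; apply: sh_comm. Qed.

(** If some [f y] is not scalar on [W], one of its eigenspaces in [W] is a smaller nonzero stable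
    subspace. If all are scalar, the scalars depend linearly on [y] and form the weight. *)
Lemma common_eigen W : stable W -> W <> 0%VS ->
  exists mu, exists2 x, x \in W /\ x != 0 & wt mu x.
Proof.
have [n] := ubnP (\dim W); elim: n W => // n IH W dimW fW W0.
have [scal|nscal] :=
    pselect (forall y, exists c, forall x, x \in W -> f y x = c *: x).
  have [x xW x0] := vspace_neq0 W0.
  pose c y := sval (cid (scal y)).
  have cE y z : z \in W -> f y z = c y *: z by exact: (svalP (cid (scal y))).
  have c_lin : linear (c : H -> F^o).
    move=> a y z; apply/eqP; rewrite -subr_eq0; apply/eqP.
    have := cE (a *: y + z) x xW; rewrite linearP /= add_lfunE scale_lfunE !cE //.
    move/eqP; rewrite eq_sym -subr_eq0 scalerA -scalerDl -scalerBl.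
    by rewrite scaler_eq0 (negPf x0) orbF => /eqP.
  have [mu muE] := lfun_of_linear c_lin.
  by exists mu, x => // y; rewrite muE cE.
have [y yN] : exists y, forall c, exists2 x, x \in W & f y x != c *: x.
  apply: contrapT => N; apply: nscal => y; apply: contrapT => Ny.
  apply: N; exists y => c; apply: contrapT => Nx; apply: Ny; exists c => x xW.
  by apply/eqP; apply: contrapT => /negP fx; apply: Nx; exists x.
have [c [x [xW x0] fx]] := lfun_eigen W0 (fW y).
pose W' := (W :&: lker (f y - c *: \1%VF))%VS.
have W'E z : z \in W' = (z \in W) && (f y z == c *: z).
  rewrite memv_cap memv_ker add_lfunE opp_lfunE scale_lfunE id_lfunE.
  by rewrite subr_eq0.
have W'0 : W' <> 0%VS by apply: (@vspace_neq0I _ _ _ x); rewrite ?W'E ?xW ?fx ?eqxx.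
have fW' : stable W'.
  by move=> z u; rewrite !W'E => /andP[uW /eqP fu]; rewrite fW // f_comm fu lfunZ /=.
have dimW' : (\dim W' < n)%N.
  have [z zW nz] := yN c; apply: leq_trans (_ : \dim W' < \dim W)%N _; last first.
    by rewrite -ltnS.
  rewrite (ltn_leqif (dimv_leqif_sup (capvSl _ _))); apply/subvP => /(_ z zW).
  by rewrite W'E (negPf nz) andbF.
have [mu [z [zW' z0] mz]] := IH W' dimW' fW' W'0.
by exists mu, z => //; split=> //; move: zW'; rewrite W'E => /andP[].
Qed.

Lemma wt_gwt_eq mu nu z : z != 0 -> wt nu z -> gwt mu z -> nu = mu.
Proof.
move=> z0 nz mz; apply/lfunP => y; apply/eqP.
have [n] := mz y; have -> : iter n (sh mu y) z = ((nu y : F) - mu y) ^+ n *: z.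
  elim: n => [|n IH]; first by rewrite scale1r.
  by rewrite iterS IH lfunZ shE nz -scalerBl scalerA exprSr.
by move/eqP; rewrite scaler_eq0 (negPf z0) orbF expf_eq0 subr_eq0 => /andP[].
Qed.

(** The vectors of [W] of generalized weight [mu] form a stable subspace, and a common eigenvector
    in it can have no weight but [mu]. *)
Lemma gwt_strict W mu x : stable W -> x \in W -> x != 0 -> gwt mu x ->
  exists x0, [/\ x0 \in W, x0 != 0 & wt mu x0].
Proof.
move=> fW xW x0 mx.
pose A : set X := [set z | z \in W /\ gwt mu z].
have AP z : z \in vspan A <-> A z.
  apply: vspan_closedP => [|a u w [uW mu'] [wW mw]]; first by split; [exact: mem0v|exact: gwt0].
  by split; [rewrite memvD ?memvZ | apply: gwt_lin].
have [y z /AP[zW mz]||nu [z [/AP[zW mz] z0] nz]] := @common_eigen (vspan A).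
- by apply/AP; split; [apply: fW | apply: gwt_f].
- by apply: (@vspace_neq0I _ _ _ x) => //; apply/AP.
by exists z; split=> //; rewrite -(wt_gwt_eq z0 nz mz).
Qed.

Lemma gwt_zero mu nu x : mu != nu -> gwt mu x -> gwt nu x -> x = 0.
Proof.
move=> /eqP neq mx nx; apply: contrapT => /eqP x0; apply: neq.
pose A : set X := [set z | gwt mu z /\ gwt nu z].
have AP z : z \in vspan A <-> A z.
  by apply: vspan_closedP => [|a u w [? ?] [? ?]]; split;
    by [exact: gwt0 | exact: gwt_lin].
have fA : stable (vspan A).
  by move=> y z /AP[? ?]; apply/AP; split; apply: gwt_f.
have xA : x \in vspan A by apply/AP.
have [z [/AP[_ nz] z0 mz]] := gwt_strict fA xA x0 mx.
exact: wt_gwt_eq nz.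
Qed.

(** A power of [sh mu0 y] kills the term of [mu0] and preserves the other generalized weights, so by
    induction it kills every other term. As [y] is arbitrary, each of these terms has two distinct
    generalized weights and vanishes. *)
Lemma gwt_indep (s : seq weight) (x : weight -> X) :
  uniq s -> (forall mu, mu \in s -> gwt mu (x mu)) ->
  \sum_(mu <- s) x mu = 0 -> forall mu, mu \in s -> x mu = 0.
Proof.
elim: s x => [//|mu0 s IH] x /= /andP[mu0s us] xw.
rewrite big_cons => sum0.
have xs0 mu : mu \in s -> x mu = 0.
  move=> mus; apply: (@gwt_zero mu mu0).
  - by apply: contraNneq mu0s => <-.
  - by apply: xw; rewrite inE mus orbT.
  move=> y; have [n x0n] := xw mu0 (mem_head _ _) y; exists n; move: mu mus.
  have [g gE] := lfun_of_linear (@iter_lfun_is_linear _ _ (sh mu0 y) n).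
  have gsum : \sum_(nu <- s) g (x nu) = 0.
    by have := congr1 g sum0; rewrite lfunD lfun_sum lfun0 gE x0n add0r.
  move=> mu mus; rewrite -gE; apply: (IH (fun nu => g (x nu)) us _ gsum mu mus).
  move=> nu nus z; apply: nil_at_comm => [u|].
    by rewrite !gE; apply/esym/iter_lfunC => u'; apply: sh_comm.
  by apply: xw; rewrite inE nus orbT.
move=> mu; rewrite inE => /predU1P[->|]; last exact: xs0.
by rewrite big_seq big1 ?addr0 in sum0.
Qed.

(** Fitting decomposition. If some [f y] has several eigenvalues on [W], then [W] splits into the
    generalized eigenspace [W1] of one of them, [c], and the image [W2] of a high power of
    [f y - c]; both are stable and smaller. Otherwise [W] has a single generalized weight. *)
Lemma gwt_basis W : stable W ->
  exists b : seq X, basis_of W b /\ forall x, x \in b -> exists mu, gwt mu x.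
Proof.
have [n] := ubnP (\dim W); elim: n W => // n IH W dimW fW.
have [->|/eqP W0] := eqVneq W 0%VS; first by exists [::]; rewrite nil_basis.
pose A y c : 'End(X) := f y - c *: \1%VF.
have AE y c x : A y c x = f y x - c *: x.
  by rewrite add_lfunE opp_lfunE scale_lfunE id_lfunE.
have [scal|nscal] :=
    pselect (forall y, exists c, forall x, x \in W -> nil_at (A y c) x).
  have [mu [x [xW x0] mx]] := common_eigen fW W0.
  exists (vbasis W); split=> [|z /vbasis_mem zW]; first exact: vbasisP.
  exists mu => y; have [c cW] := scal y.
  suff -> : sh mu y = A y c by apply: cW.
  congr (_ - _ *: _); apply/eqP; have [k] := cW x xW.
  have -> : iter k (A y c) x = ((mu y : F) - c) ^+ k *: x.
    elim: k => [|k IHk]; first by rewrite scale1r.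
    by rewrite iterS IHk lfunZ AE mx -scalerBl scalerA exprSr.
  by move/eqP; rewrite scaler_eq0 (negPf x0) orbF expf_eq0 subr_eq0 => /andP[].
have [y yN] : exists y, forall c, exists2 x, x \in W & ~ nil_at (A y c) x.
  apply: contrapT => N; apply: nscal => y; apply: contrapT => Ny.
  apply: N; exists y => c; apply: contrapT => Nx; apply: Ny; exists c => x xW.
  by apply: contrapT => fx; apply: Nx; exists x.
have [c [x [xW x0] fx]] := lfun_eigen W0 (fW y).
have AfC z u : A y c (f z u) = f z (A y c u) by rewrite !AE lfunB lfunZ f_comm.
pose W1 : {vspace X} := vspan [set z | z \in W /\ nil_at (A y c) z].
have W1P z : z \in W1 <-> z \in W /\ nil_at (A y c) z.
  apply: (vspan_closedP z) => [|a u w [? ?] [? ?]]; split.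
  - exact: mem0v.
  - exact: nil_at0.
  - by rewrite memvD ?memvZ.
  - exact: nil_at_lin.
have [N WN] : exists N, forall z, z \in W1 -> iter N (A y c) z = 0.
  have [|N] := @nil_at_unif _ _ (A y c) (vbasis W1).
    by move=> z /vbasis_mem /W1P[].
  by rewrite (span_basis (vbasisP W1)); exists N.
have [g gE] := lfun_of_linear (@iter_lfun_is_linear _ _ (A y c) N).
pose W2 := (g @: W)%VS.
have kerW : (W :&: lker g = W1)%VS.
  apply/vspaceP => z; rewrite memv_cap memv_ker gE.
  apply/andP/idP => [[zW /eqP gz]|/[dup] /W1P[zW _] /WN -> //].
  by apply/W1P; split=> //; exists N.
have W12 : (W1 :&: W2 = 0)%VS.
  apply/eqP; rewrite -subv0; apply/subvP => z; rewrite memv_cap memv0.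
  move=> /andP[/W1P[_ [k zk]] /memv_imgP[w wW zE]]; rewrite zE gE WN //.
  by apply/W1P; split=> //; exists (k + N)%N; rewrite iterD -gE -zE.
have gW z : z \in W -> g z \in W.
  move=> zW; rewrite gE; apply: iter_stable => // u uW.
  by rewrite AE memvB ?memvZ ?fW.
have dimE : (\dim W1 + \dim W2 = \dim W)%N by rewrite -kerW limg_ker_dim.
have WE : (W1 + W2 = W)%VS.
  apply/eqP; rewrite eqEdim dimv_disjoint_sum // dimE leqnn andbT subv_add.
  apply/andP; split; first by apply/subvP => z /W1P[].
  by apply/subvP => _ /memv_imgP[z zW ->]; apply: gW.
have fW1 : stable W1.
  by move=> z u /W1P[uW nu]; apply/W1P; split; [apply: fW | apply: nil_at_comm].
have fW2 : stable W2.
  move=> z _ /memv_imgP[u uW ->]; rewrite gE -iter_lfunC // -gE.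
  by apply/memv_img/fW.
have W1_gt0 : (0 < \dim W1)%N.
  rewrite lt0n dimv_eq0; apply/eqP; apply: (@vspace_neq0I _ _ _ x) => //.
  by apply/W1P; split=> //; exists 1%N; rewrite /= AE fx subrr.
have W2_gt0 : (0 < \dim W2)%N.
  rewrite lt0n; apply/eqP => W20; have [z zW nz] := yN c; apply: nz.
  suff /W1P[] : z \in W1 by [].
  suff -> : W1 = W by [].
  apply/eqP; rewrite eqEdim -dimE W20 addn0 leqnn andbT.
  by rewrite -WE addvSl.
have [|b1 [bW1 b1w]] := IH W1 _ fW1.
  by rewrite -ltnS; apply: leq_trans dimW; rewrite ltnS -dimE -addn1 leq_add2l.
have [|b2 [bW2 b2w]] := IH W2 _ fW2.
  by rewrite -ltnS; apply: leq_trans dimW; rewrite ltnS -dimE -add1n leq_add2r.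
exists (b1 ++ b2); split.
  by rewrite -WE cat_basis // directvE /= dimv_disjoint_sum.
by move=> z; rewrite mem_cat => /orP[/b1w|/b2w].
Qed.

Definition wproj_spec (s : seq weight) (p : weight -> 'End(X)) :=
  [/\ uniq s, forall mu x, gwt mu (p mu x),
      forall mu nu x, gwt nu x -> p mu x = if mu == nu then x else 0,
      forall x, x = \sum_(mu <- s) p mu x &
      forall mu, mu \in s -> exists2 x, x != 0 & gwt mu x].

Lemma wproj_ex : exists sp, wproj_spec sp.1 sp.2.
Proof.
have [|b0 [bb bw]] := @gwt_basis fullv; first by move=> y x _; apply: memvf.
pose b := in_tuple b0; pose n := size b0.
have wP (i : 'I_n) : exists mu, gwt mu b`_i by apply: bw; rewrite mem_nth.
pose m i := sval (cid (wP i)).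
have mP i : gwt (m i) b`_i by apply: (svalP (cid (wP i))).
pose s := undup [seq m i | i <- enum 'I_n].
have p_lin mu : linear (fun x => \sum_(i | m i == mu) coord b i x *: b`_i).
  move=> a x y; rewrite scaler_sumr -big_split; apply: eq_bigr => i _ /=.
  by rewrite linearP scalerDl scalerA.
pose p mu := sval (lfun_of_linear (p_lin mu)).
have pE mu x : p mu x = \sum_(i | m i == mu) coord b i x *: b`_i.
  exact: (svalP (lfun_of_linear (p_lin mu))).
have pw mu x : gwt mu (p mu x).
  rewrite pE; elim/big_ind: _ => [|u v|i /eqP <-]; [exact: gwt0|exact: gwtD|].
  exact/gwtZ/mP.
have ms i : m i \in s by rewrite mem_undup map_f ?mem_enum.
have p_notin mu x : mu \notin s -> p mu x = 0.
  by move=> mus; rewrite pE big1 // => i /eqP mi; rewrite -mi ms in mus.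
have sum_p (s' : seq weight) x : uniq s' -> {subset s <= s'} ->
    \sum_(mu <- s') p mu x = x.
  move=> us' ss'; rewrite [RHS](coord_basis (X := b) bb (memvf x)).
  under eq_bigr do rewrite pE.
  rewrite (exchange_big_dep predT) //=; apply: eq_bigr => i _.
  under eq_bigl do rewrite eq_sym.
  by rewrite -big_filter filter_pred1_uniq ?ss' // big_seq1.
exists (s, p); split=> //= [|mu nu x nx|x|mu].
- exact: undup_uniq.
(* [mu] and [nu] may lie outside [s], so the two decompositions of [x] are compared over an enlarged
   list. *)
- pose s' := undup (mu :: nu :: s).
  have us' : uniq s' by apply: undup_uniq.
  have mus' : mu \in s' by rewrite mem_undup mem_head.
  have nus' : nu \in s' by rewrite mem_undup !inE eqxx orbT.
  pose z k := p k x - (if k == nu then x else 0).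
  apply/eqP; rewrite -subr_eq0; apply/eqP.
  apply: (@gwt_indep s' z us' _ _ mu mus') => [k _|].
    rewrite /z -[X in gwt _ (X - _)]scale1r -scaleN1r addrC; apply: gwt_lin.
      by case: eqP => [->//|_]; apply: gwt0.
    exact/gwtZ/pw.
  rewrite /z sumrB sum_p //; last by move=> k ks; rewrite mem_undup !inE ks !orbT.
  by rewrite -big_mkcond -big_filter filter_pred1_uniq // big_seq1 subrr.
- by rewrite sum_p ?undup_uniq.
- rewrite mem_undup => /mapP[i _ ->]; exists b`_i; last exact: mP.
  by apply: basis_not0 bb _; rewrite mem_nth.
Qed.

Definition wts := (sval (cid wproj_ex)).1.

Definition wproj := (sval (cid wproj_ex)).2.

Lemma wprojP : wproj_spec wts wproj.
Proof. exact: (svalP (cid wproj_ex)). Qed.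

Lemma wts_uniq : uniq wts. Proof. by case: wprojP. Qed.

Lemma wproj_gwt mu x : gwt mu (wproj mu x). Proof. by case: wprojP. Qed.

Lemma wproj_sum x : x = \sum_(mu <- wts) wproj mu x. Proof. by case: wprojP. Qed.

Lemma wprojE mu nu x : gwt nu x -> wproj mu x = if mu == nu then x else 0.
Proof. by case: wprojP => _ _ h _ _; apply: h. Qed.

Lemma wproj_id mu x : gwt mu x -> wproj mu x = x.
Proof. by move/(wprojE mu); rewrite eqxx. Qed.

Lemma wproj_gwt0 mu nu x : gwt nu x -> mu != nu -> wproj mu x = 0.
Proof. by move=> nx /negPf mn; rewrite (wprojE mu nx) mn. Qed.

Lemma wtsP mu : mu \in wts <-> exists2 x, x != 0 & gwt mu x.
Proof.
split=> [|[x x0 mx]]; first by case: wprojP => _ _ _ _; apply.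
apply: contraNT x0 => mus; rewrite [x]wproj_sum big1_seq // => nu /andP[_ nus].
by apply: (wproj_gwt0 mx); apply: contraNneq mus => <-.
Qed.

Lemma wts_strict mu : mu \in wts -> exists2 x, x != 0 & wt mu x.
Proof.
move=> /wtsP[x x0 mx]; have [||z [_ z0 mz]] := @gwt_strict fullv mu x _ _ x0 mx.
- by move=> y u _; apply: memvf.
- exact: memvf.
by exists z.
Qed.

Lemma wproj_notin mu x : mu \notin wts -> wproj mu x = 0.
Proof.
move=> mus; apply/eqP; apply: contraNT mus => x0; apply/wtsP.
by exists (wproj mu x) => //; apply: wproj_gwt.
Qed.

Lemma lfun_eq_gwt (A B : 'End(X)) : (forall mu x, gwt mu x -> A x = B x) -> A = B.
Proof.
move=> AB; apply/lfunP => x; rewrite [x]wproj_sum !lfun_sum; apply: eq_bigr => mu _.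
exact/AB/wproj_gwt.
Qed.

(** [W] has a basis of generalized weight vectors, and the projection fixes or kills each of
    them. *)
Lemma wproj_stable W mu x : stable W -> x \in W -> wproj mu x \in W.
Proof.
move=> fW xW; have [b [bW bw]] := gwt_basis fW.
move: xW; rewrite -{1}(span_basis bW) memv_preim; apply/subvP/span_subvP => z zb.
rewrite -memv_preim; have [nu nz] := bw z zb; rewrite (wprojE mu nz).
by case: ifP; rewrite ?mem0v // (basis_mem bW zb).
Qed.

Lemma wproj_idem mu : (wproj mu \o wproj mu)%VF = wproj mu.
Proof. by apply/lfunP => x; rewrite comp_lfunE (wproj_id (wproj_gwt mu x)). Qed.

Lemma ltr_wproj mu : mu \in wts -> exists n, ltr (wproj mu) = n.+1%:R.
Proof.
move=> /wtsP[x x0 mx]; rewrite ltr_idem ?wproj_idem //.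
case E : (\dim _) => [|n]; last by exists n.
move/eqP: E; rewrite dimv_eq0 => /eqP E; case/eqP: x0; apply/eqP.
by rewrite -memv0 -E -(wproj_id mx) memv_img ?memvf.
Qed.

(** Only diagonal blocks contribute to the trace: by idempotence and cyclicity, [A \o wproj mu] has
    the trace of [wproj mu \o A \o wproj mu]. *)
Lemma ltr_gwt (A : 'End(X)) :
  (forall mu x, gwt mu x -> wproj mu (A x) = 0) -> ltr A = 0.
Proof.
move=> A0; have -> : A = \sum_(mu <- wts) (A \o wproj mu)%VF.
  apply/lfunP => x; rewrite sum_lfunE [x in LHS]wproj_sum lfun_sum.
  by apply: eq_bigr => mu _; rewrite comp_lfunE.
rewrite linear_sum big1 //= => mu _.
rewrite -wproj_idem comp_lfunA ltrC.
suff -> : (wproj mu \o (A \o wproj mu) = 0)%VF by rewrite linear0.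
by apply/lfunP => x; rewrite !comp_lfunE zero_lfunE A0 //; apply: wproj_gwt.
Qed.

(* The semisimple part of [f y]. *)
Definition ss y := \sum_(mu <- wts) (mu y : F) *: wproj mu.

Lemma ssE mu y x : gwt mu x -> ss y x = (mu y : F) *: x.
Proof.
move=> mx; rewrite sum_lfunE; under eq_bigr do rewrite scale_lfunE (wprojE _ mx).
have [->|x0] := eqVneq x 0.
  by rewrite scaler0 big1 // => nu _; case: ifP => _; rewrite scaler0.
rewrite (bigD1_seq mu) ?wts_uniq //=; last by apply/wtsP; exists x.
by rewrite eqxx big1 ?addr0 // => nu /negPf ->; rewrite scaler0.
Qed.

Lemma ss_f y z x : ss y (f z x) = f z (ss y x).
Proof.
rewrite -!comp_lfunE; move: x; apply/lfunP/lfun_eq_gwt => mu x mx.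
by rewrite !comp_lfunE (ssE y mx) lfunZ (ssE y (gwt_f z mx)).
Qed.

Lemma fsub_ss_nil y : exists n, forall x, iter n (f y - ss y) x = 0.
Proof.
have [b [bb bw]] := @gwt_basis fullv (fun y x _ => memvf _).
have [|n bn] := @nil_at_unif _ _ (f y - ss y) b.
  move=> x /bw[mu mx]; have [n nx] := mx y; exists n; rewrite -[RHS]nx.
  elim: n {nx} => //= n ->.
  have mn : gwt mu (iter n (sh mu y) x).
    by elim: n => //= n IHn; apply: gwt_sh.
  by rewrite add_lfunE opp_lfunE (ssE y mn) shE.
by exists n => x; apply: bn; rewrite (span_basis bb) memvf.
Qed.

Lemma ltr_nil_comm (A B : 'End(X)) n : (forall x, A (B x) = B (A x)) ->
  (forall x, iter n A x = 0) -> ltr (A \o B)%VF = 0.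
Proof.
move=> AB An; apply: (@ltr_nilpotent _ _ _ n) => x.
have -> : iter n (A \o B)%VF x = iter n B (iter n A x).
  elim: n {An} => // n IH.
  by rewrite iterS IH comp_lfunE -iterS -(@iter_lfunC _ _ B A).
by rewrite An iter_lfun0.
Qed.

(** Each factor may be replaced by its semisimple part, because the nilpotent remainder commutes
    with the other factor and their product is therefore traceless. The trace of [wproj mu] is the
    multiplicity of [mu]. *)
Lemma ltr_ff y z : ltr (f y \o f z)%VF =
  \sum_(mu <- wts) (mu y : F) * mu z * ltr (wproj mu).
Proof.
have nilC y' (B : 'End(X)) : (forall x, f y' (B x) = B (f y' x)) ->
    (forall x, ss y' (B x) = B (ss y' x)) -> ltr ((f y' - ss y') \o B)%VF = 0.
  move=> fB sB; have [n yn] := fsub_ss_nil y'; apply: ltr_nil_comm yn => x.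
  by rewrite !add_lfunE !opp_lfunE fB sB lfunB.
have ssC x : ss y (ss z x) = ss z (ss y x).
  rewrite -!comp_lfunE; move: x; apply/lfunP/lfun_eq_gwt => mu x mx.
  by rewrite !comp_lfunE !(ssE _ mx) !lfunZ !(ssE _ mx) !scalerA mulrC.
have -> : ltr (f y \o f z)%VF = ltr (ss y \o ss z)%VF.
  rewrite -[f y in LHS](subrK (ss y)) comp_lfunDl linearD /= nilC; last 2 first.
  - by move=> x; apply: f_comm.
  - by move=> x; apply: ss_f.
  rewrite add0r ltrC -[f z in LHS](subrK (ss z)) comp_lfunDl linearD /= nilC; last 2 first.
  - by move=> x; rewrite ss_f.
  - by move=> x; rewrite ssC.
  by rewrite add0r ltrC.
have -> : (ss y \o ss z)%VF = \sum_(mu <- wts) ((mu y : F) * mu z) *: wproj mu.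
  apply: lfun_eq_gwt => mu x mx.
  rewrite comp_lfunE (ssE z mx) lfunZ (ssE y mx) scalerA [mu z * _]mulrC.
  rewrite sum_lfunE; under eq_bigr do rewrite scale_lfunE (wprojE _ mx).
  have [->|x0] := eqVneq x 0.
    by rewrite scaler0 big1 // => nu _; case: ifP => _; rewrite scaler0.
  rewrite (bigD1_seq mu) ?wts_uniq //=; last by apply/wtsP; exists x.
  by rewrite eqxx big1 ?addr0 // => nu /negPf ->; rewrite scaler0.
by rewrite linear_sum; apply: eq_bigr => mu _; rewrite linearZ.
Qed.

(** [wproj mu] sends a strict weight vector to itself or to [0], hence maps the span of all of them
    into the strict weight space of [mu]. *)
Lemma wt_diag : (forall x, x \in vspan [set z | exists mu, wt mu z]) ->
  forall mu x, gwt mu x -> wt mu x.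
Proof.
move=> sp mu x mx; rewrite -(wproj_id mx).
pose A := [set z | wt mu z].
have AP z : z \in vspan A <-> A z.
  by apply: vspan_closedP => [|a u w ? ?]; [apply: wt0 | apply: wt_lin].
apply/AP; apply: lfun_vspan (sp x) => z [nu nz].
apply/AP; rewrite (wprojE mu (wt_gwt nz)).
by case: eqP => [e|_]; [rewrite /A /= e | apply: wt0].
Qed.

End CommutingFamily.

(** * Representations of sl2 *)

Section SL2.
Variables (F : numClosedFieldType) (X : vectType F).
Implicit Types (E L H : 'End(X)) (x : X) (c : F).

Definition sl2 E L H := [/\ forall x, E (L x) - L (E x) = H x,
  forall x, H (E x) - E (H x) = 2%:R *: E x &
  forall x, H (L x) - L (H x) = - (2%:R *: L x)].

Lemma sl2_sym E L H : sl2 E L H -> sl2 L E (- H).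
Proof.
move=> [EL HE HL]; split=> x; rewrite ?opp_lfunE ?lfunN -?opprD.
- by rewrite -EL opprB.
- by rewrite HL opprK.
- by rewrite HE.
Qed.

Lemma sl2_wtL E L H x c : sl2 E L H -> H x = c *: x ->
  forall k, H (iter k L x) = (c - k%:R * 2%:R) *: iter k L x.
Proof.
move=> [_ _ HL] Hx; elim=> [|k IH]; first by rewrite mul0r subr0.
rewrite iterS; have /eqP := HL (iter k L x); rewrite subr_eq => /eqP ->.
rewrite IH lfunZ -scaleNr -scalerDl; congr (_ *: _).
by rewrite -natr1; ring.
Qed.

Lemma sl2_wtE E L H x c : sl2 E L H -> H x = c *: x ->
  forall k, H (iter k E x) = (c + k%:R * 2%:R) *: iter k E x.
Proof.
move=> /sl2_sym sl Hx k; have := @sl2_wtL _ _ _ x (- c) sl.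
rewrite opp_lfunE Hx scaleNr => /(_ erefl k).
by rewrite opp_lfunE -opprD scaleNr => /oppr_inj.
Qed.

Lemma sl2_nilL E L H x c : sl2 E L H -> H x = c *: x -> nil_at L x.
Proof.
move=> sl /(sl2_wtL sl) Hx.
apply: (@eigen_seq_eq0 _ _ H (fun k => c - k%:R * 2%:R)) Hx => i j /addrI/oppr_inj.
have n2 : (2%:R : F) != 0 by rewrite pnatr_eq0.
by move/(mulIf n2)/eqP; rewrite eqr_nat => /eqP.
Qed.

Lemma sl2_EL E L H x c : sl2 E L H -> E x = 0 -> H x = c *: x ->
  forall k, E (iter k.+1 L x) = (k.+1%:R * (c - k%:R)) *: iter k L x.
Proof.
move=> sl Ex Hx k; have [EL _ _] := sl; elim: k => [|k IH].
  have /eqP := EL x; rewrite subr_eq Ex lfun0 addr0 Hx => /eqP ->.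
  by rewrite mul1r subr0.
rewrite iterS; have /eqP := EL (iter k.+1 L x); rewrite subr_eq => /eqP ->.
rewrite IH lfunZ (sl2_wtL sl Hx) -scalerDl; congr (_ *: _).
by rewrite -[k.+2%:R]natr1 -[k.+1%:R]natr1; ring.
Qed.

(** If [n] is the last exponent for which [L ^ n x] is nonzero, then [0 = E (L ^ (n + 1) x) = (n +
    1) (c - n) L ^ n x]. *)
Lemma sl2_hw E L H x c : sl2 E L H -> x != 0 -> E x = 0 -> H x = c *: x ->
  exists2 n : nat, c = n%:R & forall k, (k <= n)%N -> iter k L x != 0.
Proof.
move=> sl x0 Ex Hx.
have [n [n0 nS]] := iter_first0 x0 (sl2_nilL sl Hx).
exists n.
  have := sl2_EL sl Ex Hx n; rewrite iterS nS lfun0 => /esym/eqP.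
  by rewrite scaler_eq0 (negPf n0) orbF mulf_eq0 pnatr_eq0 /= subr_eq0 => /eqP.
by move=> k kn; apply: contraNneq n0 => /iter_lfunW ->.
Qed.

(** A nonzero [L x] would be killed by [E] and have weight [-2], which is not a natural number. *)
Lemma sl2_inv E L H x : sl2 E L H -> E x = 0 -> H x = 0 -> L x = 0.
Proof.
move=> sl Ex Hx; have H0 : H x = 0 *: x by rewrite scale0r.
apply: contrapT => /eqP Lx0.
have ELx : E (L x) = 0 by have := sl2_EL sl Ex H0 0; rewrite subr0 mulr0 scale0r.
have := sl2_wtL sl H0 1; rewrite /= mul1r sub0r => HLx.
have [n /eqP] := sl2_hw sl Lx0 ELx HLx.
by rewrite eq_sym -addr_eq0 -natrD pnatr_eq0 addn2.
Qed.

(** From the bottom [L ^ i x] of the string, of weight [- (k + 2 i)], [E] can be applied [k + 2 i]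
    times without reaching [0]. The last hypothesis, which holds when weight spaces are lines, turns
    the vectors so obtained into multiples of [E ^ j x]. *)
Lemma sl2_string E L H x k : sl2 E L H -> x != 0 -> H x = - k%:R *: x ->
  (forall i, exists c, iter i E (iter i L x) = c *: x) ->
  forall j, (j <= k)%N -> iter j E x != 0.
Proof.
move=> sl x0 Hx mult j jk.
have [i [i0 iS]] := iter_first0 x0 (sl2_nilL sl Hx).
have Hi := sl2_wtL sl Hx i.
have [|n nE n0] := @sl2_hw _ _ _ (iter i L x) (k%:R + i%:R * 2%:R) (sl2_sym sl) i0 iS.
  by rewrite opp_lfunE Hi -scaleNr; congr (_ *: _); ring.
have {nE} nE : n = (k + i * 2)%N.
  by apply/eqP; rewrite -(eqr_nat F) natrD natrM nE.
have [c cE] := mult i.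
have := n0 (j + i)%N; rewrite iterD cE nE.
have -> : iter j E (c *: x) = c *: iter j E x.
  by elim: (j) => //= m ->; rewrite lfunZ.
rewrite scaler_eq0 negb_or => /(_ _)/andP[]//.
by rewrite muln2 -addnn addnA leq_add2r (leq_trans jk) // leq_addr.
Qed.

End SL2.

(** * Lie algebras and submodules *)

Section LieBasics.
Variables (F : fieldType) (g : lieAlgType F).
Implicit Types (x y z : g) (U W Z : {vspace g}).

Lemma ad_subproof : {A : 'Hom(g, 'End(g)) | forall x y, A x y = lie x y}.
Proof.
pose a x := sval (lfun_of_linear (@lie_linearr F g x)).
have aE x y : a x y = lie x y by exact: (svalP (lfun_of_linear (@lie_linearr F g x))).
have a_lin : linear a.
  move=> c x y; apply/lfunP => z; rewrite add_lfunE scale_lfunE !aE.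
  exact: (@lie_linearl F g z c x y).
by have [A AE] := lfun_of_linear a_lin; exists A => x y; rewrite AE aE.
Qed.

Definition ad := sval ad_subproof.

Lemma adE x y : ad x y = lie x y.
Proof. exact: (svalP ad_subproof). Qed.

Lemma lie0r x : lie x 0 = 0. Proof. by rewrite -adE lfun0. Qed.
Lemma lie0l x : lie 0 x = 0. Proof. by rewrite -adE linear0 zero_lfunE. Qed.

Lemma lieDr x y z : lie x (y + z) = lie x y + lie x z.
Proof. by rewrite -!adE lfunD. Qed.

Lemma lieDl x y z : lie (x + y) z = lie x z + lie y z.
Proof. by rewrite -!adE linearD add_lfunE. Qed.

Lemma lieZr a x y : lie x (a *: y) = a *: lie x y.
Proof. by rewrite -!adE lfunZ. Qed.

Lemma lieZl a x y : lie (a *: x) y = a *: lie x y.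
Proof. by rewrite -!adE linearZ scale_lfunE. Qed.

Lemma lieC x y : lie x y = - lie y x.
Proof.
have := @liexx F g (x + y); rewrite !(lieDl, lieDr) !liexx addr0 add0r.
by move/eqP; rewrite addr_eq0 => /eqP.
Qed.

Lemma lieNr x y : lie x (- y) = - lie x y. Proof. by rewrite -!adE lfunN. Qed.

Lemma lie_sumr I (r : seq I) (P : pred I) (f : I -> g) x :
  lie x (\sum_(i <- r | P i) f i) = \sum_(i <- r | P i) lie x (f i).
Proof. by rewrite -adE lfun_sum; apply: eq_bigr => i _; rewrite adE. Qed.

Lemma lie_suml I (r : seq I) (P : pred I) (f : I -> g) x :
  lie (\sum_(i <- r | P i) f i) x = \sum_(i <- r | P i) lie (f i) x.
Proof.
by rewrite -adE linear_sum sum_lfunE; apply: eq_bigr => i _; rewrite adE.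
Qed.

Lemma lie_lieE x y z : lie (lie x y) z = lie x (lie y z) - lie y (lie x z).
Proof.
have /eqP := lie_jacobi x y z.
by rewrite [lie z (lie x y)]lieC [lie z x]lieC lieNr subr_eq0 => /eqP <-.
Qed.

Lemma ad_representation : representation ad.
Proof. by move=> x y z; rewrite !adE lie_lieE. Qed.

Lemma lie_vspace_mem U W x y : x \in U -> y \in W -> lie x y \in lie_vspace U W.
Proof. by move=> xU yW; apply: vspan_mem; exists x => //; exists y. Qed.

Lemma lie_vspace_sub U W Z :
  (forall x y, x \in U -> y \in W -> lie x y \in Z) -> (lie_vspace U W <= Z)%VS.
Proof. by move=> UWZ; apply: vspan_sub => _ [x xU [y yW <-]]; apply: UWZ. Qed.

End LieBasics.
Arguments ad {F g}.
Arguments ad_representation {F g}.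

(** * Submodules generated by a set of vectors *)

Section Hulls.
Variables (F : fieldType) (g : lieAlgType F) (X : vectType F).
Variable rho : 'Hom(g, 'End(X)).
Hypothesis rhoP : representation rho.

Definition stable_under (S : set g) (U : {vspace X}) :=
  forall s u, S s -> u \in U -> rho s u \in U.

Definition generated_by (S : set g) (B : set X) (M : {vspace X}) :=
  [/\ forall x, B x -> x \in M, stable_under S M &
      forall U : {vspace X}, (forall x, B x -> x \in U) -> stable_under S U ->
        (M <= U)%VS].

Lemma generated_ex S B : exists M, generated_by S B M.
Proof.
pose A : set X := [set u | forall U : {vspace X},
  (forall x, B x -> x \in U) -> stable_under S U -> u \in U].
have AP u : u \in vspan A <-> A u.
  apply: vspan_closedP => [U _ _|a v w Av Aw U BU SU]; first exact: mem0v.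
  by rewrite memvD ?memvZ ?(Av U BU SU) ?(Aw U BU SU).
exists (vspan A); split=> [x Bx|s u Ss /AP Au|U BU SU].
- by apply/AP => U BU _; apply: BU.
- by apply/AP => U BU SU; apply: (SU) => //; apply: Au.
- by apply: vspan_sub => u Au; apply: Au.
Qed.

(** The vectors of [M] that all of [T] sends into [M] include the generators. They are stable under
    [S], since [t s m = s t m + [t, s] m] and the bracket is again in [T] or [S], or zero; so they
    fill [M]. *)
Lemma generated_stable (S T : set g) (B : set X) (M : {vspace X}) :
  generated_by S B M -> (forall t x, T t -> B x -> rho t x \in M) ->
  (forall t s, T t -> S s -> T (lie t s) \/ S (lie t s) \/ lie t s = 0) ->
  stable_under T M.
Proof.
move=> [BM SM minM] TB TS.
pose A : set X := [set m | m \in M /\ forall t, T t -> rho t m \in M].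
have AP m : m \in vspan A <-> A m.
  apply: vspan_closedP => [|a u w [uM Tu] [wM Tw]]; split=> [|t Tt].
  - exact: mem0v.
  - by rewrite lfun0 mem0v.
  - by rewrite memvD ?memvZ.
  - by rewrite lfunD lfunZ memvD ?memvZ ?Tu ?Tw.
have /subvP MA : (M <= vspan A)%VS.
  apply: minM => [x Bx|s u Ss /AP[uM Tu]]; apply/AP.
    by split=> [|t Tt]; [apply: BM | apply: TB].
  split=> [|t Tt]; first exact: SM.
  have -> : rho t (rho s u) = rho s (rho t u) + rho (lie t s) u.
    by rewrite rhoP addrC subrK.
  apply: memvD; first by apply: SM => //; apply: Tu.
  have [/Tu//|[Sts|->]] := TS t s Tt Ss; first exact: SM.
  by rewrite linear0 zero_lfunE mem0v.
by move=> t m Tt /MA /AP[_ /(_ t Tt)].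
Qed.

End Hulls.

(** [Q] serves as a cone of strictly positive elements: [x] is maximal for the order in which [y]
    exceeds [x] when [Q (y - x)]. *)
Lemma maximal_ex (G : zmodType) (Q : set G) (s : seq G) :
  (forall x y, Q x -> Q y -> Q (x + y)) -> ~ Q 0 -> s != [::] ->
  exists2 x, x \in s & forall y, y \in s -> ~ Q (y - x).
Proof.
move=> QD Q0; elim: s => // x s IH _.
have [->|/IH[m ms mmax]] := eqVneq s [::].
  by exists x; rewrite ?mem_head // => y; rewrite inE => /eqP ->; rewrite subrr.
have [xm|xm] := pselect (Q (x - m)); last first.
  exists m; first by rewrite inE ms orbT.
  by move=> y; rewrite inE => /predU1P[->//|/mmax].
exists x; rewrite ?mem_head // => y; rewrite inE => /predU1P[->|ys].
  by rewrite subrr.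
by move=> yx; apply: (mmax y ys); rewrite -(subrK x y) -addrA; apply: QD.
Qed.

Section Restriction.
Variables (F : fieldType) (g : lieAlgType F) (X : vectType F) (h : {vspace g}).
Variable rho : 'Hom(g, 'End(X)).

Lemma hres_subproof :
  {f : 'Hom(subvs_of h, 'End(X)) | forall y, f y = rho (vsval y)}.
Proof.
apply: (lfun_of_linear (f := fun y : subvs_of h => rho (vsval y))).
by move=> a x y; rewrite !linearP.
Qed.

Definition hres := sval hres_subproof.

Lemma hresE y : hres y = rho (vsval y).
Proof. exact: (svalP hres_subproof). Qed.

End Restriction.
Arguments hres {F g X} h rho.

(** * The Killing form *)

Section NaturalCombinations.
Variables (F : numClosedFieldType) (g : lieAlgType F) (h : {vspace g}).
Local Notation weight := 'Hom(subvs_of h, F^o).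
Implicit Types (D : seq weight) (a b : weight).

Lemma nat_combD D a b : nat_comb D a -> nat_comb D b -> nat_comb D (a + b).
Proof.
move=> [c ->] [c' ->]; exists (fun d => (c d + c' d)%N).
by rewrite -big_split; apply: eq_bigr => d _; rewrite mulrnDr.
Qed.

Lemma nat_comb_anti D a : free D -> nat_comb D a -> nat_comb D (- a) -> a = 0.
Proof.
move=> Dfree [c cE] [c' c'E].
have : \sum_(d <- D) d *+ (c d + c' d) = 0.
  under eq_bigr do rewrite mulrnDr.
  by rewrite big_split -cE -c'E /= subrr.
rewrite (big_nth 0) big_mkord => sum0.
have /(freeP (X := in_tuple D))/(_ (fun i => (c D`_i + c' D`_i)%:R)) D0 := Dfree.
rewrite cE (big_nth 0) big_mkord big1 // => i _.
have /eqP : (c D`_i + c' D`_i)%:R = 0 :> F.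
  apply: D0; rewrite -[RHS]sum0; apply: eq_bigr => j _.
  by rewrite scaler_nat.
by rewrite pnatr_eq0 addn_eq0 => /andP[/eqP-> _].
Qed.

End NaturalCombinations.

Section KillingForm.
Variables (F : numClosedFieldType) (g : lieAlgType F) (h : {vspace g}).
Local Notation weight := 'Hom(subvs_of h, F^o).
Local Notation Phi := (root_system (h:=h)).
Local Notation f := (hres h (@ad F g)).
Variable D : seq weight.
Hypothesis g_semisimple : semisimple g.
Hypothesis h_cartan : cartan_subalgebra h.
Hypothesis D_base : root_base D.
Implicit Types (a b : weight) (x z : g) (y : subvs_of h).

Lemma root_space_wt a x : x \in root_space a <-> wt f a x.
Proof.
split=> [/root_spaceP xa y|xa]; first by rewrite hresE adE (xa y).
by apply/root_spaceP => y; have := xa y; rewrite hresE adE.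
Qed.

Lemma rootP a : Phi a <-> a != 0 /\ exists2 x, x != 0 & wt f a x.
Proof.
split=> [[a0 /vspace_neq0[x /root_space_wt xa x0]]|[a0 [x x0 xa]]].
  by split=> //; exists x.
by split=> //; apply: (vspace_neq0I (x := x)) x0; apply/root_space_wt.
Qed.

Lemma dual_eval y : {e : 'Hom(weight, F^o) | forall a, e a = a y}.
Proof.
apply: (lfun_of_linear (f := fun a : weight => a y)) => c a b.
by rewrite add_lfunE scale_lfunE.
Qed.

Lemma dual_coord n (b : n.-tuple (subvs_of h)) i :
  {c : weight | forall y, c y = coord b i y}.
Proof.
by apply: (lfun_of_linear (V := F^o) (f := coord b i)) => c y z; rewrite linearP.
Qed.

Lemma base_separates y : (forall a, a \in D -> a y = 0) -> y = 0.
Proof.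
move=> Dy; have [_ Db _] := D_base.
have [e eE] := dual_eval y.
have a0 a : a y = 0.
  suff /subvP ker : (fullv <= lker e)%VS.
    by apply/eqP; rewrite -eE -memv_ker ker ?memvf.
  rewrite -(span_basis Db); apply/span_subvP => d /Dy dy.
  by rewrite memv_ker eE dy.
rewrite (coord_vbasis (memvf y)) big1 // => i _.
have [c cE] := dual_coord (vbasis fullv) i.
by rewrite -cE a0 scale0r.
Qed.

(** On a root vector of a simple root, [lie x z] acts by the commutator of two scalars, so every
    simple root vanishes on it; and the simple roots separate the points of [h]. *)
Lemma cartan_abelian x z : x \in h -> z \in h -> lie x z = 0.
Proof.
move=> xh zh; have [h_sub _ _] := h_cartan.
have wh : lie x z \in h by apply: (subvP h_sub); apply: lie_vspace_mem.
pose y := vsproj h x; pose y' := vsproj h z; pose w := vsproj h (lie x z).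
suff w0 : w = 0 by rewrite -(vsprojK wh) -/w w0.
apply: base_separates => a aD; have [D_root _ _] := D_base.
have /rootP[_ [u u0 ua]] := D_root a aD.
have := ua w; rewrite hresE adE /w vsprojK // lie_lieE.
have := ua y; rewrite hresE adE vsprojK // => ->.
have := ua y'; rewrite hresE adE vsprojK // => ->.
have := ua y; rewrite hresE adE vsprojK // => yu.
have := ua y'; rewrite hresE adE vsprojK // => zu.
rewrite !lieZr yu zu !scalerA mulrC subrr => /esym/eqP.
by rewrite scaler_eq0 (negPf u0) orbF => /eqP.
Qed.

Lemma adh_comm y y' x : f y (f y' x) = f y' (f y x).
Proof.
apply/eqP; rewrite -subr_eq0 !hresE !adE -lie_lieE.
by rewrite (cartan_abelian (subvsP y) (subvsP y')) lie0l.
Qed.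

Local Notation pr := (wproj adh_comm).

Lemma gwt_lie a b x z : gwt f a x -> gwt f b z -> gwt f (a + b) (lie x z).
Proof.
move=> ax bz y; have [m mx] := ax y; have [n nz] := bz y; exists (m + n)%N.
apply: iter_leibniz mx nz => [u w|u|u]; rewrite ?lie0l ?lie0r //.
rewrite !shE !hresE !adE add_lfunE scalerDl lieDl lieDr.
rewrite -!scaleN1r !scalerA mulN1r !lieZl !lieZr.
have -> : lie (vsval y) (lie u w) = lie (lie (vsval y) u) w + lie u (lie (vsval y) w).
  by rewrite lie_lieE subrK.
rewrite scalerDr !scalerA !mulN1r -!addrA; congr (_ + _).
by rewrite addrCA; congr (_ + _).
Qed.

Lemma cartan_wt0 x : x \in h -> wt f 0 x.
Proof.
by move=> xh y; rewrite hresE adE cartan_abelian ?subvsP // zero_lfunE scale0r.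
Qed.

Lemma adz_lin z : linear (fun y : subvs_of h => lie (vsval y) z).
Proof. by move=> a y y'; rewrite linearP lieDl lieZl. Qed.

(** A vector outside [h] is replaced, for one basis element [y] of [h] after another, by its last
    iterated image under [ad y] that is outside [h]; the conditions already reached survive because
    [h] is commutative. The final vector is sent into [h] by all of [h], so it normalizes [h] and
    must lie in it. *)
Lemma gwt0_cartan x : gwt f 0 x -> x \in h.
Proof.
move=> x0; apply/negPn/negP => xh; have [_ _ h_norm] := h_cartan.
have sh0 y z : sh f 0 y z = lie (vsval y) z.
  by rewrite shE hresE adE zero_lfunE scale0r subr0.
have step (s : seq (subvs_of h)) : exists z, [/\ gwt f 0 z, z \notin h &
    forall y, y \in s -> lie (vsval y) z \in h].
  elim: s => [|y s [z [z0 zh zs]]]; first by exists x.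
  have [n] := z0 y.
  elim: n z z0 zh zs => [|n IH] z z0 zh zs.
    by move=> z00; rewrite -[z]/(iter 0 (sh f 0 y) z) z00 mem0v in zh.
  rewrite iterSr => nz.
  have [yz|yz] := boolP (lie (vsval y) z \in h).
    by exists z; split=> // y'; rewrite inE => /predU1P[->|/zs].
  apply: (IH (sh f 0 y z)) => //.
  - exact: gwt_sh adh_comm _ _ _ _ z0.
  - by rewrite sh0.
  move=> y' y's; rewrite sh0 -!adE -!hresE adh_comm !hresE !adE.
  by rewrite (@cartan_abelian _ (lie (vsval y') z)) ?mem0v ?subvsP // zs.
have [z [_ zh zs]] := step (vbasis fullv).
case/negP: zh; apply: h_norm => u uh.
rewrite -(vsprojK uh); move: (vsproj h u) => {uh}u; rewrite lieC memvN.
pose ad_z : 'Hom(subvs_of h, g) := sval (lfun_of_linear (adz_lin z)).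
suff /subvP : (fullv <= ad_z @^-1: h)%VS.
  move/(_ u (memvf u)); rewrite -memv_preim.
  by rewrite (svalP (lfun_of_linear (adz_lin z))).
rewrite -(span_basis (vbasisP fullv)); apply/span_subvP => y yb.
rewrite -memv_preim (svalP (lfun_of_linear (adz_lin z))); exact: zs.
Qed.

Lemma wts_root a : a \in wts adh_comm -> a = 0 \/ Phi a.
Proof.
have [->|a0] := eqVneq a 0; first by left.
by move=> /wts_strict[x x0 xa]; right; apply/rootP; split=> //; exists x.
Qed.

Lemma root_wts a : Phi a -> a \in wts adh_comm.
Proof.
by move=> /rootP[_ [x x0 xa]]; apply/wtsP; exists x => //; apply: wt_gwt.
Qed.

(** [phi] is evaluation at the conjugate point of [y]: prescribed on the base, it takes conjugate
    values on all integral combinations of the base. Being linear over [F], it can be applied to any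
    linear combination of roots. *)
Lemma base_conj y : exists phi : 'Hom(weight, F^o),
  forall a, a = 0 \/ Phi a -> phi a = (a y : F)^*.
Proof.
have [_ Db Dsign] := D_base; have Dfree := basis_free Db.
pose T := in_tuple D.
have phi_lin : linear (fun a : weight => \sum_i coord T i a * (T`_i y : F)^* : F^o).
  move=> c a b; rewrite scaler_sumr -big_split; apply: eq_bigr => i _ /=.
  by rewrite linearP mulrDl -mulrA.
have [phi phiE] := lfun_of_linear phi_lin.
have phiD d : d \in D -> phi d = (d y : F)^*.
  move=> dD; rewrite phiE -(nth_index 0 dD).
  have iD : (index d D < size D)%N by rewrite index_mem.
  rewrite (bigD1 (Ordinal iD)) //= -[D`_ _]/(T`_(Ordinal iD)) coord_free // eqxx.
  rewrite mul1r big1 ?addr0 // => j ij.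
  by rewrite coord_free // -val_eqE eq_sym val_eqE (negPf ij) mul0r.
have phi_comb a : nat_comb D a -> phi a = (a y : F)^*.
  move=> [c ->]; rewrite lfun_sum sum_lfunE rmorph_sum big_seq [RHS]big_seq.
  apply: eq_bigr => d dD; rewrite -!scaler_nat lfunZ scale_lfunE phiD //.
  by rewrite rmorphM /= conjC_nat.
exists phi => a [->|/Dsign[/phi_comb//|/phi_comb]].
  by rewrite lfun0 zero_lfunE conjC0.
by rewrite lfunN opp_lfunE rmorphN => /oppr_inj.
Qed.

Definition kap x z : F := ltr (ad x \o ad z)%VF.

Lemma kapC x z : kap x z = kap z x.
Proof. exact: ltrC. Qed.

Lemma kap_linl z : scalar (kap^~ z).
Proof. by move=> a x x'; rewrite /kap linearP comp_lfunDl -comp_lfunZl linearP. Qed.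

Lemma kapDl x x' z : kap (x + x') z = kap x z + kap x' z.
Proof. by have := kap_linl z 1 x x'; rewrite scale1r mul1r. Qed.

Lemma kapDr x z z' : kap x (z + z') = kap x z + kap x z'.
Proof. by rewrite ![kap x _]kapC kapDl. Qed.

Lemma kap0l z : kap 0 z = 0.
Proof. by have := kap_linl z (-1) 0 0; rewrite scaler0 addr0 mulN1r addNr. Qed.

Lemma kap0r x : kap x 0 = 0. Proof. by rewrite kapC kap0l. Qed.

Lemma kapZl c x z : kap (c *: x) z = c * kap x z.
Proof. by have := kap_linl z c x 0; rewrite addr0 kap0l addr0. Qed.

Lemma kapZr c x z : kap x (c *: z) = c * kap x z.
Proof. by rewrite kapC kapZl kapC. Qed.

Lemma kap_suml I (r : seq I) (P : pred I) (u : I -> g) z :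
  kap (\sum_(i <- r | P i) u i) z = \sum_(i <- r | P i) kap (u i) z.
Proof. exact: (big_morph (kap^~ z) (fun x x' => kapDl x x' z) (kap0l z)). Qed.

Lemma kap_sumr I (r : seq I) (P : pred I) (u : I -> g) x :
  kap x (\sum_(i <- r | P i) u i) = \sum_(i <- r | P i) kap x (u i).
Proof. exact: (big_morph (kap x) (kapDr x) (kap0r x)). Qed.

Lemma ad_lie x z : ad (lie x z) = ((ad x \o ad z) - (ad z \o ad x))%VF.
Proof.
by apply/lfunP => w; rewrite add_lfunE opp_lfunE !comp_lfunE !adE lie_lieE.
Qed.

Lemma kap_lie x z w : kap (lie x z) w = kap x (lie z w).
Proof.
rewrite /kap !ad_lie comp_lfunDl comp_lfunDr comp_lfunNl comp_lfunNr !linearB /=.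
by rewrite -!comp_lfunA; congr (_ - _); rewrite ltrC -comp_lfunA.
Qed.

Lemma kap_cartan y y' : kap (vsval y) (vsval y') =
  \sum_(a <- wts adh_comm) (a y : F) * a y' * ltr (pr a).
Proof. by rewrite -(ltr_ff adh_comm) !hresE. Qed.

Lemma root_sqsum_ge0 y :
  0 <= \sum_(a <- wts adh_comm) (a y : F) * (a y : F)^* * ltr (pr a).
Proof.
rewrite big_seq; apply: sumr_ge0 => a /ltr_wproj[n ->].
by rewrite mulr_ge0 ?ler0n // mul_conjC_ge0.
Qed.

Lemma root_sqsum_eq0 y :
  \sum_(a <- wts adh_comm) (a y : F) * (a y : F)^* * ltr (pr a) = 0 -> y = 0.
Proof.
rewrite big_seq => /eqP; rewrite psumr_eq0 => [/allP sum0|a /ltr_wproj[n ->]].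
  apply: base_separates => a aD; have [D_root _ _] := D_base.
  have aw := root_wts (D_root a aD).
  have := sum0 a aw; rewrite aw /=; have [n ->] := ltr_wproj aw.
  by rewrite !mulf_eq0 conjC_eq0 pnatr_eq0 orbF orbb => /eqP.
by rewrite mulr_ge0 ?ler0n // mul_conjC_ge0.
Qed.

(** The argument of [phi] is the functional [kap y] on [h], with [ltr (pr a)] the multiplicity of
    [a]. Applying [phi] to it turns the form into a sum of squares of absolute values. *)
Lemma conj_sqsum y : exists phi : 'Hom(weight, F^o),
  phi (\sum_(a <- wts adh_comm) ((a y : F) * ltr (pr a)) *: a) =
    \sum_(a <- wts adh_comm) (a y : F) * (a y : F)^* * ltr (pr a) /\
  forall a, a = 0 \/ Phi a -> phi a = (a y : F)^*.
Proof.
have [phi phiE] := base_conj y; exists phi; split=> //.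
rewrite lfun_sum big_seq [RHS]big_seq; apply: eq_bigr => a aw.
by rewrite lfunZ phiE 1?mulrAC //; apply: wts_root.
Qed.

Lemma kap_cartanE y : forall y', kap (vsval y) (vsval y') =
  (\sum_(a <- wts adh_comm) ((a y : F) * ltr (pr a)) *: a) y'.
Proof.
move=> y'; rewrite kap_cartan sum_lfunE; apply: eq_bigr => a _.
by rewrite scale_lfunE mulrAC.
Qed.

Lemma kap_cartan_nondeg y : (forall y', kap (vsval y) (vsval y') = 0) -> y = 0.
Proof.
move=> y0; apply: root_sqsum_eq0; have [phi [<- _]] := conj_sqsum y.
rewrite (_ : \sum_(_ <- _) _ = 0) ?lfun0 //.
by apply/lfunP => y'; rewrite -kap_cartanE y0 zero_lfunE.
Qed.

End KillingForm.

(** * Nondegeneracy of the Killing form and diagonal action of the Cartan subalgebra *)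

Section Nondegenerate.
Variables (F : numClosedFieldType) (g : lieAlgType F) (h : {vspace g}).
Local Notation weight := 'Hom(subvs_of h, F^o).
Local Notation Phi := (root_system (h:=h)).
Local Notation f := (hres h (@ad F g)).
Variable D : seq weight.
Hypothesis g_semisimple : semisimple g.
Hypothesis h_cartan : cartan_subalgebra h.
Hypothesis D_base : root_base D.
Implicit Types (a b : weight) (x z : g) (y : subvs_of h).

Let adC := adh_comm h_cartan D_base.
Local Notation wh := (wts adC).
Local Notation pr := (wproj adC).

Lemma abelian_ideal_eq0 (I : {vspace g}) :
  (forall x z, z \in I -> lie x z \in I) ->
  (forall x z, x \in I -> z \in I -> lie x z = 0) -> I = 0%VS.
Proof.
move=> Ideal Iab; apply: g_semisimple.
  by apply: lie_vspace_sub => x z _; apply: Ideal.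
exists 1%N; apply/eqP; rewrite -subv0; apply: lie_vspace_sub => x z xI zI.
by rewrite Iab ?mem0v.
Qed.

Definition pos_comb : set weight := [set a | a != 0 /\ nat_comb D a].

Lemma pos_combD a b : pos_comb a -> pos_comb b -> pos_comb (a + b).
Proof.
move=> [a0 aD] [b0 bD]; split; last exact: nat_combD.
apply: contraNneq a0 => /eqP; rewrite addr_eq0 => /eqP aE.
have [_ Db _] := D_base.
by rewrite (nat_comb_anti (basis_free Db) aD) // aE opprK.
Qed.

Lemma pos_comb0 : ~ pos_comb 0.
Proof. by case; rewrite eqxx. Qed.

Lemma wts_sign a : a \in wh -> [\/ a = 0, pos_comb a | pos_comb (- a)].
Proof.
move=> /wts_root[->|Pa]; first by constructor 1.
have [_ _ /(_ a Pa)[aD|aD]] := D_base; have [a0 _] := Pa.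
  by constructor 2.
by constructor 3; rewrite /pos_comb /= oppr_eq0.
Qed.

Section Engel.
Variable I : {vspace g}.
Hypothesis I_ideal : forall x z, z \in I -> lie x z \in I.
Hypothesis I_cartan : forall x, x \in I -> x \in h -> x = 0.

(* A maximal weight vector [w] of [W] is killed by the positive part of [I];
   unless the negative part kills it as well, the submodule that it generates
   strictly below [w] is smaller than [W]. *)
Lemma ideal_common_zero (W : {vspace g}) : stable f W ->
  (forall x w, x \in I -> w \in W -> lie x w \in W) -> W <> 0%VS ->
  exists w, [/\ w \in W, w != 0 & forall x, x \in I -> lie x w = 0].
Proof.
have [n] := ubnP (\dim W); elim: n W => // n IH W dimW fW IW W0.
pose inW a := `[< exists x, [/\ x \in W, x != 0 & gwt f a x] >].
have inWP a x : x \in W -> x != 0 -> gwt f a x -> a \in [seq a <- wh | inW a].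
  move=> xW x0 ax; rewrite mem_filter; apply/andP; split.
    by apply/asboolP; exists x.
  by apply/wtsP; exists x.
have [|mu] := maximal_ex pos_combD pos_comb0 (s := [seq a <- wh | inW a]).
  have [mu [x [xW x0] mx]] := common_eigen adC fW W0.
  by have := inWP _ _ xW x0 (wt_gwt mx); case: [seq _ <- _ | _].
rewrite mem_filter => /andP[/asboolP[w0 [w0W w00 mw0]] _] mu_max.
have [w [wW w_neq0 mw]] := gwt_strict adC fW w0W w00 mw0.
have above b x : x \in W -> gwt f b x -> pos_comb (b - mu) -> x = 0.
  move=> xW bx bmu; apply/eqP/negPn/negP => x0.
  exact: (mu_max b (inWP _ _ xW x0 bx)).
have IposW x a : x \in I -> gwt f a x -> pos_comb a -> lie x w = 0.
  move=> xI ax apos; apply: (above (a + mu)); first exact: IW.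
    exact: gwt_lie (wt_gwt mw).
  by rewrite addrK.
have fI : stable f I by move=> y x xI; rewrite hresE adE I_ideal.
have prI a x : x \in I -> pr a x \in I by apply: wproj_stable.
have pr0I x : x \in I -> pr 0 x = 0.
  move=> xI; apply: I_cartan; first exact: prI.
  by apply: (gwt0_cartan h_cartan D_base); apply: wproj_gwt.
pose S : set g := [set x | x \in I /\ exists2 a, pos_comb (- a) & gwt f a x].
have [Sw|Sw] := pselect (forall x, S x -> lie x w = 0).
  exists w; split=> // x xI; rewrite [x](wproj_sum adC) lie_suml big1_seq //.
  move=> a /andP[_ /wts_sign[->|apos|aneg]]; first by rewrite pr0I ?lie0l.
    by apply: IposW apos; [apply: prI | apply: wproj_gwt].
  by apply: Sw; split; [apply: prI | exists a => //; apply: wproj_gwt].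
have {Sw} [x1 Sx1 x1w] : exists2 x, S x & lie x w <> 0.
  by apply: contrapT => N; apply: Sw => x Sx; apply: contrapT => xw; apply: N; exists x.
pose B0 : set g := [set u | exists2 x, S x & u = lie x w].
have [M M_gen] := generated_ex ad S B0.
have [B0M SM minM] := M_gen.
pose T : set g := [set x | x \in h \/
  x \in I /\ exists2 a, pos_comb a & gwt f a x].
have S_h y x : S x -> S (lie (vsval y) x).
  move=> [xI [a aneg ax]]; split; first exact: I_ideal.
  by exists a => //; rewrite -adE -hresE; apply: gwt_f.
have S_B0 x : S x -> lie x w \in M by move=> Sx; apply: B0M; exists x.
have lieI_cases x z a b : x \in I -> gwt f a x -> z \in I -> gwt f b z ->
    [\/ T (lie x z), S (lie x z) | lie x z = 0].
  move=> xI ax zI bz; have xzI : lie x z \in I by apply: I_ideal.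
  have xzw := gwt_lie ax bz.
  have [->|xz0] := eqVneq (lie x z) 0; first by constructor 3.
  have /wts_sign[ab0|abpos|abneg] : a + b \in wh by apply/wtsP; exists (lie x z).
  - constructor 3; apply: I_cartan => //; apply: (gwt0_cartan h_cartan D_base).
    by rewrite -ab0.
  - by constructor 1; right; split=> //; exists (a + b).
  - by constructor 2; split=> //; exists (a + b).
have TM : stable_under ad T M.
  apply: (generated_stable ad_representation M_gen) => [t _ Tt [x Sx ->]|t s Tt Ss].
    rewrite adE; have -> : lie t (lie x w) = lie (lie t x) w + lie x (lie t w).
      by rewrite lie_lieE subrK.
    case: Tt => [th|[tI [a apos ta]]].
      have := mw (vsproj h t); rewrite hresE adE vsprojK // => ->.
      rewrite lieZr memvD ?memvZ ?S_B0 //.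
      by have := S_h (vsproj h t) x Sx; rewrite vsprojK.
    rewrite (IposW t a) // lie0r addr0.
    have [xI [b bneg bx]] := Sx.
    have [[xh|[txI [c cpos cx]]]|Stx|->] := lieI_cases t x a b tI ta xI bx.
    - by rewrite (I_cartan (I_ideal t xI)) ?lie0l ?mem0v.
    - by rewrite (IposW _ c) ?mem0v.
    - exact: S_B0.
    - by rewrite lie0l mem0v.
  case: Tt => [th|[tI [a apos ta]]].
    by right; left; have := S_h (vsproj h t) s Ss; rewrite vsprojK.
  have [sI [b bneg bs]] := Ss.
  have [?|?|?] := lieI_cases t s a b tI ta sI bs; [by left|by right; left|].
  by right; right.
have IM x u : x \in I -> u \in M -> lie x u \in M.
  move=> xI uM; rewrite [x](wproj_sum adC) lie_suml big_seq.
  apply: memv_suml => a /wts_sign[->|apos|aneg].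
  - by rewrite pr0I ?lie0l ?mem0v.
  - rewrite -adE; apply: TM => //; right; split; first exact: prI.
    by exists a => //; apply: wproj_gwt.
  - rewrite -adE; apply: SM => //; split; first exact: prI.
    by exists a => //; apply: wproj_gwt.
have fM : stable f M.
  by move=> y u uM; rewrite hresE; apply: TM => //; left; apply: subvsP.
pose U := (W :&: lker (pr mu))%VS.
have MU : (M <= U)%VS.
  have SU x u : S x -> u \in W -> lie x u \in U.
    move=> [xI [a aneg ax]] uW; rewrite memv_cap IW //= memv_ker.
    rewrite [u](wproj_sum adC) lie_sumr lfun_sum big1_seq // => b _.
    have axb := gwt_lie ax (wproj_gwt adC b u).
    have [muE|] := eqVneq mu (a + b); last exact: wproj_gwt0 axb.
    rewrite (above b (pr b u)) ?lie0r ?lfun0 //.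
    - exact: wproj_stable.
    - exact: wproj_gwt.
    - by rewrite muE opprD addrCA subrr addr0.
  apply: minM => [u [x Sx ->]|x u Sx]; first exact: SU.
  by rewrite memv_cap adE => /andP[uW _]; apply: SU.
have [||u [uM u0 Iu]] := IH M _ fM IM.
- apply: leq_trans (_ : \dim M < \dim W)%N _; last by rewrite -ltnS.
  have MW : (M <= W)%VS by apply: subv_trans MU (capvSl _ _).
  rewrite (ltn_leqif (dimv_leqif_sup MW)); apply/negP => /subvP/(_ w wW) wM.
  have := subvP MU _ wM; rewrite memv_cap wW memv_ker (wproj_id adC) //=.
    by rewrite (negPf w_neq0).
  exact: wt_gwt.
- by apply: (vspace_neq0I (S_B0 _ Sx1)); apply/eqP.
exists u; split=> //; apply: (subvP (capvSl W (lker (pr mu)))).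
exact: (subvP MU).
Qed.

End Engel.

(** The radical [I] is an ideal that meets [h] in [0]. If it were nonzero, [ideal_common_zero],
    applied to [I] acting on itself, would give a nonzero central element of [I]; but the centre of
    [I] is an abelian ideal of [g]. *)
Lemma kap_nondeg x : (forall z, kap x z = 0) -> x = 0.
Proof.
pose A : set g := [set x | forall z, kap x z = 0].
pose I := vspan A.
have IP z : z \in I <-> A z.
  apply: vspan_closedP => [w|a u w uA wA z']; first by rewrite kap0l.
  by rewrite kapDl kapZl uA wA mulr0 addr0.
have I_ideal u z : z \in I -> lie u z \in I.
  move=> /IP zA; apply/IP => w.
  by rewrite lieC -scaleN1r kapZl kap_lie zA mulr0.
have I_cartan z : z \in I -> z \in h -> z = 0.
  move=> /IP zA zh; rewrite -(vsprojK zh).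
  rewrite (@kap_cartan_nondeg _ _ _ D h_cartan D_base (vsproj h z)) //.
  by move=> y'; rewrite vsprojK.
move=> xA; have xI : x \in I by apply/IP.
suff I0 : I = 0%VS by apply/eqP; rewrite -memv0 -I0.
have fI : stable f I by move=> y z zI; rewrite hresE adE I_ideal.
pose ZA : set g := [set z | z \in I /\ forall u, u \in I -> lie u z = 0].
have ZP z : z \in vspan ZA <-> ZA z.
  apply: vspan_closedP => [|c u w [uI uZ] [wI wZ]]; split=> [|v vI].
  - exact: mem0v.
  - by rewrite lie0r.
  - by rewrite memvD ?memvZ.
  - by rewrite lieDr lieZr uZ // wZ // scaler0 addr0.
have Z0 : vspan ZA = 0%VS.
  apply: abelian_ideal_eq0 => u z.
    move=> /ZP[zI zZ]; apply/ZP; split=> [|v vI]; first exact: I_ideal.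
    have -> : lie v (lie u z) = lie (lie v u) z + lie u (lie v z).
      by rewrite lie_lieE subrK.
    rewrite (zZ v) // lie0r addr0 zZ //.
    by rewrite lieC memvN I_ideal.
  by move=> /ZP[uI _] /ZP[zI zZ]; apply: zZ.
apply: contrapT => /(ideal_common_zero I_ideal I_cartan fI)[|w [wI w0 wZ]].
  by move=> u w uI wI; apply: I_ideal.
by case/eqP: w0; apply/eqP; rewrite -memv0 -Z0; apply/ZP.
Qed.

(** The nilpotent part [d] of [ad y] acts on generalized weight vectors as [sh], hence is a
    derivation. Since [d \o ad u] is traceless for all [u], [kap (d x) u = tr ([d, ad x] ad u) = tr
    (d ad [x, u]) = 0], and nondegeneracy gives [d = 0]. *)
Lemma ad_diag mu x : gwt f mu x -> wt f mu x.
Proof.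
move=> mx y; have [d dA] : exists d, d = f y - ss adC y by eexists.
suff d0 x' : d x' = 0.
  have /eqP := d0 x; rewrite dA add_lfunE opp_lfunE (ssE adC y mx) subr_eq0.
  by move=> /eqP.
have dE nu u : gwt f nu u -> d u = sh f nu y u.
  by move=> nu_u; rewrite dA add_lfunE opp_lfunE (ssE adC y nu_u) shE.
have d_gwt nu u : gwt f nu u -> gwt f nu (d u).
  by move=> nu_u; rewrite (dE nu) //; apply: gwt_sh adC _ _ _ _ nu_u.
have d_lie_gwt a b u w : gwt f a u -> gwt f b w ->
    d (lie u w) = lie (d u) w + lie u (d w).
  move=> ua wb; rewrite (dE a u ua) (dE b w wb) (dE (a + b) _ (gwt_lie ua wb)).
  rewrite !shE !hresE !adE add_lfunE scalerDl lieDl lieDr.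
  rewrite -!scaleN1r !scalerA mulN1r !lieZl !lieZr.
  have -> : lie (vsval y) (lie u w) =
      lie (lie (vsval y) u) w + lie u (lie (vsval y) w) by rewrite lie_lieE subrK.
  rewrite scalerDr !scalerA !mulN1r -!addrA; congr (_ + _).
  by rewrite addrCA; congr (_ + _).
have ad_d u : ad (d u) = ((d \o ad u) - (ad u \o d))%VF.
  apply: (lfun_eq_gwt adC) => b w wb.
  rewrite add_lfunE opp_lfunE !comp_lfunE !adE.
  rewrite [u](wproj_sum adC) lfun_sum !lie_suml lfun_sum -sumrB.
  apply: eq_bigr => a _; have ua := wproj_gwt adC a u.
  by rewrite (d_lie_gwt a b) // addrK.
have tr_d u : ltr (d \o ad u)%VF = 0.
  rewrite [u](wproj_sum adC) linear_sum /=.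
  have -> : (d \o \sum_(a <- wh) ad (pr a u))%VF = \sum_(a <- wh) (d \o ad (pr a u))%VF.
    apply/lfunP => w; rewrite comp_lfunE !sum_lfunE lfun_sum.
    by apply: eq_bigr => a _; rewrite comp_lfunE.
  rewrite linear_sum big1 // => a _ /=.
  have [->|a0] := eqVneq a 0.
    have uh := gwt0_cartan h_cartan D_base (wproj_gwt adC 0 u).
    have [n dn] := fsub_ss_nil adC y; rewrite dA; apply: ltr_nil_comm dn => w.
    rewrite -(vsprojK uh) -hresE !add_lfunE !opp_lfunE lfunB.
    by rewrite adC ss_f.
  apply: (@ltr_gwt _ _ _ _ adC (d \o ad (pr a u))%VF) => b w wb; rewrite comp_lfunE adE.
  apply: (@wproj_gwt0 _ _ _ _ adC _ (a + b)).
    exact/d_gwt/gwt_lie/wb/wproj_gwt.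
  by rewrite eq_sym -subr_eq0 addrK.
apply: kap_nondeg => u; rewrite /kap ad_d comp_lfunDl comp_lfunNl linearB /=.
rewrite -!comp_lfunA [X in _ - X]ltrC -comp_lfunA -linearB /= -comp_lfunNr -comp_lfunDr.
by rewrite -ad_lie tr_d.
Qed.

End Nondegenerate.

(** * Roots *)

Section Representations.
Variables (F : numClosedFieldType) (g : lieAlgType F) (h : {vspace g}).
Variables (X : vectType F) (rho : 'Hom(g, 'End(X))).
Hypothesis rhoP : representation rho.
Local Notation weight := 'Hom(subvs_of h, F^o).
Implicit Types (a mu : weight) (x : g) (u : X).

Lemma rhoC x z u : rho x (rho z u) = rho z (rho x u) + rho (lie x z) u.
Proof. by rewrite rhoP addrC subrK. Qed.

Lemma wt_rho a mu x u : wt (hres h ad) a x -> wt (hres h rho) mu u ->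
  wt (hres h rho) (a + mu) (rho x u).
Proof.
move=> xa um y; have := xa y; have := um y; rewrite !hresE adE rhoC => -> ->.
by rewrite !lfunZ scale_lfunE add_lfunE scalerDl addrC.
Qed.

End Representations.

Section Roots.
Variables (F : numClosedFieldType) (g : lieAlgType F) (h : {vspace g}).
Local Notation weight := 'Hom(subvs_of h, F^o).
Local Notation Phi := (root_system (h:=h)).
Local Notation f := (hres h (@ad F g)).
Variable D : seq weight.
Hypothesis g_semisimple : semisimple g.
Hypothesis h_cartan : cartan_subalgebra h.
Hypothesis D_base : root_base D.
Implicit Types (a b : weight) (x z : g) (y : subvs_of h).

Let adC := adh_comm h_cartan D_base.
Local Notation wh := (wts adC).
Local Notation pr := (wproj adC).
Let diag := ad_diag g_semisimple h_cartan D_base.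

Lemma wt_lie a b x z : wt f a x -> wt f b z -> wt f (a + b) (lie x z).
Proof. by rewrite -adE; apply/wt_rho/ad_representation. Qed.

Lemma wt_iter a b x z k : wt f a x -> wt f b z ->
  wt f (b + a *+ k) (iter k (ad x) z).
Proof.
move=> xa zb; elim: k => [|k IH]; first by rewrite addr0.
by rewrite iterS adE mulrS addrCA; apply: wt_lie.
Qed.

Lemma wt_root a x : wt f a x -> x != 0 -> a != 0 -> Phi a.
Proof. by move=> xa x0 a0; apply/rootP; split=> //; exists x. Qed.

Lemma wt0_cartan x : wt f 0 x -> x \in h.
Proof. by move=> /wt_gwt /(gwt0_cartan h_cartan D_base). Qed.

Lemma pr_wt a x : wt f a (pr a x).
Proof. exact/diag/wproj_gwt. Qed.

Lemma kap_orth a b x z : wt f a x -> wt f b z -> a + b != 0 -> kap x z = 0.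
Proof.
move=> xa zb /eqP ab0; apply: contrapT => /eqP k0; apply: ab0; apply/lfunP => y.
have := kap_lie x (vsval y) z; rewrite [lie x _]lieC.
have := xa y; have := zb y; rewrite !hresE !adE => -> ->.
rewrite -scaleNr kapZl kapZr => /eqP.
rewrite -subr_eq0 -mulrBl mulf_eq0 (negPf k0) orbF -opprD oppr_eq0.
by rewrite add_lfunE zero_lfunE => /eqP.
Qed.

Lemma kap_dual a x : wt f a x -> x != 0 -> exists2 z, wt f (- a) z & kap x z != 0.
Proof.
move=> xa x0; apply: contrapT => N; case/eqP: x0.
apply: (kap_nondeg g_semisimple h_cartan D_base) => z.
rewrite [z](wproj_sum adC) kap_sumr big1 // => b _.
have [ab|ab] := eqVneq (a + b) 0; last exact: kap_orth xa (pr_wt b z) ab.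
apply/eqP/negPn/negP => k0; apply: N; exists (pr b z) => //.
by rewrite -(addKr a b) ab addr0 in k0 *; apply: pr_wt.
Qed.

Lemma root_opp a : Phi a -> Phi (- a).
Proof.
move=> /rootP[a0 [x x0 xa]]; have [z za kz] := kap_dual xa x0.
apply: (wt_root za); last by rewrite oppr_eq0.
by apply: contraNneq kz => ->; rewrite kap0r.
Qed.

Lemma tau_subproof : {t : 'Hom(weight, subvs_of h) |
  forall a y, kap (vsval (t a)) (vsval y) = a y}.
Proof.
have K_lin : linear (fun y => \sum_(a <- wh) ((a y : F) * ltr (pr a)) *: a).
  move=> c y y'; rewrite scaler_sumr -big_split; apply: eq_bigr => a _ /=.
  by rewrite linearP scalerA -scalerDl mulrDl mulrA.
have [K KE] := lfun_of_linear K_lin.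
have Kk y y' : kap (vsval y) (vsval y') = K y y' by rewrite KE (kap_cartanE h_cartan D_base).
have K0 : lker K == 0%VS.
  rewrite -subv0; apply/subvP => y; rewrite memv_ker memv0 => /eqP Ky.
  apply/eqP/(kap_cartan_nondeg h_cartan D_base) => y'.
  by rewrite Kk Ky zero_lfunE.
have Kf : limg K = fullv.
  apply/eqP; rewrite eqEdim subvf limg_dim_eq; last by rewrite (eqP K0) capv0.
  by rewrite !dimvf /= {1}/dim /= muln1.
exists (K^-1)%VF => a y; rewrite Kk limg_lfunVK // Kf; exact: memvf.
Qed.

Definition tau := sval tau_subproof.

Lemma tauE a y : kap (vsval (tau a)) (vsval y) = a y.
Proof. exact: (svalP tau_subproof). Qed.

Lemma tauC a b : a (tau b) = b (tau a) :> F.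
Proof. by rewrite -tauE kapC tauE. Qed.

Lemma tau_unique a y : (forall y', kap (vsval y) (vsval y') = a y') -> y = tau a.
Proof.
move=> ya; apply/eqP; rewrite -subr_eq0; apply/eqP.
apply: (kap_cartan_nondeg h_cartan D_base) => y'.
by rewrite linearB /= -scaleN1r kapDl kapZl ya tauE mulN1r subrr.
Qed.

(** The functional [kap (tau a)] is [a] itself, so the conjugate of [a (tau a)] is [phi a], the sum
    of the [|b (tau a)| ^ 2] with multiplicities. It vanishes only if [tau a], and hence [a],
    does. *)
Lemma tau_gt0 a : Phi a -> 0 < (a (tau a) : F).
Proof.
move=> Pa; have [a0 _] := Pa.
have [phi [phi_sum phi_conj]] := conj_sqsum h_cartan D_base (tau a).
have sumE : \sum_(b <- wh) ((b (tau a) : F) * ltr (pr b)) *: b = a.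
  by apply/lfunP => y; rewrite -(kap_cartanE h_cartan D_base) tauE.
rewrite sumE phi_conj in phi_sum; last by right.
have ge0 := root_sqsum_ge0 h_cartan D_base (tau a).
rewrite -phi_sum conjC_ge0 in ge0.
rewrite lt_neqAle ge0 andbT eq_sym; apply: contraNneq a0 => at0.
have t0 : tau a = 0.
  apply: (root_sqsum_eq0 (h_cartan := h_cartan) (D_base := D_base)).
  by rewrite -phi_sum at0 conjC0.
by apply/eqP/lfunP => y; rewrite -tauE t0 kap0l zero_lfunE.
Qed.

Lemma lie_root a x z : wt f a x -> wt f (- a) z ->
  lie x z = kap x z *: vsval (tau a).
Proof.
move=> xa za; have xzh : lie x z \in h.
  by apply: wt0_cartan; rewrite -(subrr a); apply: wt_lie.
rewrite -(vsprojK xzh) -linearZ -linearZ /=; congr vsval; apply: tau_unique => y.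
rewrite vsprojK // kap_lie lieC.
have := za y; rewrite hresE adE => ->.
by rewrite opp_lfunE scaleNr opprK kapZr mulrC scale_lfunE.
Qed.

(* The coroot of [a]; it is [0] if [a (tau a) = 0]. *)
Definition hc a := (2%:R / (a (tau a) : F)) *: tau a.

Lemma hcE a : Phi a -> a (hc a) = 2%:R :> F.
Proof. by move=> /tau_gt0/gt_eqF a0; rewrite lfunZ -[_ *: _]/(_ * _) divfK ?a0. Qed.

Lemma triple_ex a x : Phi a -> wt f a x -> x != 0 ->
  exists2 z, wt f (- a) z & lie x z = vsval (hc a).
Proof.
move=> Pa xa x0; have [z za k0] := kap_dual xa x0.
exists ((2%:R / (a (tau a) : F) / kap x z) *: z); first exact: wtZ.
by rewrite lieZr (lie_root xa za) scalerA divfK // linearZ.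
Qed.

Lemma triple_sl2 (X : vectType F) (rho : 'Hom(g, 'End(X))) a x z :
  representation rho -> Phi a -> wt f a x -> wt f (- a) z ->
  lie x z = vsval (hc a) -> sl2 (rho x) (rho z) (rho (vsval (hc a))).
Proof.
move=> rhoP Pa xa za xz; split=> u; first by rewrite -rhoP xz.
  rewrite -rhoP; have := xa (hc a); rewrite hresE adE hcE // => ->.
  by rewrite lfunZ scale_lfunE.
rewrite -rhoP; have := za (hc a); rewrite hresE adE opp_lfunE hcE // => ->.
by rewrite lfunZ scale_lfunE scaleNr.
Qed.

(** Subtracting a multiple of [x] makes [x'] orthogonal to [z], so that the difference commutes with
    [z]. If nonzero, it would be a highest weight vector of weight [-2] for the opposite triple. *)
Lemma root_dim1 a x x' : Phi a -> wt f a x -> x != 0 -> wt f a x' ->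
  exists c, x' = c *: x.
Proof.
move=> Pa xa x0 xa'; have [z za xz] := triple_ex Pa xa x0.
have k0 : kap x z != 0.
  apply/eqP => k0; have := lie_root xa za; rewrite k0 scale0r xz => h0.
  have := hcE Pa; rewrite (_ : hc a = 0) ?lfun0; last exact: val_inj.
  by move/eqP; rewrite eq_sym pnatr_eq0.
pose c := kap x' z / kap x z; exists c.
pose u := x' - c *: x; have ua : wt f a u.
  by rewrite /u addrC -scaleNr; apply: wt_lin.
apply/eqP; rewrite -subr_eq0 -/u; apply/negPn/negP => u0.
have zu : ad z u = 0.
  have kuz : kap u z = 0 by rewrite /u -scaleNr kapDl kapZl mulNr divfK // subrr.
  by rewrite adE lieC (lie_root ua za) kuz scale0r oppr0.
have sl := sl2_sym (triple_sl2 ad_representation Pa xa za xz).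
have [|n /eqP] := @sl2_hw _ _ _ _ _ u (- 2%:R) sl u0 zu.
  by rewrite opp_lfunE -hresE ua hcE // scaleNr.
by rewrite eq_sym -addr_eq0 -natrD pnatr_eq0 addn2.
Qed.

(** If [lie x z = 0], climb [k] steps from a root vector of [a + b] to the top [u] of its string,
    then descend [k + 1] steps into the line of [z]. The vector reached is killed by [x], while the
    [sl2] formula makes its image a nonzero multiple of the nonzero vector found one step
    earlier. *)
Lemma lie_root_neq0 a b x z : Phi a -> Phi b -> Phi (a + b) ->
  wt f a x -> x != 0 -> wt f b z -> z != 0 -> lie x z != 0.
Proof.
move=> Pa Pb /rootP[_ [w w0 wab]] xa x0 zb z0; apply/eqP => xz.
have [e ea xe] := triple_ex Pa xa x0.
have sl := triple_sl2 ad_representation Pa xa ea xe.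
have hz : ad (vsval (hc a)) z = (b (hc a) : F) *: z by rewrite -hresE zb.
have adxz : ad x z = 0 by rewrite adE.
have [n nE _] := sl2_hw sl z0 adxz hz.
have hw : ad (vsval (hc a)) w = (2%:R + n%:R) *: w.
  by rewrite -hresE wab add_lfunE hcE // nE.
have hwk := sl2_wtE sl hw.
have nil_x : nil_at (ad x) w.
  by apply: (sl2_nilL (sl2_sym sl) (c := - (2%:R + n%:R))); rewrite opp_lfunE hw scaleNr.
have [k [k0 kS]] := iter_first0 w0 nil_x.
have [m mE v0] := sl2_hw sl k0 kS (hwk k).
have {}mE : m = (2 + n + k * 2)%N.
  by apply/eqP; rewrite -(eqr_nat F) !natrD natrM mE.
have km : (k < m)%N by rewrite mE muln2 -addnn addnA !addSn ltnS leqW // leq_addl.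
set u := iter k (ad x) w in k0 kS v0.
have va : wt f b (iter k.+1 (ad e) u).
  have := wt_iter k.+1 ea (wt_iter k xa wab).
  rewrite (_ : a + b + a *+ k + - a *+ k.+1 = b) //.
  by rewrite mulNrn mulrS opprD [a + b]addrC addrACA subrr addr0 addrK.
have [c cE] := root_dim1 Pb zb z0 va.
have := sl2_EL sl kS (hwk k) k; rewrite cE lfunZ adxz scaler0 => /esym/eqP.
rewrite scaler_eq0 (negPf (v0 k (ltnW km))) orbF mulf_eq0 pnatr_eq0 /=.
by rewrite -natrM -!natrD -mE subr_eq0 eqr_nat gtn_eqF.
Qed.

End Roots.

(** * Positive systems *)

Section PositiveSystems.
Variables (F : numClosedFieldType) (g : lieAlgType F) (h : {vspace g}).
Local Notation weight := 'Hom(subvs_of h, F^o).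
Local Notation Phi := (root_system (h:=h)).
Implicit Types (P : set weight) (a b : weight).

(** What the weight arguments need of the positive roots, in a form symmetric under opposites: it
    serves for the positive roots on [V] and for the negative roots on the dual of [V]. *)
Definition positive_system P := [/\ P `<=` Phi,
  forall a, Phi a -> P a \/ P (- a) &
  forall s : seq weight, s != [::] -> {in s, forall a, P a} -> \sum_(a <- s) a <> 0].

Definition pos_sum P : set weight := [set a |
  exists s : seq weight, [/\ s != [::], {in s, forall b, P b} & a = \sum_(b <- s) b]].

Lemma pos_sumD P a b : pos_sum P a -> pos_sum P b -> pos_sum P (a + b).
Proof.
move=> [s [s0 sP ->]] [s' [s'0 s'P ->]]; exists (s ++ s'); split.
- by case: s s0 {sP}.
- by move=> c; rewrite mem_cat => /orP[/sP|/s'P].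
- by rewrite big_cat.
Qed.

Lemma pos_sum_pos P a : P a -> pos_sum P a.
Proof.
by move=> Pa; exists [:: a]; split=> // [b|]; rewrite ?inE ?big_seq1 // => /eqP ->.
Qed.

Section Theory.
Variable P : set weight.
Hypothesis P_pos : positive_system P.

Lemma pos_sum0 : ~ pos_sum P 0.
Proof. by case: P_pos => _ _ P0 [s [s0 sP /esym]]; apply: P0. Qed.

Lemma pos_opp a : P a -> ~ P (- a).
Proof.
move=> Pa Na; apply: pos_sum0; rewrite -(subrr a).
by apply: pos_sumD; apply: pos_sum_pos.
Qed.

Lemma pos_add a b : P a -> P b -> Phi (a + b) -> P (a + b).
Proof.
move=> Pa Pb; case: (P_pos) => _ sign _ /sign[//|Nab]; exfalso; apply: pos_sum0.
rewrite -(subrr (a + b)); apply: pos_sumD (pos_sum_pos Nab).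
by apply: pos_sumD; apply: pos_sum_pos.
Qed.

Lemma pos_sum_muln a b k : P a -> P b -> pos_sum P (a + b *+ k).
Proof.
move=> Pa Pb; elim: k => [|k IH]; first by rewrite addr0; apply: pos_sum_pos.
by rewrite mulrSr addrA; apply/pos_sumD/pos_sum_pos.
Qed.

End Theory.
End PositiveSystems.

Section BaseSystems.
Variables (F : numClosedFieldType) (g : lieAlgType F) (h : {vspace g}).
Local Notation weight := 'Hom(subvs_of h, F^o).
Local Notation Phi := (root_system (h:=h)).
Variable D : seq weight.
Hypothesis g_semisimple : semisimple g.
Hypothesis h_cartan : cartan_subalgebra h.
Hypothesis D_base : root_base D.
Implicit Types (a b : weight).

Let opp := root_opp g_semisimple h_cartan D_base.

Lemma pos_comb_sum (s : seq weight) : s != [::] ->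
  {in s, forall a, pos_roots D a} -> pos_comb D (\sum_(a <- s) a).
Proof.
have comb a : pos_roots D a -> pos_comb D a by move=> [[a0 _] aD].
elim: s => // a s IH _ sP; rewrite big_cons.
have aP := comb a (sP a (mem_head _ _)).
have [->|s0] := eqVneq s [::]; first by rewrite big_nil addr0.
apply: (pos_combD D_base) => //; apply: IH => // b bs.
by apply: sP; rewrite inE bs orbT.
Qed.

Lemma pos_roots_positive : positive_system (pos_roots D).
Proof.
split=> [a []//|a Pa|s s0 /(pos_comb_sum s0)[/eqP]//].
have [_ _ /(_ a Pa)[aD|aD]] := D_base; [by left | right].
by split=> //; apply: opp.
Qed.

Lemma neg_rootsE a : neg_roots D a <-> pos_roots D (- a).
Proof. by split=> [[b ? <-]|?]; [rewrite opprK | exists (- a); rewrite ?opprK]. Qed.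

Lemma opp_positive (P : set weight) : positive_system P ->
  positive_system [set a | P (- a)].
Proof.
move=> [sub sign sum0]; split=> [a /sub/opp|a /sign[]|s s0 sN s_sum].
- by rewrite opprK.
- by move=> Pa; right; rewrite /= opprK.
- by move=> Pa; left.
apply: (sum0 [seq - a | a <- s]).
- by case: (s) s0.
- by move=> _ /mapP[a /sN Pa ->].
- by rewrite big_map sumrN s_sum oppr0.
Qed.

End BaseSystems.

(** * Root strings and the Weyl vector of a symmetric closed set of roots *)

Section Reflections.
Variables (F : numClosedFieldType) (g : lieAlgType F) (h : {vspace g}).
Local Notation weight := 'Hom(subvs_of h, F^o).
Local Notation Phi := (root_system (h:=h)).
Local Notation f := (hres h (@ad F g)).
Variable D : seq weight.
Hypothesis g_semisimple : semisimple g.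
Hypothesis h_cartan : cartan_subalgebra h.
Hypothesis D_base : root_base D.
Variables (P Psi : set weight).
Hypothesis P_pos : positive_system P.
Hypothesis Psi_closed : closed_roots Psi.
Hypothesis Psi_sym : forall a, Psi a -> Psi (- a).
Implicit Types (a b : weight) (x z : g) (y : subvs_of h).

Local Notation tau := (tau h_cartan D_base).
Local Notation hc := (hc h_cartan D_base).
Local Notation wh := (wts (adh_comm h_cartan D_base)).

Lemma Psi_root a : Psi a -> Phi a.
Proof. by case: Psi_closed => sub _ /sub. Qed.

Lemma coroot_int a b : Phi a -> Phi b ->
  exists n k : nat, a (hc b) = n%:R - k%:R :> F.
Proof.
move=> /rootP[_ [z z0 za]] Pb; have /rootP[_ [x x0 xb]] := Pb.
have [e eb xe] := triple_ex g_semisimple h_cartan D_base Pb xb x0.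
have sl := triple_sl2 ad_representation Pb xb eb xe.
have hz : ad (vsval (hc b)) z = (a (hc b) : F) *: z by rewrite -hresE za.
have nil_x : nil_at (ad x) z.
  by apply: (sl2_nilL (sl2_sym sl) (c := - (a (hc b) : F))); rewrite opp_lfunE hz scaleNr.
have [k [k0 kS]] := iter_first0 z0 nil_x.
have [n nE _] := sl2_hw sl k0 kS (sl2_wtE sl hz k).
by exists n, (k * 2)%N; rewrite -nE natrM addrK.
Qed.

(** [a + k b] is the reflection of [a] in [b]. Root spaces being lines, [sl2_string] shows that
    every intermediate [a + j b] is a root, and closedness then leads from [a] to the reflection one
    step at a time. *)
Lemma Psi_string a b k : Psi a -> P a -> Psi b -> P b ->
  a (hc b) = - k%:R :> F -> Psi (a + b *+ k) /\ P (a + b *+ k).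
Proof.
move=> Pa apos Pb bpos ab.
have /rootP[_ [z z0 za]] := Psi_root Pa; have /rootP[_ [x x0 xb]] := Psi_root Pb.
have [e eb xe] := triple_ex g_semisimple h_cartan D_base (Psi_root Pb) xb x0.
have sl := triple_sl2 ad_representation (Psi_root Pb) xb eb xe.
have hz : ad (vsval (hc b)) z = - k%:R *: z by rewrite -hresE za ab.
have mult i : exists c, iter i (ad x) (iter i (ad e) z) = c *: z.
  apply: (root_dim1 g_semisimple h_cartan D_base (Psi_root Pa)) => //.
  have := wt_iter i xb (wt_iter i eb za).
  by rewrite mulNrn subrK.
have nz := sl2_string sl z0 hz mult.
have root_j j : (j <= k)%N -> Phi (a + b *+ j).
  move=> jk; apply: (wt_root (wt_iter j xb za)); first exact: nz.
  by apply/eqP => ab0; apply: (pos_sum0 P_pos); rewrite -ab0; apply: pos_sum_muln.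
suff H j : (j <= k)%N -> Psi (a + b *+ j) /\ P (a + b *+ j) by apply: H.
elim: j => [|j IH] jk; first by rewrite addr0.
have [Pj Pj'] := IH (ltnW jk); have := root_j _ jk; rewrite mulrSr addrA => Rj.
by split; [case: Psi_closed => _; apply | apply: (pos_add P_pos)].
Qed.

Definition Psi_pos_seq := [seq a <- wh | `[< Psi a /\ P a >]].

Lemma Psi_pos_seqP a : (a \in Psi_pos_seq) <-> Psi a /\ P a.
Proof.
rewrite mem_filter; split=> [/andP[/asboolP]//|aP]; apply/andP; split; first exact/asboolP.
by apply: root_wts; apply: Psi_root; case: aP.
Qed.

(* Half of the sum below is the Weyl vector of [Psi] paired with the coroot of [b].
   The reflection in [b] maps the negative terms injectively to opposite
   positive terms, and does not reach the positive term [b (hc b) = 2]. *)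
Lemma weyl_vector_gt0 b : Psi b -> P b ->
  0 < \sum_(a <- Psi_pos_seq) (a (hc b) : F).
Proof.
move=> Pb bpos; pose v a : F := a (hc b); pose r a := a - (v a : F) *: b.
have vb : v b = 2%:R by rewrite /v hcE //; apply: Psi_root.
have vr a : v (r a) = - v a.
  rewrite /r /v add_lfunE opp_lfunE scale_lfunE -/(v b) vb -[_ *: _]/(_ * _).
  by rewrite -/(v a); ring.
have rr a : r (r a) = a by rewrite {1}/r vr scaleNr opprK /r subrK.
have v_int a : a \in Psi_pos_seq -> exists n k : nat, v a = n%:R - k%:R.
  by move=> /Psi_pos_seqP[Pa _]; apply: coroot_int; apply: Psi_root.
have v_neg a : a \in Psi_pos_seq -> v a < 0 -> r a \in Psi_pos_seq.
  move=> aL va; have [n [k nk]] := v_int a aL.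
  have nk' : (n < k)%N by rewrite -(ltr_nat F) -subr_lt0 -nk.
  have vE : v a = - (k - n)%:R by rewrite nk natrB ?(ltnW nk') // opprB.
  apply/Psi_pos_seqP; have [Pa apos] := (Psi_pos_seqP a).1 aL.
  rewrite /r vE scaleNr opprK scaler_nat.
  by apply: Psi_string.
pose N := [seq a <- Psi_pos_seq | v a < 0].
pose M := [seq a <- Psi_pos_seq | ~~ (v a < 0)].
have M_ge0 a : a \in M -> 0 <= v a.
  rewrite mem_filter => /andP[va /v_int[n [k nk]]].
  by rewrite real_ltNge ?negbK // in va; rewrite nk rpredB // realn.
have uL : uniq Psi_pos_seq by rewrite filter_uniq // wts_uniq.
pose s := b :: map r N.
have bM : b \in M by rewrite mem_filter vb ltrn0; apply/Psi_pos_seqP.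
have us : uniq s.
  rewrite /= map_inj_uniq; last exact: (can_inj rr).
  rewrite (filter_uniq _ uL) andbT.
  apply/mapP => -[a]; rewrite mem_filter => /andP[va aL] bE.
  have aE : a = - b by rewrite -(rr a) -bE /r vb scaler_nat mulr2n opprD addrA subrr sub0r.
  have [_ apos] := (Psi_pos_seqP a).1 aL.
  by rewrite aE in apos; apply: (pos_opp P_pos bpos).
have sM : {subset s <= M}.
  move=> a; rewrite inE => /predU1P[->//|/mapP[a' + ->]].
  rewrite mem_filter => /andP[va a'L]; rewrite mem_filter vr oppr_lt0.
  by rewrite (v_neg a') // andbT (lt_gtF va).
have le_sM : \sum_(a <- s) v a <= \sum_(a <- M) v a.
  rewrite [leRHS](bigID (mem s)) /= -[X in _ <= X + _]big_filter.
  rewrite [X in _ <= X + _](perm_big s) /=; last first.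
    apply: uniq_perm => // [|a]; first by rewrite (filter_uniq _ (filter_uniq _ uL)).
    by rewrite mem_filter andb_idr // => /sM.
  rewrite lerDl big_seq_cond; apply: sumr_ge0 => a /andP[aM _].
  exact: M_ge0.
rewrite (bigID (fun a => v a < 0)) /= -big_filter -[X in _ + X]big_filter -/N -/M.
apply: lt_le_trans (_ : 0 < \sum_(a <- N) v a + \sum_(a <- s) v a) _; last first.
  by rewrite lerD2l.
rewrite big_cons big_map vb.
under [X in _ + (_ + X)]eq_bigr do rewrite vr.
by rewrite sumrN addrCA subrr addr0 ltr0n.
Qed.

End Reflections.

(** * The Casimir operator *)

Section Casimir.
Variables (F : numClosedFieldType) (g : lieAlgType F) (h : {vspace g}).
Local Notation weight := 'Hom(subvs_of h, F^o).
Local Notation Phi := (root_system (h:=h)).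
Local Notation f := (hres h (@ad F g)).
Variable D : seq weight.
Hypothesis g_semisimple : semisimple g.
Hypothesis h_cartan : cartan_subalgebra h.
Hypothesis D_base : root_base D.
Variables (P Psi : set weight).
Hypothesis P_pos : positive_system P.
Hypothesis Psi_closed : closed_roots Psi.
Hypothesis Psi_sym : forall a, Psi a -> Psi (- a).
Variables (X : vectType F) (rho : 'Hom(g, 'End(X))).
Hypothesis rhoP : representation rho.
Implicit Types (a b mu : weight) (x z : g) (y : subvs_of h) (u w : X).

Local Notation tau := (tau h_cartan D_base).
Local Notation hc := (hc h_cartan D_base).
Local Notation wh := (wts (adh_comm h_cartan D_base)).
Local Notation fX := (hres h rho).
Local Notation Psi_pos_seq := (Psi_pos_seq h_cartan D_base P Psi).

Lemma hres_comm y y' u : fX y (fX y' u) = fX y' (fX y u).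
Proof.
rewrite !hresE (rhoC rhoP) (cartan_abelian h_cartan D_base) ?subvsP //.
by rewrite linear0 zero_lfunE addr0.
Qed.

Lemma wt_hc_nat b mu u : Phi b -> u != 0 -> wt fX mu u ->
  (forall x, wt f b x -> rho x u = 0) -> exists n : nat, mu (hc b) = n%:R :> F.
Proof.
move=> Pb u0 um ub; have /rootP[_ [x x0 xb]] := Pb.
have [e eb xe] := triple_ex g_semisimple h_cartan D_base Pb xb x0.
have [|n nE _] := sl2_hw (triple_sl2 rhoP Pb xb eb xe) u0 (ub x xb) (c := mu (hc b)).
  by rewrite -hresE um.
by exists n.
Qed.

Lemma wt_tau_ge0 b mu u : Phi b -> u != 0 -> wt fX mu u ->
  (forall x, wt f b x -> rho x u = 0) -> 0 <= (mu (tau b) : F).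
Proof.
move=> Pb u0 um ub; have [n] := wt_hc_nat Pb u0 um ub.
have b0 := tau_gt0 h_cartan D_base Pb.
rewrite lfunZ -[_ *: _]/(_ * _) => nE.
have -> : (mu (tau b) : F) = n%:R * (b (tau b) : F) / 2%:R.
  by rewrite -nE; field; rewrite gt_eqF //= pnatr_eq0.
by rewrite divr_ge0 ?mulr_ge0 ?ler0n // ltW.
Qed.

Lemma root_vectors_ex : exists ef : weight -> g * g, forall a, Phi a ->
  [/\ wt f a (ef a).1, wt f (- a) (ef a).2 & kap (ef a).1 (ef a).2 = 1].
Proof.
suff H a : exists p : g * g, Phi a ->
    [/\ wt f a p.1, wt f (- a) p.2 & kap p.1 p.2 = 1].
  by have [e eP] := choice H; exists e.
have [Pa|Na] := pselect (Phi a); last by exists (0, 0).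
have /rootP[_ [x x0 xa]] := Pa.
have [z za k0] := kap_dual g_semisimple h_cartan D_base xa x0.
by exists (x, (kap x z)^-1 *: z) => _; split=> //; [apply: wtZ | rewrite kapZr mulVf].
Qed.

Definition ef := sval (cid root_vectors_ex).

Lemma efP a : Phi a ->
  [/\ wt f a (ef a).1, wt f (- a) (ef a).2 & kap (ef a).1 (ef a).2 = 1].
Proof. exact: (svalP (cid root_vectors_ex)). Qed.

Definition hb := vbasis (fullv : {vspace (subvs_of h)}).

Definition hcoord i : weight := sval (dual_coord hb i).

Lemma hcoordE i y : hcoord i y = coord hb i y.
Proof. exact: (svalP (dual_coord hb i)). Qed.

Lemma hb_sum y : y = \sum_(i < _) (hcoord i y : F) *: hb`_i.
Proof. by under eq_bigr do rewrite hcoordE; apply/coord_vbasis/memvf. Qed.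

Definition Psi_seq := [seq a <- wh | `[< Psi a >]].

Lemma Psi_seqP a : (a \in Psi_seq) <-> Psi a.
Proof.
rewrite mem_filter; split=> [/andP[/asboolP]//|aP]; apply/andP; split; first exact/asboolP.
by apply: root_wts; case: Psi_closed => sub _; apply: sub.
Qed.

(** Bases of [m] dual to each other for the Killing form of [g]: a basis of [h] with its dual basis,
    then root vectors of [a] and [- a] for each [a] in [Psi]. *)
Definition cas_pairs : seq (g * g) :=
  [seq (vsval hb`_(nat_of_ord i), vsval (tau (hcoord i))) |
     i <- index_enum 'I_(\dim (fullv : {vspace (subvs_of h)}))]
    ++ [seq ef a | a <- Psi_seq].

(** The weight vectors of [m]; they span it, which suffices to test stability. *)
Definition in_levi x := exists2 a, a = 0 \/ Psi a & wt f a x.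

Lemma levi_lie x z : in_levi x -> in_levi z -> in_levi (lie x z).
Proof.
move=> [a Pa xa] [b Pb zb]; have xz := wt_lie xa zb.
have [->|n0] := eqVneq (lie x z) 0; first by exists 0; [left | apply: wt0].
have [ab|ab] := eqVneq (a + b) 0; first by exists 0; [left | rewrite -ab].
exists (a + b) => //; right; case: Pa Pb ab => [->|Pa] [->|Pb] ab.
- by move: ab; rewrite addr0 eqxx.
- by rewrite add0r.
- by rewrite addr0.
by case: Psi_closed => _; apply=> //; apply: wt_root xz n0 ab.
Qed.

Lemma root_vectors_levi a : Psi a -> in_levi (ef a).1 /\ in_levi (ef a).2.
Proof.
move=> Pa; have [e1 e2 _] := efP (Psi_root Psi_closed Pa).
by split; [exists a | exists (- a)] => //; right => //; apply: Psi_sym.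
Qed.

Lemma cas_repr1 z : in_levi z -> z = \sum_(p <- cas_pairs) kap z p.2 *: p.1.
Proof.
move=> [a aP za]; rewrite big_cat /= !big_map /=.
case: aP => [a0|Pa].
  rewrite [X in _ + X]big1_seq ?addr0; last first.
    move=> b /andP[_ /Psi_seqP Pb]; have [_ e2 _] := efP (Psi_root Psi_closed Pb).
    rewrite (kap_orth za e2) ?scale0r // a0 add0r oppr_eq0.
    by have [] := Psi_root Psi_closed Pb.
  have zh : z \in h by apply: (wt0_cartan h_cartan D_base); rewrite -a0.
  rewrite -{1}(vsprojK zh) [vsproj h z]hb_sum linear_sum /=; apply: eq_bigr => i _.
  by rewrite kapC -{2}(vsprojK zh) tauE.
have [a0 _] := Psi_root Psi_closed Pa.
rewrite big1 ?add0r => [|i _]; last first.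
  rewrite (kap_orth za (cartan_wt0 h_cartan D_base (subvsP _))) ?scale0r //.
  by rewrite addr0.
have [e1 e2 e12] := efP (Psi_root Psi_closed Pa).
have e0 : (ef a).1 != 0 by apply: contra_eq_neq e12 => ->; rewrite kap0l eq_sym oner_eq0.
rewrite (bigD1_seq a) /=; last 2 first.
- exact/Psi_seqP.
- by rewrite filter_uniq // wts_uniq.
have [c ->] := root_dim1 g_semisimple h_cartan D_base (Psi_root Psi_closed Pa) e1 e0 za.
rewrite kapZl e12 mulr1 big_seq_cond big1 ?addr0 // => b /andP[/Psi_seqP Pb ba].
have [_ e2b _] := efP (Psi_root Psi_closed Pb).
by rewrite kapZl (kap_orth e1 e2b) ?mulr0 ?scale0r // subr_eq0 eq_sym.
Qed.

Lemma cas_repr2 z : in_levi z -> z = \sum_(p <- cas_pairs) kap z p.1 *: p.2.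
Proof.
move=> [a aP za]; rewrite big_cat /= !big_map /=.
case: aP => [a0|Pa].
  rewrite [X in _ + X]big1_seq ?addr0; last first.
    move=> b /andP[_ /Psi_seqP Pb]; have [e1 _ _] := efP (Psi_root Psi_closed Pb).
    rewrite (kap_orth za e1) ?scale0r // a0 add0r.
    by have [] := Psi_root Psi_closed Pb.
  have zh : z \in h by apply: (wt0_cartan h_cartan D_base); rewrite -a0.
  rewrite -{1}(vsprojK zh); set y := vsproj h z.
  have -> : y = \sum_(i < _) kap z (vsval hb`_i) *: tau (hcoord i); last first.
    by rewrite linear_sum.
  apply/eqP; rewrite -subr_eq0; apply/eqP/(kap_cartan_nondeg h_cartan D_base) => y'.
  rewrite linearB /= -scaleN1r kapDl kapZl mulN1r linear_sum /= kap_suml.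
  rewrite {1}[y']hb_sum linear_sum /= kap_sumr -sumrB big1 // => i _.
  by rewrite kapZr kapZl tauE vsprojK // mulrC subrr.
have [a0 _] := Psi_root Psi_closed Pa.
rewrite big1 ?add0r => [|i _]; last first.
  rewrite (kap_orth za (cartan_wt0 h_cartan D_base (subvsP _))) ?scale0r //.
  by rewrite addr0.
have PN := Psi_sym Pa.
have [e1 e2 e12] := efP (Psi_root Psi_closed PN); rewrite opprK in e2.
have e0 : (ef (- a)).2 != 0 by apply: contra_eq_neq e12 => ->; rewrite kap0r eq_sym oner_eq0.
rewrite (bigD1_seq (- a)) /=; last 2 first.
- exact/Psi_seqP.
- by rewrite filter_uniq // wts_uniq.
have [c ->] := root_dim1 g_semisimple h_cartan D_base (Psi_root Psi_closed Pa) e2 e0 za.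
rewrite kapZl kapC e12 mulr1 big_seq_cond big1 ?addr0 // => b /andP[/Psi_seqP Pb ba].
have [e1b _ _] := efP (Psi_root Psi_closed Pb).
rewrite kapZl (kap_orth e2 e1b) ?mulr0 ?scale0r //.
by rewrite addrC addr_eq0.
Qed.

Definition cas u := \sum_(p <- cas_pairs) rho p.1 (rho p.2 u).

Lemma cas_linear : linear cas.
Proof.
move=> c u w; rewrite /cas scaler_sumr -big_split; apply: eq_bigr => p _ /=.
by rewrite !(lfunD, lfunZ).
Qed.

Lemma cas_pairs_levi p : p \in cas_pairs -> in_levi p.1 /\ in_levi p.2.
Proof.
rewrite mem_cat => /orP[/mapP[i _ ->]|/mapP[a /Psi_seqP Pa ->]].
  by split; exists 0; [by left| |by left|]; apply/(cartan_wt0 h_cartan D_base)/subvsP.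
exact: root_vectors_levi.
Qed.

(* The two families of correction terms cancel because the Killing form is invariant. *)
Lemma casC x u : in_levi x -> rho x (cas u) = cas (rho x u).
Proof.
move=> xL; rewrite /cas lfun_sum.
have -> : \sum_(p <- cas_pairs) rho x (rho p.1 (rho p.2 u)) =
    \sum_(p <- cas_pairs) rho p.1 (rho p.2 (rho x u)) +
    (\sum_(p <- cas_pairs) rho p.1 (rho (lie x p.2) u) +
     \sum_(p <- cas_pairs) rho (lie x p.1) (rho p.2 u)).
  rewrite -!big_split; apply: eq_bigr => p _ /=.
  by rewrite (rhoC rhoP x p.1) (rhoC rhoP x p.2) lfunD addrA.
have rho_sum I (s : seq I) (c : I -> F) (z : I -> g) w :
    rho (\sum_(i <- s) c i *: z i) w = \sum_(i <- s) c i *: rho (z i) w.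
  rewrite linear_sum sum_lfunE; apply: eq_bigr => i _.
  by rewrite linearZ scale_lfunE.
suff -> : \sum_(p <- cas_pairs) rho (lie x p.1) (rho p.2 u) =
    - \sum_(p <- cas_pairs) rho p.1 (rho (lie x p.2) u) by rewrite subrr addr0.
have -> : \sum_(p <- cas_pairs) rho (lie x p.1) (rho p.2 u) =
    \sum_(p <- cas_pairs) \sum_(q <- cas_pairs)
      kap (lie x p.1) q.2 *: rho q.1 (rho p.2 u).
  rewrite big_seq [RHS]big_seq; apply: eq_bigr => p /cas_pairs_levi[p1 _].
  by rewrite {1}(cas_repr1 (levi_lie xL p1)) rho_sum.
rewrite exchange_big /= -sumrN big_seq [RHS]big_seq.
apply: eq_bigr => q /cas_pairs_levi[_ q2].
rewrite [in RHS](cas_repr2 (levi_lie xL q2)) rho_sum lfun_sum -sumrN.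
apply: eq_bigr => p _; rewrite lfunZ -scaleNr; congr (_ *: _).
by rewrite lieC -scaleN1r kapZl mulN1r kap_lie [kap (lie x _) _]kapC.
Qed.

(** This is [(mu, mu + 2 delta)] for the form carried to the dual by [tau], where [2 delta] is the
    sum of the roots of [Psi] in [P]. *)
Definition cas_val mu : F := (mu (tau mu) : F) + \sum_(a <- Psi_pos_seq) (mu (tau a) : F).

(** For [a] in [P] the pair contributes [[e, f] u], that is [mu (tau a)] times [u]; for the other
    [a] the second component is a raising vector and kills [u]. *)
Lemma cas_hw mu u : wt fX mu u ->
  (forall a x, Psi a -> P a -> wt f a x -> rho x u = 0) -> cas u = cas_val mu *: u.
Proof.
move=> um u_hw; rewrite /cas big_cat /= !big_map /= scalerDl; congr (_ + _).
  have -> : tau mu = \sum_(i < _) (mu hb`_i : F) *: tau (hcoord i).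
    apply/esym/tau_unique => y.
    rewrite linear_sum /= kap_suml [in RHS](hb_sum y) lfun_sum; apply: eq_bigr => i _.
    by rewrite kapZl tauE lfunZ -[RHS]/(_ * _) mulrC.
  rewrite lfun_sum scaler_suml; apply: eq_bigr => i _.
  rewrite -!hresE um lfunZ um scalerA lfunZ; congr (_ *: _).
  exact: mulrC.
rewrite scaler_suml big_filter [RHS]big_filter.
rewrite big_mkcond [RHS]big_mkcond /=; apply: eq_bigr => a _.
case: asboolP => [Pa|Na]; last by case: asboolP => // -[].
have [e1 e2 e12] := efP (Psi_root Psi_closed Pa).
case: asboolP => [[_ apos]|N].
  rewrite (rhoC rhoP) (u_hw a) // lfun0 add0r.
  rewrite (lie_root h_cartan D_base e1 e2) e12 scale1r -hresE um.
  by [].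
rewrite (u_hw (- a) (ef a).2) ?lfun0 //; first exact: Psi_sym.
by have [_ /(_ a (Psi_root Psi_closed Pa))[apos|//] _] := P_pos; case: N.
Qed.

Definition lowering x := exists2 a, Psi a /\ P (- a) & wt f a x.

(** The vectors whose weight is [mu] minus a sum of positive roots of [Psi] span a subspace that
    contains [u] and is stable under lowering, so it contains [M]; projecting onto [nu] kills it
    unless [nu] is one of these weights. *)
Lemma generated_weights mu u (M : {vspace X}) w nu : wt fX mu u ->
  generated_by rho lowering [set u] M -> w \in M -> w != 0 -> wt fX nu w ->
  exists s : seq weight, {in s, forall a, Psi a /\ P a} /\ mu = nu + \sum_(a <- s) a.
Proof.
move=> um [_ _ minM] wM w0 wnu; apply: contrapT => N.
pose A : set X := [set v | exists s : seq weight, {in s, forall a, Psi a /\ P a} /\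
  wt fX (mu - \sum_(a <- s) a) v].
have MA : (M <= vspan A)%VS.
  apply: minM => [v ->|x v [a [Pa aneg] xa]].
    by apply: vspan_mem; exists [::]; split=> //; rewrite big_nil subr0.
  apply: lfun_vspan => {}v [s [sP vs]]; apply: vspan_mem; exists (- a :: s).
  split=> [b|]; first by rewrite inE => /predU1P[->|/sP//]; split=> //; apply: Psi_sym.
  by rewrite big_cons opprD opprK addrCA; apply: wt_rho.
case/eqP: w0; rewrite -(wproj_id hres_comm (wt_gwt wnu)).
apply/eqP; rewrite -memv0; apply: lfun_vspan (subvP MA _ wM) => v [s [sP vs]].
rewrite (wproj_gwt0 hres_comm (wt_gwt vs)) ?mem0v //.
by apply: contra_notN N => /eqP nuE; exists s; split=> //; rewrite nuE subrK.
Qed.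

(** The Casimir operator is the scalar [cas_val mu] on all of [M], so [cas_val nu = cas_val mu].
    Since [mu - nu] is a sum of positive roots of [Psi], both weights pair nonnegatively with these
    roots, and the Weyl vector pairs positively, the sum must be empty. *)
Lemma highest_weight_unique mu u (M : {vspace X}) nu w :
  wt fX mu u -> u != 0 ->
  (forall a x, Psi a -> P a -> wt f a x -> rho x u = 0) ->
  generated_by rho lowering [set u] M ->
  w \in M -> wt fX nu w -> w != 0 ->
  (forall a x, Psi a -> P a -> wt f a x -> rho x w = 0) -> nu = mu.
Proof.
move=> um u0 u_hw M_gen wM wnu w0 w_hw.
have [s [sP muE]] := generated_weights um M_gen wM w0 wnu.
have [casl casE] := lfun_of_linear cas_linear.
have cas_w : cas w = cas_val mu *: w.
  apply/eqP; rewrite -casE; have [_ _ minM] := M_gen.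
  have /subvP/(_ w wM) : (M <= lker (casl - cas_val mu *: \1%VF))%VS.
    have kE v : (v \in lker (casl - cas_val mu *: \1%VF)) = (cas v == cas_val mu *: v).
      rewrite memv_ker add_lfunE opp_lfunE scale_lfunE id_lfunE subr_eq0.
      by rewrite casE.
    apply: minM => [v ->|x v [a [Pa _] xa]]; rewrite !kE; first exact/eqP/cas_hw.
    move=> /eqP vE; rewrite -casC ?vE ?lfunZ //.
    by exists a => //; right.
  by rewrite memv_ker add_lfunE opp_lfunE scale_lfunE id_lfunE subr_eq0.
have /eqP : cas_val mu = cas_val nu.
  apply/eqP; rewrite -subr_eq0; have := cas_hw wnu w_hw.
  rewrite cas_w => /eqP; rewrite -subr_eq0 -scalerBl scaler_eq0.
  by rewrite (negPf w0) orbF.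
(* The difference of the two scalars is [(mu - nu, mu + nu + 2 delta)]; [t a] is the contribution of
   one root [a] of [mu - nu]. *)
rewrite -subr_eq0; pose t a : F := (a (tau mu) : F) + (a (tau nu) : F) +
  \sum_(b <- Psi_pos_seq) (a (tau b) : F).
have -> : cas_val mu - cas_val nu = \sum_(a <- s) t a.
  rewrite /t 2!big_split /= exchange_big /=.
  have lsum y : \sum_(a <- s) (a y : F) = (mu y : F) - nu y.
    by rewrite muE add_lfunE sum_lfunE [X in X - _]addrC addrK.
  rewrite !lsum; under [in RHS]eq_bigr do rewrite lsum.
  rewrite sumrB /cas_val (tauC h_cartan D_base nu mu).
  ring.
have t_gt0 a : a \in s -> 0 < t a.
  move=> /sP[Pa apos]; have Ra := Psi_root Psi_closed Pa.
  have a0 := tau_gt0 h_cartan D_base Ra.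
  apply: ltr_wpDl; first apply: addr_ge0.
  - by rewrite (tauC h_cartan D_base); apply: wt_tau_ge0 Ra u0 um _ => x; apply: u_hw.
  - by rewrite (tauC h_cartan D_base); apply: wt_tau_ge0 Ra w0 wnu _ => x; apply: w_hw.
  have := weyl_vector_gt0 g_semisimple h_cartan D_base P_pos Psi_closed Pa apos.
  under eq_bigr do rewrite lfunZ -[_ *: _]/(_ * _).
  rewrite -mulr_sumr pmulr_rgt0 ?divr_gt0 ?ltr0n //.
  by under eq_bigr do rewrite (tauC h_cartan D_base).
case: s sP muE t_gt0 => [|a s] sP muE t_gt0; first by move=> _; rewrite muE big_nil addr0.
rewrite big_cons gt_eqF // ltr_pwDl ?t_gt0 ?mem_head //.
by rewrite big_seq; apply: sumr_ge0 => b bs; rewrite ltW // t_gt0 // inE bs orbT.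
Qed.

End Casimir.

(** * Complements *)

Section Complements.
Variables (F : numClosedFieldType) (g : lieAlgType F) (h : {vspace g}).
Local Notation weight := 'Hom(subvs_of h, F^o).
Local Notation Phi := (root_system (h:=h)).
Local Notation f := (hres h (@ad F g)).
Variable D : seq weight.
Hypothesis g_semisimple : semisimple g.
Hypothesis h_cartan : cartan_subalgebra h.
Hypothesis D_base : root_base D.
Implicit Types (a b mu : weight) (x z : g) (y : subvs_of h) (P Psi : set weight).

Definition raising P Psi x := exists2 a, Psi a /\ P a & wt f a x.

Definition extremal P Psi (X : vectType F) (rho : 'Hom(g, 'End(X))) mu (u : X) :=
  [/\ wt (hres h rho) mu u, u != 0 &
      forall a x, Psi a -> P a -> wt f a x -> rho x u = 0].

(** A vector of maximal weight in [Z] will do: a nonzero image under a raising vector would have a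
    higher weight in [Z]. *)
Lemma highest_weight_ex P Psi (X : vectType F) (rho : 'Hom(g, 'End(X)))
    (Z : {vspace X}) :
  representation rho -> positive_system P -> stable_under rho [set` h] Z ->
  stable_under rho (raising P Psi) Z -> Z <> 0%VS ->
  exists mu, exists2 w, w \in Z & extremal P Psi rho mu w.
Proof.
move=> rhoP P_pos hZ RZ Z0; have XC := hres_comm h_cartan D_base rhoP.
have fZ : stable (hres h rho) Z.
  by move=> y u uZ; rewrite hresE; apply: hZ => //; apply: subvsP.
pose inZ a := `[< exists x : X, [/\ x \in Z, x != 0 & gwt (hres h rho) a x] >].
have inZP a (x : X) : x \in Z -> x != 0 -> gwt (hres h rho) a x ->
    a \in [seq a <- wts XC | inZ a].
  move=> xZ x0 ax; rewrite mem_filter; apply/andP; split.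
    by apply/asboolP; exists x.
  by apply/wtsP; exists x.
have [|mu] := maximal_ex (@pos_sumD _ _ _ P) (pos_sum0 P_pos)
    (s := [seq a <- wts XC | inZ a]).
  have [mu [x [xZ x0] mx]] := common_eigen XC fZ Z0.
  by have := inZP _ _ xZ x0 (wt_gwt mx); case: [seq _ <- _ | _].
rewrite mem_filter => /andP[/asboolP[w0 [w0Z w00 mw0]] _] mu_max.
have [w [wZ w_neq0 mw]] := gwt_strict XC fZ w0Z w00 mw0.
exists mu, w => //; split=> // a x Pa apos xa; apply/eqP/negPn/negP => xw0.
have xwZ : rho x w \in Z by apply: RZ => //; exists a.
apply: (mu_max _ (inZP _ _ xwZ xw0 (wt_gwt (wt_rho rhoP xa mw)))).
by rewrite addrK; apply: pos_sum_pos.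
Qed.

Section Generated.
Variables (P Psi : set weight).
Hypothesis P_pos : positive_system P.
Hypothesis Psi_closed : closed_roots Psi.
Hypothesis Psi_sym : forall a, Psi a -> Psi (- a).
Variables (X : vectType F) (rho : 'Hom(g, 'End(X))).
Hypothesis rhoP : representation rho.
Variables (mu : weight) (u : X) (M : {vspace X}).
Hypothesis u_ext : extremal P Psi rho mu u.
Hypothesis M_gen : generated_by rho (lowering P Psi) [set u] M.

(** The bracket of a raising and a lowering vector is zero, in [h], raising or lowering, so
    [generated_stable] applies. *)
Lemma generated_raising :
  stable_under rho [set x | x \in h \/ raising P Psi x] M.
Proof.
have [um u0 u_hw] := u_ext; have [BM SM minM] := M_gen.
apply: (generated_stable rhoP M_gen) => [x _ Tx ->|x z Tx [b [Pb bneg] zb]].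
  case: Tx => [xh|[a [Pa apos] xa]]; last by rewrite (u_hw a) ?mem0v.
  have := um (vsproj h x); rewrite hresE vsprojK // => ->.
  by rewrite memvZ // BM.
case: Tx => [xh|[a [Pa apos] xa]].
  have := zb (vsproj h x); rewrite hresE adE vsprojK // => ->.
  by right; left; exists b => //; apply: wtZ.
have xz := wt_lie xa zb.
have [->|n0] := eqVneq (lie x z) 0; first by right; right.
have [ab|ab] := eqVneq (a + b) 0.
  by left; left; apply: (wt0_cartan h_cartan D_base); rewrite -ab.
have Rab := wt_root xz n0 ab.
have Pab : Psi (a + b) by case: Psi_closed => _; apply.
have [_ /(_ _ Rab)[abpos|abneg] _] := P_pos.
  by left; right; exists (a + b).
by right; left; exists (a + b).
Qed.

Lemma generated_levi x : in_levi Psi x -> forall m, m \in M -> rho x m \in M.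
Proof.
have [_ SM _] := M_gen.
move=> [a [a0|Pa] xa] m mM.
  apply: generated_raising => //; left.
  by apply: (wt0_cartan h_cartan D_base); rewrite -a0.
have [_ /(_ a (Psi_root Psi_closed Pa))[apos|aneg] _] := P_pos.
  by apply: generated_raising => //; right; exists a.
by apply: SM => //; exists a.
Qed.

(** Apart from [u] itself, [M] is spanned by vectors of weight [mu] minus a nonempty sum of elements
    of [P]. Such a weight differs from [mu], so the projection onto [mu] leaves only the line of
    [u]. *)
Lemma generated_top w : w \in M -> wt (hres h rho) mu w -> w \in <[u]>%VS.
Proof.
move=> wM wmu; have [um u0 _] := u_ext; have [_ _ minM] := M_gen.
have XC := hres_comm h_cartan D_base rhoP.
pose A : set X := [set v | v = u \/ exists s : seq weight,
  [/\ s != [::], {in s, forall a, Psi a /\ P a} &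
      wt (hres h rho) (mu - \sum_(a <- s) a) v]].
have MA : (M <= vspan A)%VS.
  apply: minM => [v ->|x v [a [Pa aneg] xa]]; first by apply: vspan_mem; left.
  have Pa' := Psi_sym Pa.
  apply: lfun_vspan => {}v [->|[s [s0 sP vs]]]; apply: vspan_mem; right.
    exists [:: - a]; split=> // [b|]; first by rewrite inE => /eqP ->.
    by rewrite big_seq1 opprK addrC; apply: wt_rho.
  exists (- a :: s); split=> // [b|]; first by rewrite inE => /predU1P[->|/sP].
  by rewrite big_cons opprD opprK addrCA; apply: wt_rho.
rewrite -(wproj_id XC (wt_gwt wmu)).
apply: lfun_vspan (subvP MA _ wM) => v [->|[s [s0 sP vs]]].
  by rewrite (wproj_id XC (wt_gwt um)) memv_line.
rewrite (wproj_gwt0 XC (wt_gwt vs)) ?mem0v //.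
rewrite -subr_eq0 opprB addrCA subrr addr0; apply/eqP.
by case: P_pos => _ _; apply=> // a /sP[].
Qed.

Lemma generated_spanned : (M <= vspan [set w | exists nu, wt (hres h rho) nu w])%VS.
Proof.
have [um _ _] := u_ext; have [_ _ minM] := M_gen.
apply: minM => [v ->|x v [a _ xa]]; first by apply: vspan_mem; exists mu.
apply: lfun_vspan => {}v [nu vnu]; apply: vspan_mem; exists (a + nu).
exact: wt_rho.
Qed.

End Generated.

(** * The dual module *)

Section Dual.
Variables (V : vectType F) (rho : 'Hom(g, 'End(V))).
Hypothesis rhoP : representation rho.
Local Notation dualV := 'Hom(V, F^o).

Lemma dual_rep_subproof : {r : 'Hom(g, 'End(dualV)) |
  forall x (phi : dualV) u, r x phi u = - phi (rho x u)}.
Proof.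
have lin1 x : linear (fun phi : dualV => - (phi \o rho x)%VF).
  by move=> a phi psi; rewrite comp_lfunDl -comp_lfunZl opprD scalerN.
pose r x := sval (lfun_of_linear (lin1 x)).
have rE x phi u : r x phi u = - phi (rho x u).
  by rewrite (svalP (lfun_of_linear (lin1 x))) opp_lfunE comp_lfunE.
have lin2 : linear r.
  move=> a x z; apply/lfunP => phi; apply/lfunP => u.
  rewrite add_lfunE scale_lfunE add_lfunE scale_lfunE !rE.
  by rewrite linearP add_lfunE scale_lfunE lfunD lfunZ opprD scalerN.
by have [R RE] := lfun_of_linear lin2; exists R => x phi u; rewrite RE.
Qed.

Definition dual_rep := sval dual_rep_subproof.

Lemma dual_repE x (phi : dualV) u : dual_rep x phi u = - phi (rho x u).
Proof. exact: (svalP dual_rep_subproof). Qed.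

Lemma dual_repP : representation dual_rep.
Proof.
move=> x z phi; apply/lfunP => u; rewrite add_lfunE opp_lfunE !dual_repE !opprK.
by rewrite rhoP lfunB opprB.
Qed.

End Dual.

Lemma dim_common_zeros (V : vectType F) k (phi : 'I_k -> 'Hom(V, F^o)) (N : {vspace V}) :
  (forall w, (forall i, phi i w = 0) -> w \in N) -> (dim V <= k + \dim N)%N.
Proof.
move=> zeros.
have lin : linear (fun w => \row_(i < k) (phi i w : F)).
  by move=> a u w; apply/rowP => i; rewrite !mxE lfunD lfunZ.
have [L LE] := lfun_of_linear lin.
have kerN : (lker L <= N)%VS.
  apply/subvP => w; rewrite memv_ker LE => /eqP/rowP w0; apply: zeros => i.
  by have := w0 i; rewrite !mxE.
rewrite -dimvf -(limg_ker_dim L fullv) capfv addnC leq_add ?dimvS //.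
by apply: leq_trans (dimvS (subvf _)) _; rewrite dimvf dim_matrix mul1r.
Qed.

Section Complement.
Variables (P Psi : set weight).
Hypothesis P_pos : positive_system P.
Hypothesis Psi_closed : closed_roots Psi.
Hypothesis Psi_sym : forall a, Psi a -> Psi (- a).
Variables (V : vectType F) (rho : 'Hom(g, 'End(V))).
Hypothesis rhoP : representation rho.
Variables (l : weight) (v : V) (vd : 'Hom(V, F^o)) (M : {vspace V}).
Hypothesis v_ext : extremal P Psi rho l v.
Hypothesis vd_ext : extremal [set a | P (- a)] Psi (dual_rep rho) (- l) vd.
Hypothesis vdv : vd v != 0.
Hypothesis M_gen : generated_by rho (lowering P Psi) [set v] M.

Lemma levi_h Psi' x : x \in h -> in_levi Psi' x.
Proof. by move=> xh; exists 0; [left | apply: (cartan_wt0 h_cartan D_base)]. Qed.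

(* The complement is the annihilator of the submodule generated by [vd] in the
   dual module: both submodules have only one line of extremal vectors, so
   neither contains a vector that annihilates the other. *)
Lemma levi_complement : exists N : {vspace V},
  [/\ forall x w, in_levi Psi x -> w \in N -> rho x w \in N,
      (M + N = fullv)%VS & (M :&: N = 0)%VS].
Proof.
pose Q : set weight := [set a | P (- a)].
have Q_pos : positive_system Q.
  exact: (opp_positive g_semisimple h_cartan D_base P_pos).
have dP := dual_repP rhoP.
have [Md Md_gen] := generated_ex (dual_rep rho) (lowering Q Psi) [set vd].
have MdL := generated_levi Q_pos Psi_closed dP vd_ext Md_gen.
have ML := generated_levi P_pos Psi_closed rhoP v_ext M_gen.
have vM : v \in M by case: M_gen => + _ _; apply.
have vdM : vd \in Md by case: Md_gen => + _ _; apply.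
pose N := vspan [set w | forall phi, phi \in Md -> phi w = 0].
have NP w : w \in N <-> forall phi, phi \in Md -> phi w = 0.
  apply: (vspan_closedP w) => [phi _|c u u' uN u'N phi phiM]; first by rewrite lfun0.
  by rewrite lfunD lfunZ uN // u'N // scaler0 addr0.
pose K := vspan [set phi : 'Hom(V, F^o) | forall m, m \in M -> phi m = 0].
have KP phi : phi \in K <-> forall m, m \in M -> phi m = 0.
  apply: (vspan_closedP phi) => [m _|c u u' uN u'N m mM]; first by rewrite zero_lfunE.
  by rewrite add_lfunE scale_lfunE uN // u'N // scaler0 addr0.
have NL x w : in_levi Psi x -> w \in N -> rho x w \in N.
  move=> xL /NP wN; apply/NP => phi phiM.
  by apply: oppr_inj; rewrite oppr0 -dual_repE wN // MdL.
have KL x phi : in_levi Psi x -> phi \in K -> dual_rep rho x phi \in K.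
  move=> xL /KP phiK; apply/KP => m mM.
  by rewrite dual_repE phiK ?oppr0 // ML.
have raise_levi R x : raising R Psi x -> in_levi Psi x.
  by move=> [a [Pa _] xa]; exists a => //; right.
have MN0 : (M :&: N = 0)%VS.
  have [//|/eqP Z0] := eqVneq (M :&: N)%VS 0%VS.
  have ZL x w : in_levi Psi x -> w \in (M :&: N)%VS -> rho x w \in (M :&: N)%VS.
    by move=> xL; rewrite !memv_cap => /andP[wM wN]; rewrite ML // NL.
  have [||nu [w wZ [wnu w0 w_hw]]] :=
      highest_weight_ex rhoP P_pos (Z := (M :&: N)%VS) (Psi := Psi) _ _ Z0.
  - by move=> x w xh; apply: ZL; apply: levi_h.
  - by move=> x w xR; apply: ZL; apply: raise_levi xR.
  move: wZ; rewrite memv_cap => /andP[wM /NP wN].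
  have [vl v0 v_hw] := v_ext.
  have nuE := highest_weight_unique g_semisimple h_cartan D_base P_pos Psi_closed Psi_sym rhoP
    vl v0 v_hw M_gen wM wnu w0 w_hw.
  rewrite nuE in wnu.
  have /vlineP[c wE] := generated_top P_pos Psi_sym rhoP v_ext M_gen wM wnu.
  have := wN vd vdM; rewrite wE lfunZ => /eqP.
  by rewrite scaler_eq0 (negPf vdv) orbF => /eqP c0; rewrite wE c0 scale0r eqxx in w0.
have MK0 : (Md :&: K = 0)%VS.
  have [//|/eqP Z0] := eqVneq (Md :&: K)%VS 0%VS.
  have ZL x w : in_levi Psi x -> w \in (Md :&: K)%VS -> dual_rep rho x w \in (Md :&: K)%VS.
    by move=> xL; rewrite !memv_cap => /andP[wM wK]; rewrite MdL // KL.
  have [||nu [w wZ [wnu w0 w_hw]]] :=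
      highest_weight_ex dP Q_pos (Z := (Md :&: K)%VS) (Psi := Psi) _ _ Z0.
  - by move=> x w xh; apply: ZL; apply: levi_h.
  - by move=> x w xR; apply: ZL; apply: raise_levi xR.
  move: wZ; rewrite memv_cap => /andP[wM /KP wK].
  have [vl v0 v_hw] := vd_ext.
  have nuE := highest_weight_unique g_semisimple h_cartan D_base Q_pos Psi_closed Psi_sym dP
    vl v0 v_hw Md_gen wM wnu w0 w_hw.
  rewrite nuE in wnu.
  have /vlineP[c wE] := generated_top Q_pos Psi_sym dP vd_ext Md_gen wM wnu.
  have := wK v vM; rewrite wE scale_lfunE => /eqP.
  by rewrite scaler_eq0 (negPf vdv) orbF => /eqP c0; rewrite wE c0 scale0r eqxx in w0.
exists N; split=> //.
(* Since [Md] and [K] are independent, [dim Md + dim K <= dim V <= dim M + dim K], whence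
   [dim Md <= dim M]. With [dim V <= dim Md + dim N] this makes [M] and [N] large enough to fill
   [V]. *)
have dimN : (dim V <= \dim Md + \dim N)%N.
  apply: (dim_common_zeros (phi := fun i => (vbasis Md)`_i)) => w w0; apply/NP => phi phiM.
  rewrite (coord_vbasis phiM) sum_lfunE big1 // => i _.
  by rewrite scale_lfunE w0 scaler0.
have ev_lin w : linear (fun phi : 'Hom(V, F^o) => phi w : F^o).
  by move=> c phi psi; rewrite add_lfunE scale_lfunE.
pose ev w := sval (lfun_of_linear (ev_lin w)).
have evE w phi : ev w phi = phi w by exact: (svalP (lfun_of_linear (ev_lin w))).
have dimK : (dim ('Hom(V, F^o) : vectType F) <= \dim M + \dim K)%N.
  apply: (dim_common_zeros (phi := fun i => ev (vbasis M)`_i)) => phi phi0; apply/KP => m mM.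
  rewrite (coord_vbasis mM) lfun_sum big1 // => i _.
  by rewrite lfunZ -evE phi0 scaler0.
have dimD : dim ('Hom(V, F^o) : vectType F) = dim V by rewrite {1}/dim /= muln1.
have MdK : (\dim Md + \dim K <= dim V)%N.
  by rewrite -dimD -dimvf -dimv_disjoint_sum // dimvS // subvf.
apply/eqP; rewrite eqEdim subvf dimv_disjoint_sum // dimvf.
rewrite dimD in dimK.
have le_Md : (\dim Md <= \dim M)%N.
  by rewrite -(leq_add2r (\dim K)) (leq_trans MdK).
by apply: leq_trans dimN _; rewrite leq_add2r.
Qed.

End Complement.

End Complements.

(** * Highest weight modules *)

Section HighestWeightModule.
Variables (F : numClosedFieldType) (g : lieAlgType F) (h : {vspace g}).
Local Notation weight := 'Hom(subvs_of h, F^o).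
Local Notation Phi := (root_system (h:=h)).
Local Notation f := (hres h (@ad F g)).
Variable D : seq weight.
Hypothesis g_semisimple : semisimple g.
Hypothesis h_cartan : cartan_subalgebra h.
Hypothesis D_base : root_base D.
Variables (e : weight -> g) (T : set weight) (t : {vspace g}) (l : weight).
Variables (V : vectType F) (rho : 'Hom(g, 'End(V))) (v : V).
Hypothesis e_root_vector : forall a, Phi a -> e a \in root_space a /\ e a <> 0.
Hypothesis T_closed : closed_roots T.
Hypothesis t_sub_h : (t <= h)%VS.
Hypothesis V_simple : simple_highest_weight_module rho D l v.
Implicit Types (a b mu : weight) (x z : g) (y : subvs_of h).

Let rhoP : representation rho. Proof. by case: V_simple. Qed.
Let adC := adh_comm h_cartan D_base.
Let VC := hres_comm h_cartan D_base rhoP.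
Let P := pos_roots D.
Let P_pos : positive_system P.
Proof. exact: pos_roots_positive g_semisimple h_cartan D_base. Qed.
Local Notation Psi := (root_closure (T `|` oppr_set T)).
Local Notation s := (regular_subalgebra T t).
Local Notation fV := (hres h rho).

Lemma roots_closed : closed_roots Phi.
Proof. by split. Qed.

Lemma T_root a : T a -> Phi a.
Proof. by case: T_closed => sub _ /sub. Qed.

Lemma closure_min (S : set weight) :
  closed_roots S -> T `<=` S -> oppr_set T `<=` S -> Psi `<=` S.
Proof. by move=> Sc TS NTS a; apply; split=> // b [/TS|/NTS]. Qed.

Lemma closure_sub a : T a \/ T (- a) -> Psi a.
Proof.
move=> Ta S [_ TS]; apply: TS; case: Ta => Ta; [by left | right].
by exists (- a); rewrite ?opprK.
Qed.

Lemma T_opp_root : oppr_set T `<=` Phi.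
Proof. by move=> _ [a /T_root Ra <-]; apply: (root_opp g_semisimple h_cartan D_base). Qed.

Lemma closure_closed : closed_roots Psi.
Proof.
split; first by apply: closure_min => //; [exact: roots_closed|exact: T_root|exact: T_opp_root].
by move=> a b Pa Pb Rab S [Sc TS]; case: (Sc) => _; apply=> //; [apply: Pa | apply: Pb].
Qed.

(** The roots whose opposites lie in the closure form a closed set that contains [T] and its
    opposite. *)
Lemma closure_opp a : Psi a -> Psi (- a).
Proof.
have [sub add] := closure_closed; move: a.
have Rop := root_opp g_semisimple h_cartan D_base.
apply: (@closure_min [set a | Psi (- a)]).
- split=> [a /sub/Rop|a b Pa Pb Rab]; first by rewrite opprK.
  by rewrite /= opprD; apply: add => //; rewrite -opprD; apply: Rop.
- by move=> a Ta; apply: closure_sub; right; rewrite opprK.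
- by move=> _ [a Ta <-]; apply: closure_sub; left; rewrite opprK.
Qed.

Lemma regular_subalgebra_ind (A : set g) :
  A 0 -> (forall c x z, A x -> A z -> A (c *: x + z)) ->
  (forall x, x \in h -> A x) -> (forall a x, T a -> wt f a x -> A x) ->
  forall x, x \in s -> A x.
Proof.
move=> A0 Alin Ah AT x; rewrite -(vspan_closedP x A0 Alin).
apply/subvP; rewrite subv_add; apply/andP; split.
  apply: subv_trans t_sub_h _; apply/subvP => z zh; exact/vspan_mem/Ah.
apply: vspan_sub => z [a Ta /root_space_wt za]; exact/vspan_mem/(AT a).
Qed.

Lemma levi_submodule (N : {vspace V}) :
  (forall x w, in_levi Psi x -> w \in N -> rho x w \in N) -> submodule rho s N.
Proof.
move=> NL x w xs; move: w.
apply: (@regular_subalgebra_ind [set x | forall w, w \in N -> rho x w \in N]) xs.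
- by move=> w _; rewrite linear0 zero_lfunE mem0v.
- move=> c u z Nu Nz w wN; rewrite linearP add_lfunE scale_lfunE.
  by rewrite memvD ?memvZ ?Nu ?Nz.
- by move=> z zh w; apply: NL; apply: (levi_h h_cartan D_base).
- by move=> a z Ta za w; apply: NL; exists a => //; right; apply: closure_sub; left.
Qed.

Lemma v_extremal (Psi' : set weight) : extremal P Psi' rho l v.
Proof.
case: V_simple => _ _ [v0 vl v_hw]; split=> //.
  by move=> y; rewrite hresE; apply: vl.
by move=> a x _ Pa /root_space_wt; apply: v_hw.
Qed.

(** With all of [Phi] in the role of [Psi], [m] is the whole algebra, so [M] is a nonzero submodule
    of a simple module. Its weight properties thus become properties of [V]. *)
Lemma generated_full M : generated_by rho (lowering P Phi) [set v] M -> M = fullv.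
Proof.
move=> M_gen; have [_ [_ simp] _] := V_simple.
have vM : v \in M by case: M_gen => + _ _; apply.
have ML := generated_levi h_cartan D_base P_pos roots_closed rhoP (v_extremal Phi) M_gen.
case: (simp M) => [x u _ uM|M0|//].
  rewrite [x](wproj_sum adC) linear_sum sum_lfunE big_seq; apply: memv_suml.
  move=> a /wts_root aw; apply: ML => //; exists a => //.
  exact: (pr_wt g_semisimple).
by case: V_simple => _ _ [+ _ _]; rewrite -memv0 -M0 vM.
Qed.

Lemma full_generated : generated_by rho (lowering P Phi) [set v] fullv.
Proof.
by have [M M_gen] := generated_ex rho (lowering P Phi) [set v]; rewrite -(generated_full M_gen).
Qed.

Let Phi_opp : forall a, Phi a -> Phi (- a) := @root_opp _ _ _ _ g_semisimple h_cartan D_base.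

Lemma V_diag mu w : gwt fV mu w -> wt fV mu w.
Proof.
apply: (wt_diag VC) => u.
exact: (subvP (generated_spanned rhoP (v_extremal Phi) full_generated) u (memvf u)).
Qed.

Lemma V_top w : wt fV l w -> w \in <[v]>%VS.
Proof.
apply: (generated_top h_cartan D_base P_pos Phi_opp rhoP (v_extremal Phi) full_generated).
exact: memvf.
Qed.

Lemma V_weights mu w : w != 0 -> wt fV mu w -> exists r : seq weight,
  {in r, forall a, P a} /\ l = mu + \sum_(a <- r) a.
Proof.
move=> w0 wmu; have [vl _ _] := v_extremal Phi.
have [r [rP lE]] := generated_weights h_cartan D_base Phi_opp rhoP vl
  full_generated (memvf w) w0 wmu.
by exists r; split=> // a /rP[].
Qed.

(** [vd] is the projection onto the weight space of [l] followed by the coordinate along [v]. It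
    vanishes on every lowered vector: one of weight [l] would come from a weight above [l], and
    [V_weights] leaves none. *)
Lemma dual_vector_ex : exists vd : 'Hom(V, F^o), vd v != 0 /\
  extremal [set a | P (- a)] Psi (dual_rep rho) (- l) vd.
Proof.
have [vl v0 _] := v_extremal Phi.
pose c (w : V) : F := coord [tuple v] ord0 w.
have cE (k : F) : c (k *: v) = k.
  have fv : free [tuple v] by rewrite seq1_free.
  have := coord_free ord0 ord0 fv; rewrite eqxx /= => c1.
  by rewrite /c linearZ /= c1 mulr1.
have lin : linear (fun w => c (wproj VC l w) : F^o).
  by move=> a u w; rewrite /c lfunD lfunZ linearP.
have [vd vdE] := lfun_of_linear lin; exists vd.
have vdl mu w : wt fV mu w -> mu != l -> vd w = 0.
  by move=> wmu /negPf n; rewrite vdE (wprojE VC l (wt_gwt wmu)) eq_sym n /c linear0.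
have vdv : vd v = 1.
  by rewrite vdE (wproj_id VC (wt_gwt vl)) -[v]scale1r cE.
split; first by rewrite vdv oner_eq0.
split.
- move=> y; apply/lfunP => w; rewrite hresE dual_repE scale_lfunE opp_lfunE scaleNr.
  congr (- _); rewrite [w](wproj_sum VC) !lfun_sum scaler_sumr; apply: eq_bigr => mu _.
  have wmu := V_diag (wproj_gwt VC mu w).
  rewrite -hresE wmu lfunZ; have [->//|n] := eqVneq mu l.
  by rewrite (vdl _ _ wmu n) !scaler0.
- apply: contraTneq isT => vd0; have := vdv.
  by rewrite vd0 zero_lfunE => /esym/eqP; rewrite oner_eq0.
move=> a x _ apos xa; apply/lfunP => w; rewrite dual_repE zero_lfunE.
rewrite [w](wproj_sum VC) !lfun_sum big1 ?oppr0 // => mu _.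
have wmu := V_diag (wproj_gwt VC mu w).
have xw := wt_rho rhoP xa wmu.
have [amu|n] := eqVneq (a + mu) l; last exact: vdl xw n.
have [->|w0] := eqVneq (wproj VC mu w) 0; first by rewrite !lfun0.
have [r [rP]] := V_weights w0 wmu; rewrite -amu addrC => /addrI aE.
exfalso; case: P_pos => _ _ /(_ (- a :: r)); apply=> //.
  by move=> b; rewrite inE => /predU1P[->|/rP].
by rewrite big_cons -aE addNr.
Qed.

(** Root spaces are lines, so stability under the chosen [e c] is stability under all lowering
    vectors; the span therefore does not depend on the choice of [e]. *)
Lemma lowering_span_generated :
  generated_by rho (lowering P Psi) [set v] (lowering_span rho D e (T `|` oppr_set T) v).
Proof.
split=> [_ ->|x w [a [Pa aneg] xa]|U vU SU].
- by apply: vspan_mem; exists [::].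
- have Ra := Psi_root closure_closed Pa.
  have [/root_space_wt ea /eqP e0] := e_root_vector Ra.
  have [c ->] := root_dim1 g_semisimple h_cartan D_base Ra ea e0 xa.
  rewrite linearZ scale_lfunE => wM; apply: memvZ; move: w wM.
  apply: lfun_vspan => _ [cs csP <-]; apply: vspan_mem; exists (a :: cs) => //.
  move=> b; rewrite inE => /predU1P[->|/csP//].
  by split=> //; apply/neg_rootsE.
apply: vspan_sub => _ [cs csP <-].
elim: cs csP => [|c cs IH] csP; first by apply: vU.
have [Pc /neg_rootsE cneg] := csP c (mem_head _ _).
apply: SU; last by apply: IH => b bs; apply: csP; rewrite inE bs orbT.
exists c => //; apply/root_space_wt.
by case: (e_root_vector (Psi_root closure_closed Pc)).
Qed.

Lemma wide_lowering_span : wide rho s ->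
  lowering_span rho D e (T `|` oppr_set T) v = fullv.
Proof.
move=> Vwide; set M := lowering_span _ _ _ _ _.
have M_gen : generated_by rho (lowering P Psi) [set v] M := lowering_span_generated.
have [vd [vdv vd_ext]] := dual_vector_ex.
have [N [NL MN MN0]] := levi_complement g_semisimple h_cartan D_base P_pos
  closure_closed closure_opp rhoP (v_extremal Psi) vd_ext vdv M_gen.
have [//|MT] := pselect (M = fullv); exfalso; apply: Vwide.
have ML := generated_levi h_cartan D_base P_pos closure_closed rhoP (v_extremal Psi) M_gen.
exists M, N; split; last by [].
split.
- by apply: levi_submodule => x w xL; apply: ML.
- exact: levi_submodule.
- have vM : v \in M by case: M_gen => + _ _; apply.
  by apply: (vspace_neq0I vM); have [_ v0 _] := v_extremal Psi.
- by move=> N0; apply: MT; rewrite -MN N0 addv0.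
Qed.

End HighestWeightModule.

(** * The commutant of the regular subalgebra *)

Section EndRepresentation.
Variables (F : fieldType) (g : lieAlgType F) (V : vectType F) (rho : 'Hom(g, 'End(V))).
Hypothesis rhoP : representation rho.

Lemma end_rep_subproof : {r : 'Hom(g, 'End('End(V))) |
  forall x (A : 'End(V)), r x A = ((rho x \o A) - (A \o rho x))%VF}.
Proof.
have lin1 x : linear (fun A : 'End(V) => ((rho x \o A) - (A \o rho x))%VF).
  move=> a A B; rewrite comp_lfunDl comp_lfunDr -comp_lfunZl -comp_lfunZr.
  by rewrite scalerBr opprD addrACA.
pose r x := sval (lfun_of_linear (lin1 x)).
have rE x A : r x A = ((rho x \o A) - (A \o rho x))%VF.
  exact: (svalP (lfun_of_linear (lin1 x))).
have lin2 : linear r.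
  move=> a x z; apply/lfunP => A; rewrite add_lfunE scale_lfunE !rE linearP.
  rewrite comp_lfunDl comp_lfunDr -comp_lfunZl -comp_lfunZr.
  by rewrite scalerBr opprD addrACA.
by have [R RE] := lfun_of_linear lin2; exists R => x A; rewrite RE.
Qed.

Definition end_rep := sval end_rep_subproof.

Lemma end_repE x (A : 'End(V)) : end_rep x A = ((rho x \o A) - (A \o rho x))%VF.
Proof. exact: (svalP end_rep_subproof). Qed.

Lemma end_rep_app x (A : 'End(V)) u : end_rep x A u = rho x (A u) - A (rho x u).
Proof. by rewrite end_repE add_lfunE opp_lfunE !comp_lfunE. Qed.

Lemma end_repP : representation end_rep.
Proof.
move=> x z A; apply/lfunP => u; rewrite add_lfunE opp_lfunE !end_rep_app !rhoP !lfunB.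
have E (G : zmodType) (p q r s m n : G) :
    p - q - (r - s) = p - m - (n - s) - (q - n - (m - r)).
  have tel (x1 x2 x3 : G) : x1 - x2 + (x2 - x3) = x1 - x3 by rewrite addrA subrK.
  rewrite !opprB [RHS]addrACA !tel addrACA [RHS]addrACA.
  by congr (_ + _); rewrite addrC.
exact: E.
Qed.

Lemma end_rep0P x (A : 'End(V)) :
  end_rep x A = 0 <-> forall u, rho x (A u) = A (rho x u).
Proof.
split=> [xA u|xA]; first by apply/eqP; rewrite -subr_eq0 -end_rep_app xA zero_lfunE.
by apply/lfunP => u; rewrite end_rep_app xA subrr zero_lfunE.
Qed.

Lemma end_rep_comp x (A B : 'End(V)) :
  end_rep x (A \o B)%VF = ((end_rep x A \o B) + (A \o end_rep x B))%VF.
Proof.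
apply/lfunP => u; rewrite add_lfunE !comp_lfunE !end_rep_app !comp_lfunE.
by rewrite lfunB addrA subrK.
Qed.

Lemma ltr_end_rep x (A : 'End(V)) : ltr (end_rep x A) = 0.
Proof. by rewrite end_repE linearB /= ltrC subrr. Qed.

End EndRepresentation.

(** * Idempotents of the commutant *)

Section Indecomposability.
Variables (F : numClosedFieldType) (g : lieAlgType F) (h : {vspace g}).
Local Notation weight := 'Hom(subvs_of h, F^o).
Local Notation Phi := (root_system (h:=h)).
Local Notation f := (hres h (@ad F g)).
Variable D : seq weight.
Hypothesis g_semisimple : semisimple g.
Hypothesis h_cartan : cartan_subalgebra h.
Hypothesis D_base : root_base D.
Variables (e : weight -> g) (T : set weight) (t : {vspace g}) (l : weight).
Variables (V : vectType F) (rho : 'Hom(g, 'End(V))) (v : V).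
Hypothesis e_root_vector : forall a, Phi a -> e a \in root_space a /\ e a <> 0.
Hypothesis T_closed : closed_roots T.
Hypothesis t_sub_h : (t <= h)%VS.
Hypothesis V_simple : simple_highest_weight_module rho D l v.
Hypothesis V_lowering : lowering_span rho D e (T `|` oppr_set T) v = fullv.
Implicit Types (a b mu nu : weight) (x z : g) (y : subvs_of h) (A B : 'End(V)).

Let rhoP : representation rho. Proof. by case: V_simple. Qed.
Let VC := hres_comm h_cartan D_base rhoP.
Let EP := end_repP rhoP.
Let EC := hres_comm h_cartan D_base EP.
Local Notation Psi := (root_closure (T `|` oppr_set T)).
Local Notation s := (regular_subalgebra T t).
Local Notation fV := (hres h rho).
Local Notation er := (end_rep rho).
Local Notation fE := (hres h er).

Let Vdiag := V_diag g_semisimple h_cartan D_base V_simple.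

Lemma wproj_fV mu y w : wproj VC mu (fV y w) = (mu y : F) *: wproj VC mu w.
Proof.
rewrite [w in LHS](wproj_sum VC) lfun_sum lfun_sum [w in RHS](wproj_sum VC) lfun_sum.
rewrite scaler_sumr; apply: eq_bigr => nu _.
rewrite (Vdiag (wproj_gwt VC nu w)) lfunZ (wprojE VC mu (wproj_gwt VC nu w)).
by case: eqP => [->//|_]; rewrite !scaler0.
Qed.

(** [A] is the sum of its blocks between weight spaces of [V], and the block from [nu] to [mu] has
    strict weight [mu - nu]. *)
Lemma E_diag nu A : gwt fE nu A -> wt fE nu A.
Proof.
apply: (wt_diag EC) => {nu}A.
have -> : A = \sum_(mu <- wts VC) \sum_(nu <- wts VC)
    (wproj VC mu \o A \o wproj VC nu)%VF.
  apply/lfunP => w; rewrite sum_lfunE [LHS](wproj_sum VC); apply: eq_bigr => mu _.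
  rewrite sum_lfunE [w in LHS](wproj_sum VC) !lfun_sum; apply: eq_bigr => nu _.
  by rewrite !comp_lfunE.
apply: memv_suml => mu _; apply: memv_suml => nu _; apply: vspan_mem.
exists (mu - nu) => y; apply/lfunP => w.
rewrite hresE end_rep_app -hresE !comp_lfunE wproj_fV !lfunZ.
rewrite (Vdiag (wproj_gwt VC mu _)) scale_lfunE !comp_lfunE add_lfunE opp_lfunE.
by rewrite -scalerBl.
Qed.

(** [nu y] times the trace of [A] is the trace of a commutator with [rho y]. *)
Lemma ltr_wt_neq0 nu A : wt fE nu A -> nu != 0 -> ltr A = 0.
Proof.
move=> nuA /eqP nu0; apply: contrapT => /eqP trA; apply: nu0; apply/lfunP => y.
have := ltr_end_rep rho (vsval y) A; rewrite -hresE nuA linearZ /= => /eqP.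
by rewrite mulf_eq0 (negPf trA) orbF zero_lfunE => /eqP.
Qed.

Lemma wt_comp mu nu A B : wt fE mu A -> wt fE nu B -> wt fE (mu + nu) (A \o B)%VF.
Proof.
move=> muA nuB y; rewrite hresE end_rep_comp -!hresE muA nuB.
by rewrite -comp_lfunZl -comp_lfunZr -scalerDl add_lfunE.
Qed.

Definition s_endo A := forall x, x \in s -> er x A = 0.

Lemma s_endo_comp A B : s_endo A -> s_endo B -> s_endo (A \o B)%VF.
Proof.
move=> sA sB x xs; rewrite end_rep_comp sA // sB //.
by rewrite comp_lfun0l comp_lfun0r addr0.
Qed.

Lemma root_s a x : T a -> wt f a x -> x \in s.
Proof.
move=> Ta /root_space_wt xa; apply: (subvP (addvSr t _)).
by apply: vspan_mem; exists a.
Qed.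

Lemma lie_s_h x y : x \in s -> lie x (vsval y) \in s.
Proof.
apply: (@regular_subalgebra_ind _ _ _ _ _ t_sub_h [set x | lie x (vsval y) \in s]).
- by rewrite /= lie0l mem0v.
- by move=> c u z us zs; rewrite /= lieDl lieZl memvD ?memvZ.
- by move=> z zh; rewrite /= (cartan_abelian h_cartan D_base) ?subvsP ?mem0v.
- move=> a z Ta za; rewrite /= lieC; have := za y; rewrite hresE adE => ->.
  by rewrite memvN memvZ // (root_s Ta).
Qed.

Lemma s_endo_wproj nu A : s_endo A -> s_endo (wproj EC nu A).
Proof.
move=> sA; pose C : {vspace 'End(V)} := vspan [set B | s_endo B].
have CP B : B \in C <-> s_endo B.
  apply: (vspan_closedP B) => [x _|c B1 B2 s1 s2 x xs]; first by rewrite lfun0.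
  by rewrite lfunD lfunZ s1 // s2 // scaler0 addr0.
apply/CP; apply: wproj_stable; last exact/CP.
move=> y B /CP sB; apply/CP => x xs; rewrite hresE (rhoC EP) sB // lfun0 add0r.
exact/sB/lie_s_h.
Qed.

Lemma s_endo_scalar A : s_endo A -> wt fE 0 A -> exists c, A = c *: \1%VF.
Proof.
move=> sA A0.
have hA y : er (vsval y) A = 0 by rewrite -hresE A0 zero_lfunE scale0r.
(* The roots whose root vectors commute with [A]. They are closed under addition because the bracket
   of the root spaces of [b] and [c] fills that of [b + c]. *)
pose Q : set weight := [set c | Phi c /\ forall x, wt f c x -> er x A = 0].
have QT : T `<=` Q.
  move=> a Ta; split; first exact: T_root T_closed _ Ta.
  by move=> x xa; apply/sA/root_s/xa.
have Qclosure : Psi `<=` Q.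
  apply: closure_min => //.
  - split=> [a []//|b c [Rb bA] [Rc cA] Rbc]; split=> // x xbc.
    have /rootP[_ [u u0 ub]] := Rb; have /rootP[_ [w w0 wc]] := Rc.
    have n0 := lie_root_neq0 g_semisimple h_cartan D_base Rb Rc Rbc ub u0 wc w0.
    have [k ->] := root_dim1 g_semisimple h_cartan D_base Rbc (wt_lie ub wc) n0 xbc.
    rewrite linearZ scale_lfunE EP (bA u) // (cA w) // !lfun0 subr0.
    by rewrite scaler0.
  - move=> _ [a Ta <-]; have [Ra aA] := QT a Ta.
    have Rn := root_opp g_semisimple h_cartan D_base Ra.
    split=> // x xa; have /rootP[_ [u u0 ua]] := Ra.
    have [z za uz] := triple_ex g_semisimple h_cartan D_base Ra ua u0.
    have z0 : z != 0.
      apply/eqP => z0; move: uz; rewrite z0 lie0r => hc0.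
      have := hcE h_cartan D_base Ra; rewrite (_ : hc _ _ a = 0) ?lfun0; last exact: val_inj.
      by move/eqP; rewrite eq_sym pnatr_eq0.
    have [k ->] := root_dim1 g_semisimple h_cartan D_base Rn za z0 xa.
    rewrite linearZ scale_lfunE.
    (* In [End V], [A] has weight 0 and is killed by the raising operator of the triple, so the
       lowering operator kills it as well. *)
    rewrite (sl2_inv (triple_sl2 EP Ra ua za uz) (aA u ua) (hA _)).
    by rewrite scaler0.
have [vl v0 _] := v_extremal V_simple Phi.
have /vlineP[c Av] : A v \in <[v]>%VS.
  apply: (V_top g_semisimple h_cartan D_base V_simple) => y.
  by rewrite hresE (end_rep0P _ _ _).1 ?hA // -hresE vl lfunZ.
exists c; apply/lfunP => w; rewrite scale_lfunE id_lfunE.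
have kE u : (u \in lker (A - c *: \1%VF)) = (A u == c *: u).
  by rewrite memv_ker add_lfunE opp_lfunE scale_lfunE id_lfunE subr_eq0.
apply/eqP; rewrite -kE; apply: (subvP _ _ (memvf w)); rewrite -V_lowering.
have [_ _] := lowering_span_generated g_semisimple h_cartan D_base rho v e_root_vector T_closed.
apply=> [u ->|x u [a [Pa _] xa]]; rewrite !kE; first by rewrite Av.
move=> /eqP Au; have [_ aA] := Qclosure a Pa.
by rewrite -((end_rep0P _ _ _).1 (aA x xa)) Au lfunZ.
Qed.

Lemma V_dim_neq0 : (\dim {:V})%:R != 0 :> F.
Proof.
have [_ v0 _] := v_extremal V_simple Phi.
rewrite pnatr_eq0 dimv_eq0; apply/eqP => V0; case/eqP: v0; apply/eqP.
by rewrite -memv0 -V0 memvf.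
Qed.

Lemma ltr_scalar c : ltr (c *: \1%VF : 'End(V)) = c * (\dim {:V})%:R.
Proof. by rewrite linearZ /= ltr1. Qed.

(* If [A \o B] were a nonzero scalar [c], then so would be [B \o A], and the trace
   of [rho y \o A \o B] computed in two ways would give [nu y * c * dim V = 0]. *)
Lemma ltr_comp_eq0 nu A B : s_endo A -> s_endo B -> wt fE nu A -> nu != 0 ->
  ltr (A \o B)%VF = 0.
Proof.
move=> sA sB nuA nu0.
have -> : ltr (A \o B)%VF = \sum_(k <- wts EC) ltr (A \o wproj EC k B)%VF.
  rewrite -linear_sum /=; congr ltr; apply/lfunP => w.
  rewrite sum_lfunE comp_lfunE {1}[B](wproj_sum EC) sum_lfunE lfun_sum.
  by apply: eq_bigr => k _; rewrite comp_lfunE.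
apply: big1 => k _; have kB := E_diag (wproj_gwt EC k B).
have sBk : s_endo (wproj EC k B) by apply: s_endo_wproj.
move: (wproj EC k B) kB sBk => {sB}B kB sB.
have ABw := wt_comp nuA kB.
have [nk|] := eqVneq (nu + k) 0; last exact: ltr_wt_neq0.
rewrite nk in ABw; have [c ABc] := s_endo_scalar (s_endo_comp sA sB) ABw.
have [c0|c0] := eqVneq c 0; first by rewrite ABc c0 scale0r linear0.
(* As [A \o B] is a nonzero scalar, [B] is injective, hence invertible, and [A] is [c] times its
   inverse. *)
have B0 : lker B == 0%VS.
  rewrite -subv0; apply/subvP => w; rewrite memv_ker memv0 => /eqP Bw.
  have := congr1 (fun C : 'End(V) => C w) ABc.
  rewrite comp_lfunE Bw lfun0 scale_lfunE id_lfunE => /esym/eqP.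
  by rewrite scaler_eq0 (negPf c0).
have BAc : (B \o A)%VF = c *: \1%VF.
  have -> : A = c *: (B^-1)%VF.
    by rewrite -[LHS](lker0_compfK B0) ABc -comp_lfunZl comp_lfun1l.
  by rewrite -comp_lfunZr lker0_compfV.
case/eqP: nu0; apply/lfunP => y; rewrite zero_lfunE.
have := congr1 (fun C => ltr (C \o B)%VF) (nuA y).
rewrite hresE end_repE -comp_lfunZl comp_lfunDl comp_lfunNl linearB linearZ /=.
rewrite -!comp_lfunA [X in _ - X]ltrC -comp_lfunA BAc ABc ltr_scalar.
rewrite subrr => /esym/eqP.
by rewrite !mulf_eq0 (negPf c0) (negPf V_dim_neq0) !orbF => /eqP.
Qed.

Lemma ltr_comp_wproj0 A B : s_endo A -> s_endo B ->
  ltr (A \o B)%VF = ltr (wproj EC 0 A \o B)%VF.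
Proof.
move=> sA sB.
have -> : ltr (A \o B)%VF = \sum_(k <- wts EC) ltr (wproj EC k A \o B)%VF.
  rewrite -linear_sum /=; congr ltr; apply/lfunP => w.
  rewrite sum_lfunE comp_lfunE {1}[A](wproj_sum EC) sum_lfunE.
  by apply: eq_bigr => k _; rewrite comp_lfunE.
have k0 k : k != 0 -> ltr (wproj EC k A \o B)%VF = 0.
  by apply: ltr_comp_eq0; [apply: s_endo_wproj | | exact/E_diag/wproj_gwt].
have [w0|w0] := boolP (0 \in wts EC).
  by rewrite (bigD1_seq 0) ?wts_uniq //= big1 ?addr0.
rewrite (wproj_notin _ w0) comp_lfun0l linear0 big1_seq // => k /andP[_ kw].
by apply: k0; apply: contraNneq w0 => <-.
Qed.

(** Pairing [A] with the identity and with itself gives [tr A = c dim V] and [tr A = c tr A]. The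
    trace of an idempotent is its rank, so the two values of [c] correspond to rank zero and full
    rank. *)
Lemma s_endo_idem A : s_endo A -> (A \o A = A)%VF -> A = 0 \/ A = \1%VF.
Proof.
move=> sA AA.
have [c cE] := s_endo_scalar (s_endo_wproj 0 sA) (E_diag (wproj_gwt EC 0 A)).
have s1 : s_endo \1%VF by move=> x _; apply/end_rep0P => u; rewrite !id_lfunE.
have trA : ltr A = c * (\dim {:V})%:R.
  by have := ltr_comp_wproj0 sA s1; rewrite !comp_lfun1r cE ltr_scalar.
have := ltr_comp_wproj0 sA sA; rewrite AA cE -comp_lfunZl comp_lfun1l linearZ /= trA.
move=> /eqP; rewrite -subr_eq0 -[X in X - _]mul1r -mulrBl !mulf_eq0 subr_eq0.
rewrite (negPf V_dim_neq0) orbF => /orP[/eqP c1|/eqP c0].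
  right; apply/lfunP => w.
  have idA : limg A = fullv.
    apply/eqP; rewrite eqEdim subvf -(ler_nat F) -ltr_idem // trA -c1 mul1r.
    by rewrite lexx.
  have /memv_imgP[u _ ->] : w \in limg A by rewrite idA memvf.
  by rewrite id_lfunE -comp_lfunE AA.
left; apply/lfunP => w; rewrite zero_lfunE; apply/eqP; rewrite -memv0.
suff <- : limg A = 0%VS by apply: memv_img; apply: memvf.
by apply/eqP; rewrite -dimv_eq0 -(eqr_nat F) -ltr_idem // trA c0 mul0r.
Qed.

Lemma lowering_span_wide : wide rho s.
Proof.
move=> [U [W [[sU sW U0 W0] [UW UW0]]]].
pose p := daddv_pi U W.
have pU u : u \in U -> p u = u by apply: daddv_pi_id.
have pW w : w \in W -> p w = 0.
  move=> wW; have := daddv_pi_add UW0 (w := w); rewrite UW memvf => /(_ isT).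
  rewrite (daddv_pi_id _ wW) 1?capvC // => /eqP.
  by rewrite addrC -subr_eq0 addrAC subrr add0r => /eqP.
have sp : s_endo p.
  move=> x xs; apply/end_rep0P => z.
  have /memv_addP[u uU [w wW ->]] : z \in (U + W)%VS by rewrite UW memvf.
  rewrite !lfunD (pU u) // (pW w) // lfun0 addr0.
  by rewrite (pU _ (sU _ _ xs uU)) (pW _ (sW _ _ xs wW)) addr0.
have pp : (p \o p = p)%VF.
  by apply/lfunP => z; rewrite comp_lfunE pU // memv_pi.
have [p0|p1] := s_endo_idem sp pp.
  have [u uU /eqP] := vspace_neq0 U0; apply.
  by rewrite -(pU u uU) p0 zero_lfunE.
have [w wW /eqP] := vspace_neq0 W0; apply.
by rewrite -(pW w wW) p1 id_lfunE.
Qed.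

End Indecomposability.

Local Open Scope complex_scope.

Theorem theorem3p8
  (R : realType)
  (g : lieAlgType R[i]) (h : {vspace g})
  (D : seq 'Hom(subvs_of h, R[i]^o))
  (e : 'Hom(subvs_of h, R[i]^o) -> g)
  (T : set 'Hom(subvs_of h, R[i]^o)) (t : {vspace g})
  (l : 'Hom(subvs_of h, R[i]^o))
  (V : vectType R[i]) (rho : 'Hom(g, 'End(V))) (v : V)
  (g_semisimple : semisimple g)
  (h_cartan : cartan_subalgebra h)
  (D_base : root_base D)
  (e_root_vector : forall a, root_system a -> e a \in root_space a /\ e a <> 0)
  (T_closed : closed_roots T)
  (t_subalgebra : subalgebra t) (t_sub_h : (t <= h)%VS)
  (t_coroots : forall a, sym_part T a ->
     (lie_vspace (root_space a) (root_space (- a)) <= t)%VS)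
  (l_dominant : dominant_integral D l)
  (V_simple : simple_highest_weight_module rho D l v) :
  wide rho (regular_subalgebra T t) <->
  lowering_span rho D e (T `|` oppr_set T) v = {:V}%VS.
Proof.
split=> [V_wide|V_lowering].
  exact: (wide_lowering_span g_semisimple h_cartan D_base e_root_vector T_closed
    t_sub_h V_simple V_wide).
exact: (lowering_span_wide g_semisimple h_cartan D_base e_root_vector T_closed
  t_sub_h V_simple V_lowering).
Qed.
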